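(* Let $\{\phi_\alpha\}_{\alpha\in A}$ be a regular family of cardinal interpolators on $\mathbb{R}^n$ and let $f\in PW_\pi$. Then: (a) $\displaystyle \lim_{\alpha\to\infty}\Big\| \sum_{j\in\mathbb{Z}^n}f(j)L_{\phi_\alpha}(x-j) - f(x) \Big\|_{L^2(\mathbb{R}^n)} =0$; (b) $\displaystyle \lim_{\alpha\to\infty}\Big| \sum_{j\in\mathbb{Z}^n}f(j)L_{\phi_\alpha}(x-j) - f(x) \Big| =0$ uniformly for $x\in\mathbb{R}^n$.
   Context: Fourier transform: $\hat f(\xi)=(2\pi)^{-n/2}\int_{\mathbb{R}^n}f(x)e^{-ix\cdot\xi}\,dx$ for $f\in L^1(\mathbb{R}^n)$, extended to $L^2$ as usual. $\|\cdot\|$ is the Euclidean norm on $\mathbb{R}^n$; $\mathbb{N}_0=\{0,1,2,\dots\}$. Paley-Wiener space: $PW_\pi=\{f\in L^2(\mathbb{R}^n): \operatorname{supp}\hat f\subseteq[-\pi,\pi]^n\}$ (with its continuous representatives, so that $f(j)$ makes sense), normed by $\|f\|_{PW_\pi}=\|f\|_{L^2(\mathbb{R}^n)}$. Specialized Fourier transform: $\mathcal S$ is the Schwartz space, and $\mathcal S_m$ is the set of $\gamma\in\mathcal S$ with $\gamma(\xi)=O(\|\xi\|^m)$ as $\|\xi\|\to0$. For $\phi:\mathbb{R}^n\to\mathbb{C}$ continuous and slowly increasing (at most polynomial growth), a measurable function $\hat\phi\in L^2_{loc}(\mathbb{R}^n\setminus\{0\})$ is the specialized Fourier transform of $\phi$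 if there is a positive integer $m$ such that $\int_{\mathbb{R}^n}\phi(x)\hat\gamma(x)\,dx=\int_{\mathbb{R}^n}\hat\phi(\xi)\gamma(\xi)\,d\xi$ for all $\gamma\in\mathcal S_{2m}$. Cardinal interpolator: a function $\phi$ on $\mathbb{R}^n$, with specialized Fourier transform $\hat\phi$, such that (H1) $\phi$ is a real valued slowly increasing function on $\mathbb{R}^n$; (H2) $\hat\phi(\xi)\ge0$, and $\hat\phi(\xi)\ge\delta$ in $[-\pi,\pi]^n$ for some $\delta>0$; (H3) $\hat\phi\in C^{n+1}(\mathbb{R}^n\setminus\{0\})$; (H4) there is $\epsilon>0$ such that for all multi-indices $\beta$ with $|\beta|\le n+1$, $D^\beta\hat\phi(\xi)=O(\|\xi\|^{-(n+\epsilon)})$ as $\|\xi\|\to\infty$; (H5) for every multi-index $\beta$ with $|\beta|\le n+1$ and all $\beta_1,\dots,\beta_{|\beta|}\in\mathbb{N}_0^n$ with $\sum_{j=1}^{|\beta|}\beta_j=\beta$, the function $[\hat\phi(\xi)]^{-|\beta|-1}\prod_{j=1}^{|\beta|}D^{\beta_j}\hat\phi(\xi)$ belongs to $L^\infty([-\pi,\pi]^n)$. As $\hat\phi$ is a function on $\mathbb{R}^n\setminus\{0\}$, pointwise conditions and expressions involving $\hat\phi$ are understood where all its arguments are nonzero. Fundamental function: $L_\phi$ is defined through its Fourier transform $\hat L_\phi(\xi)=(2\pi)^{-n/2}\hat\phi(\xi)\big[\sum_{j\in\mathbb{Z}^n}\hat\phi(\xi-2\pi j)\big]^{-1}$, i.e.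 $L_\phi(x)=(2\pi)^{-n/2}\int_{\mathbb{R}^n}\hat L_\phi(\xi)e^{ix\cdot\xi}\,d\xi$. Regular family of cardinal interpolators: a family $\{\phi_\alpha\}_{\alpha\in A}$, with $A\subset(0,\infty)$ unbounded (discrete or continuous), such that each $\phi_\alpha$ is a cardinal interpolator and, with $M_{j,\alpha}(\xi)=\hat\phi_\alpha(\xi+2\pi j)/\hat\phi_\alpha(\xi)$ for $j\in\mathbb{Z}^n\setminus\{0\}$, $\xi\in[-\pi,\pi]^n$: (R1) for each $j\in\mathbb{Z}^n\setminus\{0\}$, $\lim_{\alpha\to\infty}M_{j,\alpha}(\xi)=0$ for almost every $\xi\in[-\pi,\pi]^n$; (R2) there is a sequence $(M_j)\in l^1(\mathbb{Z}^n\setminus\{0\})$, independent of $\alpha$, with $M_{j,\alpha}(\xi)\le M_j$ for all $j\in\mathbb{Z}^n\setminus\{0\}$ (all $\xi\in[-\pi,\pi]^n$, $\alpha\in A$). Limits $\alpha\to\infty$ are taken along $\alpha\in A$. *)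

(* Defs.v *)
From HB Require Import structures.
From mathcomp Require Import all_boot all_order all_algebra.
From mathcomp Require Import all_classical all_reals all_analysis.
From mathcomp Require Import complex finmap.
Set Implicit Arguments.
Unset Strict Implicit.
Unset Printing Implicit Defensive.
Import Order.TTheory GRing.Theory Num.Theory.
Import numFieldNormedType.Exports.
Local Open Scope classical_set_scope.
Local Open Scope ring_scope.

(* The real and imaginary parts, with values in R rather than R[i]. *)
Local Notation Re := complex.Re.
Local Notation Im := complex.Im.

(* Row vectors carry the product sigma-algebra, which for T = R is the Borel
   sigma-algebra of R^n. *)
Section measurable_rV.
Context d (T : measurableType d) (n : nat).

Let coord : 'I_n -> 'rV[T]_n -> T := fun i v => v ord0 i.

Let rV_set0 : g_sigma_preimage coord set0.
Proof. exact: sigma_algebra0. Qed.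

Let rV_setC A : g_sigma_preimage coord A -> g_sigma_preimage coord (~` A).
Proof. exact: sigma_algebraC. Qed.

Let rV_bigcup (F : (set 'rV[T]_n)^nat) :
  (forall i, g_sigma_preimage coord (F i)) ->
  g_sigma_preimage coord (\bigcup_i (F i)).
Proof. exact: sigma_algebra_bigcup. Qed.

HB.instance Definition _ := @isMeasurable.Build (measure_tuple_display d)
  'rV[T]_n (g_sigma_preimage coord) rV_set0 rV_setC rV_bigcup.

Lemma measurable_coord (i : 'I_n) :
  measurable_fun [set: 'rV[T]_n] (fun v : 'rV[T]_n => v ord0 i).
Proof.
move=> _ Y mY; rewrite setTI; apply: sub_sigma_algebra => /=.
rewrite -bigcup_seq/=; exists i => /=; first by rewrite mem_index_enum.
by exists Y => //; rewrite setTI.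
Qed.

Lemma measurable_fun_rV d' (S : measurableType d') (f : S -> 'rV[T]_n) :
  (forall i, measurable_fun [set: S] (fun x => f x ord0 i)) ->
  measurable_fun [set: S] f.
Proof.
move=> mf.
have H : g_sigma_preimage (fun i => coord i \o f) `<=` measurable.
  apply: smallest_sub; first exact: sigma_algebra_measurable.
  rewrite -bigcup_seq/=; apply: bigcup_sub => i _ A [B mB <-]; exact: mf.
case: (pselect ([set: S] !=set0)) => [|noS]; last first.
  move=> _ A mA; rewrite (_ : _ `&` _ = set0)//.
  by apply/seteqP; split=> // x; case: noS; exists x.
move=> _.
move=> _ A mA; apply: H.
have -> : g_sigma_preimage (fun i => coord i \o f) =
    preimage_set_system [set: S] f (g_sigma_preimage coord).
  exact: (@g_sigma_preimage_comp _ T n 'rV[T]_n coord S f).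
by exists A.
Qed.

End measurable_rV.

Section lebesgue_rV.
Context (R : realType).

Definition rV_cons n (p : measurableTypeR R * 'rV[R]_n) : 'rV[R]_n.+1 :=
  \row_(i < n.+1) oapp (fun j => p.2 ord0 j) p.1 (unlift ord0 i).

Lemma measurable_rV_cons n : measurable_fun setT (@rV_cons n).
Proof.
apply: measurable_fun_rV => i.
have [j ij|i0] := unliftP ord0 i.
- rewrite [X in measurable_fun _ X](_ : _ =
    (fun v => v ord0 j) \o (@snd _ 'rV[R]_n)).
    exact: measurableT_comp (measurable_coord _) measurable_snd.
  by apply/funext => x; rewrite mxE ij liftK.
- rewrite [X in measurable_fun _ X](_ : _ = fst); first exact: measurable_fst.
  by apply/funext => x; rewrite mxE i0 unlift_none.
Qed.

End lebesgue_rV.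

Section lebesgue_rVS.
Context (R : realType) (n : nat).
Variable mu : {sigma_finite_measure set 'rV[R]_n -> \bar R}.
Local Open Scope ereal_scope.

Definition lebesgue_rVS : set 'rV[R]_n.+1 -> \bar R :=
  pushforward (@lebesgue_measure R \x mu) (@rV_cons R n).

Let lebesgue_rVS0 : lebesgue_rVS set0 = 0.
Proof. by rewrite /lebesgue_rVS /pushforward preimage_set0 measure0. Qed.

Let lebesgue_rVS_ge0 A : 0 <= lebesgue_rVS A.
Proof. exact: (measure_ge0 (@lebesgue_measure R \x mu)). Qed.

Let lebesgue_rVS_sigma_additive : semi_sigma_additive lebesgue_rVS.
Proof.
move=> F mF tF mUF; rewrite /lebesgue_rVS /pushforward preimage_bigcup.
apply: measure_semi_sigma_additive.
- move=> k; rewrite -[X in measurable X]setTI; exact: measurable_rV_cons.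
- apply/trivIsetP => /= i j _ _ ij; rewrite -preimage_setI.
  by move/trivIsetP : tF => /(_ _ _ _ _ ij) ->//; rewrite preimage_set0.
- by rewrite -preimage_bigcup -[X in measurable X]setTI; exact: measurable_rV_cons.
Qed.

HB.instance Definition _ := isMeasure.Build _ _ _ lebesgue_rVS
  lebesgue_rVS0 lebesgue_rVS_ge0 lebesgue_rVS_sigma_additive.

Lemma rV_cons_preimage (A : 'I_n.+1 -> set R) :
  @rV_cons R n @^-1` [set v : 'rV[R]_n.+1 | forall i, A i (v ord0 i)] =
  A ord0 `*` [set v : 'rV[R]_n | forall i, A (lift ord0 i) (v ord0 i)].
Proof.
apply/seteqP; split=> [[x v] /= H|[x v] [/= H0 H] i].
  split=> [|i]; first by have := H ord0; rewrite mxE unlift_none.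
  by have := H (lift ord0 i); rewrite mxE liftK.
by rewrite mxE; case: unliftP => [j ->|->].
Qed.

Let lebesgue_rVS_sigma_finite : sigma_finite setT lebesgue_rVS.
Proof.
have /sigma_finiteP[F [TF ndF Foo]] := sigma_finiteT (@lebesgue_measure R).
have /sigma_finiteP[G [TG ndG Goo]] := sigma_finiteT mu.
pose uncons (v : 'rV[R]_n.+1) : measurableTypeR R * 'rV[R]_n :=
  (v ord0 ord0, \row_j v ord0 (lift ord0 j)).
have unconsK : cancel (@rV_cons R n) uncons.
  case=> x v; rewrite /uncons mxE unlift_none; congr pair.
  by apply/rowP => j; rewrite !mxE liftK.
have muncons : measurable_fun setT uncons.
  apply/measurable_fun_pairP; split.
    exact: (measurable_coord ord0).
  apply: measurable_fun_rV => i.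
  rewrite [X in measurable_fun _ X](_ : _ =
    (fun v : 'rV[R]_n.+1 => v ord0 (lift ord0 i))).
    exact: measurable_coord.
  by apply/funext => v; rewrite /= mxE.
exists (fun k => uncons @^-1` (F k `*` G k)).
  apply/esym/seteqP; split=> // v _.
  have [i _ Fi] : (\bigcup_k F k) (uncons v).1 by rewrite -TF.
  have [j _ Gj] : (\bigcup_k G k) (uncons v).2 by rewrite -TG.
  exists (maxn i j) => //; split.
    by move: Fi; exact/subsetPset/ndF/leq_maxl.
  by move: Gj; exact/subsetPset/ndG/leq_maxr.
move=> k; have [mFk Fk] := Foo k; have [mGk Gk] := Goo k; split.
  by rewrite -[X in measurable X]setTI; apply: muncons => //; exact: measurableX.
rewrite /lebesgue_rVS /pushforward -comp_preimage.
rewrite (_ : _ \o _ = id) ?preimage_id; last first.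
  by apply/funext => p; rewrite /= unconsK.
by rewrite product_measure1E// lte_mul_pinfty// ge0_fin_numE.
Qed.

HB.instance Definition _ := Measure_isSigmaFinite.Build _ _ _ lebesgue_rVS
  lebesgue_rVS_sigma_finite.

End lebesgue_rVS.

(* Lebesgue measure on R^n, as an iterated product; see lebesgue_rV_box. *)
Fixpoint lebesgue_rV (R : realType) (n : nat) :
    {sigma_finite_measure set 'rV[R]_n -> \bar R} :=
  match n with
  | 0%N => \d_(0 : 'rV[R]_0)
  | n'.+1 => lebesgue_rVS (lebesgue_rV R n')
  end.

Lemma measurable_box (R : realType) n (A : 'I_n -> set R) :
  (forall i, measurable (A i)) ->
  measurable [set v : 'rV[R]_n | forall i, A i (v ord0 i)].
Proof.
move=> mA; rewrite (_ : mkset _ =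
  \bigcap_(i in [set: 'I_n]) ((fun v : 'rV[R]_n => v ord0 i) @^-1` A i)).
  apply: fin_bigcap_measurable => // i _.
  by rewrite -[X in measurable X]setTI; exact: measurable_coord.
by apply/seteqP; split=> v /= H i => [_|]; exact: H.
Qed.

Lemma lebesgue_rV_box (R : realType) n (A : 'I_n -> set R) :
  (forall i, measurable (A i)) ->
  lebesgue_rV R n [set v | forall i, A i (v ord0 i)] =
  (\prod_(i < n) @lebesgue_measure R (A i))%E.
Proof.
elim: n A => [|n ih] A mA.
  rewrite big_ord0 /= diracE mem_set//; by case.
rewrite big_ord_recl /= /lebesgue_rVS /pushforward rV_cons_preimage.
rewrite product_measure1E; first by rewrite (ih (fun i => A (lift ord0 i))).
- exact: mA.
- by apply: (@measurable_box R n (fun i => A (lift ord0 i))).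
Qed.

Section euclidean_space.
Context {R : realType} {n : nat}.
Implicit Types (x y : 'rV[R]_n) (j : 'rV[int]_n).

Definition dot x y : R := \sum_i x ord0 i * y ord0 i.

(* The library norm `|x| of a row vector is the sup norm. *)
Definition enorm x : R := Num.sqrt (dot x x).

Definition cube : set 'rV[R]_n :=
  [set x | forall i, - pi <= x ord0 i <= pi].

Definition lat j : 'rV[R]_n := map_mx intr j.

End euclidean_space.

Section calculus.
Context {R : realType} {n : nat}.
Implicit Types (f : 'rV[R]_n -> R) (b : {ffun 'I_n -> nat}).

Definition mdeg b : nat := (\sum_i b i)%N.

Definition partials (s : seq 'I_n) f : 'rV[R]_n -> R :=
  foldr (fun i g => 'D_(delta_mx ord0 i) g) f s.

Definition mderiv b f : 'rV[R]_n -> R :=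
  partials (flatten [seq nseq (b i) i | i <- enum 'I_n]) f.

(* f is of class C^k on U (meant for open U): all partial derivatives of order
   at most k, in any order of differentiation, exist and are continuous on U. *)
Definition class_C (k : nat) (U : set 'rV[R]_n) f :=
  forall s : seq 'I_n, (size s <= k)%N -> forall x, U x ->
    {for x, continuous (partials s f)} /\
    ((size s < k)%N -> forall i, derivable (partials s f) x (delta_mx ord0 i)).

Definition schwartz_re f :=
  (forall k, class_C k setT f) /\
  (forall k b, exists C : R, forall x, enorm x ^+ k * `|mderiv b f x| <= C).

End calculus.

Section complex_functions.
Context {R : realType} {n : nat}.
Local Notation mu := (lebesgue_rV R n).
Implicit Types f g : 'rV[R]_n -> R[i].

(* R[i] carries no measurable structure and is not a normed space over R in the
   libraries, so measurability, smoothness and integration are componentwise. *)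
Definition Ccontinuous f :=
  continuous (fun x => Re (f x)) /\ continuous (fun x => Im (f x)).

Definition Cmeasurable (D : set 'rV[R]_n) f :=
  measurable_fun D (fun x => Re (f x)) /\ measurable_fun D (fun x => Im (f x)).

Definition Cintegrable f :=
  mu.-integrable setT (fun x => (Re (f x))%:E) /\
  mu.-integrable setT (fun x => (Im (f x))%:E).

Definition Cintegral f : R[i] :=
  ((\int[mu]_x Re (f x)) +i* (\int[mu]_x Im (f x)))%C.

Definition L2norm f : \bar R :=
  ('N[mu]_2%:E[EFin \o (fun x => Normc.normc (f x))])%E.

Definition in_L2 f := Cmeasurable setT f /\ (L2norm f < +oo)%E.

Definition cis (t : R) : R[i] := (cos t +i* sin t)%C.

Definition fourier_const : R := (2 * pi) `^ (- (n%:R / 2)).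

(* The integral transforms, meaningful for integrable f. *)
Definition fourier f (xi : 'rV[R]_n) : R[i] :=
  (fourier_const%:C)%C * Cintegral (fun x => f x * cis (- dot x xi)).

Definition inverse_fourier f (x : 'rV[R]_n) : R[i] :=
  (fourier_const%:C)%C * Cintegral (fun xi => f xi * cis (dot x xi)).

(* g is the Fourier transform of f in L^2: the extension by continuity of the
   transform on L^1 /\ L^2. As an element of L^2, g is determined up to null
   sets. *)
Definition L2_fourier f g :=
  [/\ in_L2 f, in_L2 g & exists u : nat -> 'rV[R]_n -> R[i],
    [/\ forall k, Cintegrable (u k) /\ in_L2 (u k),
        L2norm (fun x => u k x - f x) @[k --> \oo] --> 0%E &
        L2norm (fun xi => fourier (u k) xi - g xi) @[k --> \oo] --> 0%E]].

(* For a closed set D, an L^2 class has support in D iff it vanishes almost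
   everywhere off D. *)
Definition supported_in (D : set 'rV[R]_n) f :=
  {ae mu, forall x, ~ D x -> f x = 0}.

Definition paley_wiener f :=
  [/\ Ccontinuous f, in_L2 f &
      exists2 fhat, L2_fourier f fhat & supported_in cube fhat].

Definition schwartz f :=
  schwartz_re (fun x => Re (f x)) /\ schwartz_re (fun x => Im (f x)).

Definition schwartz_vanishing (m : nat) f :=
  schwartz f /\
  exists C : R, \forall x \near (0 : 'rV[R]_n),
    Normc.normc (f x) <= C * enorm x ^+ m.

Definition slowly_increasing f :=
  exists (C : R) (k : nat), forall x,
    Normc.normc (f x) <= C * (1 + enorm x) ^+ k.

(* L^2_loc (R^n \ {0}): square integrable on the compact subsets. *)
Definition L2loc_punctured f :=
  Cmeasurable (~` [set 0]) f /\
  forall K : set 'rV[R]_n, compact K -> K `<=` ~` [set 0] ->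
    (\int[mu]_(x in K) (Normc.normc (f x) ^+ 2)%:E < +oo)%E.

(* The value of phihat at 0 is irrelevant. *)
Definition specialized_fourier (phi phihat : 'rV[R]_n -> R[i]) :=
  [/\ Ccontinuous phi, slowly_increasing phi, L2loc_punctured phihat &
      exists2 m : nat, (0 < m)%N &
      forall gamma, schwartz_vanishing (2 * m) gamma ->
        [/\ Cintegrable (fun x => phi x * fourier gamma x),
            Cintegrable (fun xi => phihat xi * gamma xi) &
            Cintegral (fun x => phi x * fourier gamma x) =
            Cintegral (fun xi => phihat xi * gamma xi)]].

(* Unconditional convergence of a series over Z^n. *)
Definition lattice_sums_to (a : 'rV[int]_n -> R[i]) (s : R[i]) :=
  forall e : R, 0 < e -> exists J0 : {fset 'rV[int]_n},
    forall J : {fset 'rV[int]_n}, (J0 `<=` J)%fset ->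
      Normc.normc (\sum_(j <- J) a j - s) < e.

(* 0 when the series does not converge. *)
Definition lattice_sum (a : 'rV[int]_n -> R[i]) : R[i] :=
  xget 0 [set s | lattice_sums_to a s].

End complex_functions.

Section cardinal_interpolation.
Context {R : realType} {n : nat}.
Local Notation mu := (lebesgue_rV R n).
Local Notation punctured := (~` [set 0] : set 'rV[R]_n).

Definition in_Linfty (D : set 'rV[R]_n) (g : 'rV[R]_n -> R) :=
  measurable_fun D g /\
  exists C : R, {ae mu, forall x, D x -> `|g x| <= C}.

(* phihat stands for a function on R^n \ {0}: its value at 0 is arbitrary, and
   no clause constrains it. *)
Record cardinal_interpolator (phi phihat : 'rV[R]_n -> R) : Prop := {
  ci_fourier :
    specialized_fourier (fun x => ((phi x)%:C)%C) (fun x => ((phihat x)%:C)%C) ;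
  ci_slow : slowly_increasing (fun x => ((phi x)%:C)%C) ;
  ci_ge0 : forall xi, xi != 0 -> 0 <= phihat xi ;
  ci_bounded_below : exists2 delta : R, 0 < delta &
    forall xi, cube xi -> xi != 0 -> delta <= phihat xi ;
  ci_smooth : class_C n.+1 punctured phihat ;
  ci_decay : exists2 eps : R, 0 < eps &
    forall b : {ffun 'I_n -> nat}, (mdeg b <= n.+1)%N ->
      exists C K : R, forall xi, K <= enorm xi ->
        `|mderiv b phihat xi| <= C * enorm xi `^ (- (n%:R + eps)) ;
  ci_quotients : forall b : {ffun 'I_n -> nat}, (mdeg b <= n.+1)%N ->
    forall bs : 'I_(mdeg b) -> {ffun 'I_n -> nat}, \sum_k bs k = b ->
      in_Linfty cube (fun xi =>
        phihat xi ^- (mdeg b).+1 * \prod_k mderiv (bs k) phihat xi) }.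

(* The points xi of 2 pi Z^n, where phihat is evaluated at 0, form a null set. *)
Definition fundamental_hat (phihat : 'rV[R]_n -> R) (xi : 'rV[R]_n) : R :=
  @fourier_const R n * phihat xi /
  fine (\esum_(j in [set: 'rV[int]_n]) (phihat (xi - (2 * pi) *: lat j))%:E)%E.

Definition fundamental (phihat : 'rV[R]_n -> R) : 'rV[R]_n -> R[i] :=
  inverse_fourier (fun xi => ((fundamental_hat phihat xi)%:C)%C).

Definition fourier_ratio (phihat : 'rV[R]_n -> R) (j : 'rV[int]_n)
    (xi : 'rV[R]_n) : R :=
  phihat (xi + (2 * pi) *: lat j) / phihat xi.

Record regular_family (A : set R) (phi phihat : R -> 'rV[R]_n -> R) : Prop := {
  rf_pos : A `<=` [set a | 0 < a] ;
  rf_unbounded : ~ has_ubound A ;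
  rf_cardinal : forall a, A a -> cardinal_interpolator (phi a) (phihat a) ;
  rf_limit : forall j : 'rV[int]_n, j != 0 ->
    {ae mu, forall xi, cube xi ->
      fourier_ratio (phihat a) j xi @[a --> within A +oo] --> (0 : R)} ;
  rf_dominated : exists2 M : 'rV[int]_n -> R,
    summable [set j | j != 0] (fun j => (M j)%:E) &
    forall a j xi, A a -> j != 0 -> cube xi -> xi != 0 ->
      fourier_ratio (phihat a) j xi <= M j }.

Definition interpolation_terms (phihat : 'rV[R]_n -> R)
    (f : 'rV[R]_n -> R[i]) (x : 'rV[R]_n) (j : 'rV[int]_n) : R[i] :=
  f (lat j) * fundamental phihat (x - lat j).

Definition interpolant (phihat : 'rV[R]_n -> R) (f : 'rV[R]_n -> R[i])
    (x : 'rV[R]_n) : R[i] :=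
  lattice_sum (interpolation_terms phihat f x).

End cardinal_interpolation.

(* Main.v *)
Require Import Defs.
From mathcomp Require Import all_boot all_order all_algebra.
From mathcomp Require Import all_classical all_reals all_analysis.
From mathcomp Require Import complex finmap.
From mathcomp Require Import measurable_realfun ring lra.
Set Implicit Arguments.
Unset Strict Implicit.
Unset Printing Implicit Defensive.
Import Order.TTheory GRing.Theory Num.Theory.
Import numFieldNormedType.Exports.
Local Open Scope classical_set_scope.
Local Open Scope ring_scope.

(** Write [T] for the torus [-pi, pi[^n and [c] for the constant of the Fourier
    transform. As the transform of [f] is square integrable with support in the
    cube, [f] is the absolutely convergent integral of [c F(xi) e^(i x xi)] over
    [T], where [F] is the 2 pi Z^n-periodic extension of that transform
    ([paley_wiener_inversion]); so the samples of [f] are the Fourier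
    coefficients of [F] ([coef_periodized]).

    The transform of a fundamental function is [c s], where the weight [s] takes
    values in [0, 1] and adds up to 1 along every coset of 2 pi Z^n
    ([fundamental_weighted], [weight_partition]). Integrating a periodic
    function against such a weight over R^n is integrating it over [T]
    ([integral_periodic_weight]), so the L^2 convergence of the Fourier series
    of [F] gives the sum of the interpolation series: it is the integral of
    [c s(xi) F(xi) e^(i x xi)] over R^n ([weighted_series]).

    The error is therefore an integral against [s - 1_T]. The mass of [s] off
    [T] is the mass [1 - s] that is missing on [T], hence the error at every
    point is at most [c] times the integral of [2 (1 - s) |F|] over [T]
    ([weighted_error_sup]). For the L^2 norm, fix [x] and test the values of the
    error at finitely many points of [x + Z^n] against the trigonometric
    polynomial [P] that has these values as coefficients: their sum of squares
    is the integral of [s - 1_T] times [F], the conjugate of [P] and a factor of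
    modulus 1, and Parseval's identity for [P] bounds it by the integral of [|2 (1 - s) F|^2] over [T]
    ([error_coset_sum]). Integration over [x] in the unit cube bounds the L^2
    norm ([weighted_error_L2]).

    Both bounds tend to 0 by dominated convergence. Indeed [1 - s] is at most
    the sum of the ratios of the transform at the other points of a coset to its
    value in the cube ([weight_near1]); each ratio tends to 0 almost everywhere,
    and together they are dominated by a summable family ([deficit_cvg0]). A
    limit over a possibly uncountable parameter reduces to limits along
    sequences ([near_within_pinfty]).

    Two classical theorems carry the first two paragraphs. The inversion formula
    ([L2_fourier_inversion]) comes from Gaussian regularization. The
    completeness of the trigonometric system ([approximable_tL2]) holds because
    the sets whose indicator is a limit of trigonometric polynomials form a
    sigma-algebra, and polynomials in the sine and cosine of a coordinate
    produce the half-spaces. *)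

Local Notation Re := complex.Re.
Local Notation Im := complex.Im.
Local Notation normc := Normc.normc.

(** * Complex numbers and complex integrals *)

Section complex_numbers.
Context {R : realType}.
Implicit Types z w : R[i].

(** The squared modulus, as a polynomial in the real and imaginary parts. *)
Definition nsq z : R := Re z ^+ 2 + Im z ^+ 2.

Lemma nsq_ge0 z : 0 <= nsq z.
Proof. by rewrite addr_ge0// sqr_ge0. Qed.

Lemma normcE z : normc z = Num.sqrt (nsq z).
Proof. by case: z. Qed.

Lemma sqr_normc z : normc z ^+ 2 = nsq z.
Proof. by rewrite normcE sqr_sqrtr// nsq_ge0. Qed.

Lemma normc_ge0 z : 0 <= normc z.
Proof. by rewrite normcE sqrtr_ge0. Qed.

Lemma ReM z w : Re (z * w) = Re z * Re w - Im z * Im w.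
Proof. by case: z w => [a b] [c d]. Qed.

Lemma ImM z w : Im (z * w) = Re z * Im w + Im z * Re w.
Proof. by case: z w => [a b] [c d]. Qed.

Lemma ReD z w : Re (z + w) = Re z + Re w.
Proof. by case: z w => [a b] [c d]. Qed.

Lemma ImD z w : Im (z + w) = Im z + Im w.
Proof. by case: z w => [a b] [c d]. Qed.

Lemma ReN z : Re (- z) = - Re z.
Proof. by case: z. Qed.

Lemma ImN z : Im (- z) = - Im z.
Proof. by case: z. Qed.

Lemma complex_eqP z w : Re z = Re w -> Im z = Im w -> z = w.
Proof. by case: z w => [a b] [c d] /= -> ->. Qed.

Lemma nsqM z w : nsq (z * w) = nsq z * nsq w.
Proof. by rewrite /nsq ReM ImM; ring. Qed.

Lemma nsqN z : nsq (- z) = nsq z.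
Proof. by rewrite /nsq ReN ImN !sqrrN. Qed.

Lemma nsq_real (t : R) : nsq ((t%:C)%C) = t ^+ 2.
Proof. by rewrite /nsq /= expr0n addr0. Qed.

Lemma nsqD_le z w : nsq (z + w) <= 2 * nsq z + 2 * nsq w.
Proof.
rewrite /nsq ReD ImD -subr_ge0 (_ : _ - _ =
  (Re z - Re w) ^+ 2 + (Im z - Im w) ^+ 2); last by ring.
by rewrite addr_ge0 ?sqr_ge0.
Qed.

Lemma normr_Re_le z : `|Re z| <= normc z.
Proof. by rewrite normcE -sqrtr_sqr ler_wsqrtr// lerDl sqr_ge0. Qed.

Lemma normr_Im_le z : `|Im z| <= normc z.
Proof. by rewrite normcE -sqrtr_sqr ler_wsqrtr// lerDr sqr_ge0. Qed.

Lemma normc_le_ReIm z : normc z <= `|Re z| + `|Im z|.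
Proof.
rewrite normcE -[leRHS]ger0_norm ?addr_ge0// -sqrtr_sqr ler_wsqrtr//.
rewrite /nsq -(real_normK (num_real (Re z))) -(real_normK (num_real (Im z))).
rewrite sqrrD -addrA [X in _ <= _ + X]addrC lerD2l lerDl.
by rewrite mulrn_wge0// mulr_ge0.
Qed.

Lemma normc_triangle z w : normc (z + w) <= normc z + normc w.
Proof. exact: le_normcD. Qed.

Lemma normc_opp z : normc (- z) = normc z.
Proof. exact: normcN. Qed.

Lemma normc_real (x : R) : normc (x%:C)%C = `|x|.
Proof. by rewrite normcE /nsq /= expr0n addr0 sqrtr_sqr. Qed.

Lemma normc_conj z : normc (z^*)%C = normc z.
Proof. by case: z => a b /=; rewrite sqrrN. Qed.

Lemma conj_mul_nsq z : z * (z^*)%C = ((nsq z)%:C)%C.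
Proof. by apply: complex_eqP; rewrite ?ReM ?ImM; case: z => a b /=; rewrite /nsq/=; ring. Qed.

Lemma normc_sum (I : Type) (r : seq I) (F : I -> R[i]) :
  normc (\sum_(i <- r) F i) <= \sum_(i <- r) normc (F i).
Proof.
elim/big_rec2 : _ => [|i y1 y2 _ le12]; first by rewrite Normc.normc0.
by rewrite (le_trans (normc_triangle _ _))// lerD2l.
Qed.

Lemma normc_cis (t : R) : normc (cis t) = 1.
Proof. by rewrite /= cos2Dsin2 sqrtr1. Qed.

Lemma nsq_cis (t : R) : nsq (cis t) = 1.
Proof. exact: cos2Dsin2. Qed.

Lemma cisD (s t : R) : cis (s + t) = cis s * cis t.
Proof. by apply: complex_eqP; rewrite ?ReM ?ImM /= ?cosD ?sinD//; ring. Qed.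

Lemma cis0 : cis (0 : R) = 1.
Proof. by apply: complex_eqP; rewrite /= ?cos0 ?sin0. Qed.

Lemma cisN (t : R) : cis (- t) = ((cis t)^*)%C.
Proof. by apply: complex_eqP; rewrite /= ?cosN ?sinN. Qed.

Lemma cis_2pi_int (k : int) : cis (2 * pi * k%:~R : R) = 1.
Proof.
have nat_case (m : nat) : cis (2 * pi * m%:R : R) = 1.
  elim: m => [|m ih]; first by rewrite mulr0 cis0.
  rewrite (mulrSr _ m) mulrDr cisD ih mul1r mulr1.
  by apply: complex_eqP; rewrite /= mulr_natl ?cos2pi ?sin2pi.
case: k => m; first exact: nat_case.
by rewrite NegzE mulrNz mulrN cisN nat_case conjc1.
Qed.

End complex_numbers.

Section complex_integral.
Context d {T : measurableType d} {R : realType}.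
Variable mu : {measure set T -> \bar R}.
Implicit Types f g u : T -> R[i].

(** Over an arbitrary measure, to serve on R, on R^n and on products. On R^n
    these notions unfold to [Cmeasurable setT], [Cintegrable] and [Cintegral]. *)
Definition cmeas f :=
  measurable_fun setT (fun x => Re (f x)) /\
  measurable_fun setT (fun x => Im (f x)).

Definition cintable f :=
  mu.-integrable setT (fun x => (Re (f x))%:E) /\
  mu.-integrable setT (fun x => (Im (f x))%:E).

Definition cint f : R[i] :=
  ((\int[mu]_x Re (f x)) +i* (\int[mu]_x Im (f x)))%C.

Lemma cmeasD f g : cmeas f -> cmeas g -> cmeas (fun x => f x + g x).
Proof.
move=> [rf jf] [rg jg]; split.
  by under eq_fun do rewrite ReD; exact: measurable_funD.
by under eq_fun do rewrite ImD; exact: measurable_funD.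
Qed.

Lemma cmeasM f g : cmeas f -> cmeas g -> cmeas (fun x => f x * g x).
Proof.
move=> [rf jf] [rg jg]; split.
  by under eq_fun do rewrite ReM; apply: measurable_funB; exact: measurable_funM.
by under eq_fun do rewrite ImM; apply: measurable_funD; exact: measurable_funM.
Qed.

Lemma cmeas_comp d' (T' : measurableType d') (h : T' -> T) f :
  cmeas f -> measurable_fun setT h ->
  measurable_fun setT (fun x => Re (f (h x))) /\ measurable_fun setT (fun x => Im (f (h x))).
Proof.
move=> [rf jf] mh; split; [exact: (measurableT_comp rf mh)|exact: (measurableT_comp jf mh)].
Qed.

Lemma cmeas_cst z : cmeas (fun=> z).
Proof. by split; exact: measurable_cst. Qed.

Lemma cmeasN f : cmeas f -> cmeas (fun x => - f x).
Proof.
move=> [rf jf]; split.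
  by under eq_fun do rewrite ReN; exact: measurableT_comp.
by under eq_fun do rewrite ImN; exact: measurableT_comp.
Qed.

Lemma cmeasB f g : cmeas f -> cmeas g -> cmeas (fun x => f x - g x).
Proof. by move=> mf mg; apply: cmeasD => //; exact: cmeasN. Qed.

Lemma cmeas_conj f : cmeas f -> cmeas (fun x => (f x)^*%C).
Proof.
move=> [rf jf]; split.
  by apply: eq_measurable_fun rf => x _; case: (f x).
apply: (@eq_measurable_fun _ _ _ _ _ (fun x => - Im (f x))).
  by move=> x _; case: (f x).
exact: measurableT_comp.
Qed.

Lemma cmeas_real (h : T -> R) : measurable_fun setT h ->
  cmeas (fun x => ((h x)%:C)%C).
Proof. by move=> mh; split => //=; exact: measurable_cst. Qed.

Lemma cmeas_cis (h : T -> R) : measurable_fun setT h ->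
  cmeas (fun x => cis (h x)).
Proof.
move=> mh; split => /=.
  by apply: measurableT_comp => //; apply: continuous_measurable_fun; exact: continuous_cos.
by apply: measurableT_comp => //; apply: continuous_measurable_fun; exact: continuous_sin.
Qed.

Lemma measurable_nsq f : cmeas f -> measurable_fun setT (fun x => nsq (f x)).
Proof.
by move=> [rf jf]; apply: measurable_funD; exact: measurable_funX.
Qed.

Lemma measurable_normc f : cmeas f -> measurable_fun setT (fun x => normc (f x)).
Proof.
move=> mf; under eq_fun do rewrite normcE.
apply: (@measurableT_comp _ _ _ _ _ _ (@Num.sqrt R) _ (fun x => nsq (f x))).
  by apply: continuous_measurable_fun; exact: sqrt_continuous.
exact: measurable_nsq.
Qed.

(** The parts are dominated by the modulus, and the modulus by the sum of the
    moduli of the parts. *)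
Lemma cintableP f : cintable f <->
  cmeas f /\ (\int[mu]_x (normc (f x))%:E < +oo)%E.
Proof.
split=> [[rf jf]|[[mr mi] fin]].
  have mf : cmeas f.
    by split; apply/measurable_EFinP; apply: (measurable_int mu).
  split => //.
  move: rf jf => /integrableP[_ rf] /integrableP[_ jf].
  apply: (@le_lt_trans _ _ (\int[mu]_x (`|(Re (f x))%:E| + `|(Im (f x))%:E|)%E)%E).
    apply: ge0_le_integral => //.
    - by move=> x _; rewrite lee_fin normc_ge0.
    - by apply/measurable_EFinP; exact: measurable_normc.
    - by apply: emeasurable_funD; apply: measurableT_comp => //;
        apply/measurable_EFinP; case: mf.
    - by move=> x _; rewrite lee_fin; exact: normc_le_ReIm.
  rewrite ge0_integralD//; first exact: lte_add_pinfty.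
  - by apply: measurableT_comp => //; apply/measurable_EFinP; case: mf.
  - by apply: measurableT_comp => //; apply/measurable_EFinP; case: mf.
split; apply/integrableP; (split; first exact/measurable_EFinP);
  apply: le_lt_trans fin; apply: ge0_le_integral => //.
- by apply: measurableT_comp => //; exact/measurable_EFinP.
- by apply/measurable_EFinP; exact: measurable_normc.
- by move=> x _; rewrite /= lee_fin; exact: normr_Re_le.
- by apply: measurableT_comp => //; exact/measurable_EFinP.
- by apply/measurable_EFinP; exact: measurable_normc.
- by move=> x _; rewrite /= lee_fin; exact: normr_Im_le.
Qed.

Lemma cintable_le f (h : T -> R) : cmeas f -> (forall x, normc (f x) <= h x) ->
  mu.-integrable setT (EFin \o h) -> cintable f.
Proof.
move=> mf fh /integrableP[mh fin]; apply/cintableP; split => //.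
apply: le_lt_trans fin; apply: ge0_le_integral => //.
- by move=> x _; rewrite lee_fin normc_ge0.
- by apply/measurable_EFinP; exact: measurable_normc.
- exact: measurableT_comp.
- by move=> x _; rewrite /= lee_fin (le_trans (fh x)) ?ler_norm.
Qed.

Lemma cintable_normc f : cintable f ->
  mu.-integrable setT (fun x => (normc (f x))%:E).
Proof.
move=> /cintableP[mf fin]; apply/integrableP; split.
  by apply/measurable_EFinP; exact: measurable_normc.
by under eq_integral do rewrite gee0_abs ?lee_fin ?normc_ge0//.
Qed.

Lemma cintableD f g : cintable f -> cintable g -> cintable (fun x => f x + g x).
Proof.
move=> [rf jf] [rg jg]; split.
  under eq_fun do rewrite ReD EFinD; exact: integrableD.
under eq_fun do rewrite ImD EFinD; exact: integrableD.
Qed.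

Lemma cintableZ z f : cintable f -> cintable (fun x => z * f x).
Proof.
move=> /[dup] intf /cintableP[mf _].
apply: (@cintable_le _ (fun x => normc z * normc (f x))).
- exact: cmeasM (cmeas_cst _) mf.
- by move=> x; rewrite Normc.normcM.
- exact: (integrableZl measurableT (normc z) (cintable_normc intf)).
Qed.

Lemma cintable_mul_le1 u f : cmeas u -> (forall x, normc (u x) <= 1) ->
  cintable f -> cintable (fun x => u x * f x).
Proof.
move=> mu_ u1 intf; have [mf _] := (cintableP f).1 intf.
apply: (cintable_le (h := fun x => normc (f x))); first exact: cmeasM.
  by move=> x; rewrite Normc.normcM ler_piMl ?normc_ge0.
exact: cintable_normc.
Qed.

Lemma cintableN f : cintable f -> cintable (fun x => - f x).
Proof. by move=> /(cintableZ (-1)); under eq_fun do rewrite mulN1r. Qed.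

Lemma cintableB f g : cintable f -> cintable g -> cintable (fun x => f x - g x).
Proof. by move=> intf intg; apply: cintableD => //; exact: cintableN. Qed.

Lemma cintable_sum (I : Type) (r : seq I) (F : I -> T -> R[i]) :
  (forall i, cintable (F i)) -> cintable (fun x => \sum_(i <- r) F i x).
Proof.
move=> mF; elim: r => [|i r ih].
  under eq_fun do rewrite big_nil.
  by split; exact: integrable0.
by under eq_fun do rewrite big_cons; apply: cintableD.
Qed.

Lemma cintD f g : cintable f -> cintable g ->
  cint (fun x => f x + g x) = cint f + cint g.
Proof.
move=> [rf jf] [rg jg]; apply: complex_eqP => /=.
  by under eq_Rintegral do rewrite ReD; rewrite RintegralD.
by under eq_Rintegral do rewrite ImD; rewrite RintegralD.
Qed.

Lemma cintZ z f : cintable f -> cint (fun x => z * f x) = z * cint f.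
Proof.
move=> [rf jf]; have Z (a : R) (h : T -> R) : mu.-integrable setT (EFin \o h) ->
    mu.-integrable setT (EFin \o (fun x => a * h x)).
  by move=> ih; apply: (integrableZl measurableT a ih).
apply: complex_eqP; rewrite ?ReM ?ImM /=.
  under eq_Rintegral do rewrite ReM.
  by rewrite RintegralB ?RintegralZl//; exact: Z.
under eq_Rintegral do rewrite ImM.
by rewrite RintegralD ?RintegralZl//; exact: Z.
Qed.

Lemma cintN f : cintable f -> cint (fun x => - f x) = - cint f.
Proof.
move=> intf; rewrite -mulN1r -cintZ//; congr cint.
by apply/funext => x; rewrite mulN1r.
Qed.

Lemma cintB f g : cintable f -> cintable g ->
  cint (fun x => f x - g x) = cint f - cint g.
Proof.
by move=> intf intg; rewrite cintD// ?cintN//; exact: cintableN.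
Qed.

Lemma cint_sum (I : Type) (r : seq I) (F : I -> T -> R[i]) :
  (forall i, cintable (F i)) ->
  cint (fun x => \sum_(i <- r) F i x) = \sum_(i <- r) cint (F i).
Proof.
move=> mF; elim: r => [|i r ih].
  rewrite big_nil (_ : (fun x => _) = fun=> 0); last first.
    by apply/funext => x; rewrite big_nil.
  by apply: complex_eqP => /=; rewrite Rintegral_cst// mul0r.
rewrite big_cons -ih -cintD//; last exact: cintable_sum.
by congr cint; apply/funext => x; rewrite big_cons.
Qed.

Lemma ae_eq_cint f g : cmeas f -> cmeas g ->
  {ae mu, forall x, f x = g x} -> cint f = cint g.
Proof.
move=> [rf jf] [rg jg] fg; apply: complex_eqP => /=; congr fine.
  apply: ae_eq_integral => //; [exact/measurable_EFinP..|].
  by apply: filterS fg => x -> _.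
apply: ae_eq_integral => //; [exact/measurable_EFinP..|].
by apply: filterS fg => x -> _.
Qed.

Lemma normc_cint_le f : cintable f ->
  ((normc (cint f))%:E <= \int[mu]_x (normc (f x))%:E)%E.
Proof.
move=> intf; have [mf fin] := (cintableP f).1 intf.
set z := cint f.
have [->|z0] := eqVneq (normc z) 0.
  by apply: integral_ge0 => x _; rewrite lee_fin normc_ge0.
(* rotate so that the integral becomes a nonnegative real number *)
pose w : R[i] := (((normc z)^-1)%:C * z^*)%C.
have wz : w * z = ((normc z)%:C)%C.
  rewrite /w -mulrA [_^*%C * _]mulrC conj_mul_nsq -sqr_normc.
  apply: complex_eqP; rewrite ?ReM ?ImM /=; last by rewrite mulr0 mul0r addr0.
  by rewrite mul0r subr0 expr2 mulKf.
have nw : normc w = 1.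
  rewrite /w Normc.normcM normc_real normc_conj ger0_norm ?invr_ge0 ?normc_ge0//.
  by rewrite mulVf.
have iw : cintable (fun x => w * f x) := cintableZ w intf.
have -> : normc z = Re (cint (fun x => w * f x)) by rewrite cintZ// -/z wz.
rewrite /= fineK; last by apply: integrable_fin_num => //; case: iw.
apply: le_integral => //; first by case: iw.
  exact: cintable_normc.
move=> x _; rewrite lee_fin (le_trans (ler_norm _))//.
by rewrite (le_trans (normr_Re_le _))// Normc.normcM nw mul1r.
Qed.

End complex_integral.

(** * Lebesgue measure on R^n *)

Section lebesgue_space.
Context {R : realType}.
Local Notation mu n := (lebesgue_rV R n).

Lemma measurable_addv n (a : 'rV[R]_n) :
  measurable_fun setT (fun x : 'rV[R]_n => x + a).
Proof.
apply: measurable_fun_rV => i; under eq_fun do rewrite mxE.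
by apply: measurable_funD; [exact: measurable_coord|exact: measurable_cst].
Qed.

Lemma measurable_subv n d (T : measurableType d) (f g : T -> 'rV[R]_n) :
  measurable_fun setT f -> measurable_fun setT g ->
  measurable_fun setT (fun x => f x - g x).
Proof.
move=> mf mg; apply: measurable_fun_rV => i; under eq_fun do rewrite !mxE.
apply: measurable_funB.
  exact: measurableT_comp (measurable_coord i) mf.
exact: measurableT_comp (measurable_coord i) mg.
Qed.

Lemma measurable_dot n d (T : measurableType d) (f g : T -> 'rV[R]_n) :
  measurable_fun setT f -> measurable_fun setT g ->
  measurable_fun setT (fun x => dot (f x) (g x)).
Proof.
move=> mf mg; apply: measurable_sum => i; apply: measurable_funM.
  exact: measurableT_comp (measurable_coord i) mf.
exact: measurableT_comp (measurable_coord i) mg.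
Qed.

Lemma dotC n (x y : 'rV[R]_n) : dot x y = dot y x.
Proof. by apply: eq_bigr => i _; rewrite mulrC. Qed.

Lemma dotDl n (x y z : 'rV[R]_n) : dot (x + y) z = dot x z + dot y z.
Proof. by rewrite -big_split; apply: eq_bigr => i _; rewrite mxE mulrDl. Qed.

Lemma dotNl n (x z : 'rV[R]_n) : dot (- x) z = - dot x z.
Proof. by rewrite -sumrN; apply: eq_bigr => i _; rewrite mxE mulNr. Qed.

Lemma dotDr n (x y z : 'rV[R]_n) : dot z (x + y) = dot z x + dot z y.
Proof. by rewrite !(dotC z) dotDl. Qed.

Lemma dotZl n a (x z : 'rV[R]_n) : dot (a *: x) z = a * dot x z.
Proof. by rewrite mulr_sumr; apply: eq_bigr => i _; rewrite mxE mulrA. Qed.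

Lemma dot0l n (z : 'rV[R]_n) : dot 0 z = 0.
Proof. by rewrite /dot big1// => i _; rewrite mxE mul0r. Qed.

Lemma ge0_integral_cons n (F : 'rV[R]_n.+1 -> \bar R) :
  measurable_fun setT F -> (forall x, (0 <= F x)%E) ->
  (\int[mu n.+1]_x F x =
   \int[@lebesgue_measure R]_t \int[mu n]_v F (rV_cons (t, v)))%E.
Proof.
move=> mF F0.
rewrite [LHS](@ge0_integral_pushforward _ _ _ _ R _ (@measurable_rV_cons R n)
  (@lebesgue_measure R \x mu n)%E setT)//.
rewrite preimage_setT fubini_tonelli1//.
  by apply: measurableT_comp => //; exact: measurable_rV_cons.
by move=> p; exact: F0.
Qed.

Lemma rV_consD n (t s : R) (v w : 'rV[R]_n) :
  rV_cons (t + s, v + w) = rV_cons (t, v) + rV_cons (s, w).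
Proof.
by apply/rowP => i; rewrite !mxE/=; case: unliftP => [j _|_]//=; rewrite mxE.
Qed.

Lemma rV_cons_surj n (x : 'rV[R]_n.+1) :
  x = rV_cons (x ord0 ord0, \row_j x ord0 (lift ord0 j)).
Proof.
by apply/rowP => i; rewrite !mxE/=; case: unliftP => [j ->|->]//=; rewrite mxE.
Qed.

(** The half-open intervals determine the measure. *)
Lemma lebesgue_measure_shift (c : R) (A : set (measurableTypeR R)) :
  measurable A ->
  pushforward lebesgue_measure
    (fun t : measurableTypeR R => t + c : measurableTypeR R) A
  = lebesgue_measure A.
Proof.
move=> mA; apply/esym/lebesgue_measure_unique => //=.
  by apply: measurable_funD => //; exact: measurable_cst.
move=> mc _ [[a b]] _ <-.
rewrite /pushforward (_ : _ @^-1` _ = `]a - c, b - c]%classic); last first.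
  by apply/seteqP; split => t /=; rewrite !in_itv/= ltrBlDr lerBrDr.
rewrite !lebesgue_measure_itv/= !lte_fin ltrD2r; case: ifP => // _.
by rewrite -!EFinB; congr EFin; ring.
Qed.

Lemma ge0_integral_shift (c : R) (f : R -> \bar R) :
  measurable_fun setT f -> (forall t, (0 <= f t)%E) ->
  (\int[@lebesgue_measure R]_t f (t + c)%R = \int[@lebesgue_measure R]_t f t)%E.
Proof.
move=> mf f0.
have mc : measurable_fun setT (fun t : measurableTypeR R => t + c : measurableTypeR R).
  by apply: measurable_funD => //; exact: measurable_cst.
transitivity (\int[pushforward (@lebesgue_measure R)
    (fun t : measurableTypeR R => (t + c)%R : measurableTypeR R)]_t f t)%E.
  by rewrite (ge0_integral_pushforward mc).
by apply: eq_measure_integral => //= A mA _; exact: lebesgue_measure_shift.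
Qed.

(** Tonelli's theorem splits off one coordinate at a time, which reduces the
    claim to one variable. *)
Lemma ge0_integral_translate n (a : 'rV[R]_n) (F : 'rV[R]_n -> \bar R) :
  measurable_fun setT F -> (forall x, (0 <= F x)%E) ->
  (\int[mu n]_x F (x + a)%R = \int[mu n]_x F x)%E.
Proof.
elim: n => [|n ih] in a F * => mF F0.
  by apply: eq_integral => x _; congr F; apply/rowP => -[].
have mF' (b : 'rV[R]_n.+1) : measurable_fun setT (fun x : 'rV[R]_n.+1 => F (x + b)).
  by apply: measurableT_comp => //; exact: measurable_addv.
rewrite !ge0_integral_cons//.
rewrite -[RHS](@ge0_integral_shift (a ord0 ord0)); last 2 first.
- apply: (measurable_fun_fubini_tonelli_F (F \o @rV_cons R n)).
    by apply: measurableT_comp => //; exact: measurable_rV_cons.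
  by move=> p; exact: F0.
- by move=> t; apply: integral_ge0.
apply: eq_integral => t _.
rewrite -(ih (\row_j a ord0 (lift ord0 j)) (fun v => F (rV_cons (_, v))))//.
  by apply: eq_integral => v _; rewrite {1}(rV_cons_surj a) -rV_consD.
apply: (measurableT_comp mF); apply: (measurableT_comp (@measurable_rV_cons R n)).
exact: measurable_pair1.
Qed.

Lemma lebesgue_rV_set1 n (a : 'rV[R]_n) : (0 < n)%N -> mu n [set a] = 0%E.
Proof.
case: n a => // n a _.
rewrite (_ : [set a] = [set v | forall i, [set a ord0 i] (v ord0 i)]).
  rewrite (@lebesgue_rV_box R n.+1 (fun i => [set a ord0 i])); last first.
    by move=> i; exact: measurable_set1.
  by rewrite big_ord_recl lebesgue_measure_set1 mul0e.
apply/seteqP; split => [x ->//|x /= xa]; exact/rowP.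
Qed.

Lemma measurable_rV_set1 n (a : 'rV[R]_n) : measurable [set a].
Proof.
rewrite (_ : [set a] = [set v | forall i, [set a ord0 i] (v ord0 i)]).
  by apply: (@measurable_box R n (fun i => [set a ord0 i])) => i; exact: measurable_set1.
apply/seteqP; split => [x ->//|x /= xa]; exact/rowP.
Qed.

Lemma lebesgue_rV_hyperplane n (i : 'I_n) (c : R) :
  mu n [set x | x ord0 i = c] = 0%E.
Proof.
rewrite (_ : mkset _ =
    [set v | forall j, (if j == i then [set c] else setT) (v ord0 j)]).
  rewrite (@lebesgue_rV_box R n (fun j => if j == i then [set c] else setT)); last first.
    by move=> j; case: ifP => _; [exact: measurable_set1|exact: measurableT].
  by rewrite (bigD1 i)//= eqxx lebesgue_measure_set1 mul0e.
apply/seteqP; split => x /=.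
  by move=> xi j; case: eqP => // ->.
by move=> /(_ i); rewrite eqxx.
Qed.

Section product.
Context d1 d2 (T1 : measurableType d1) (T2 : measurableType d2).
Variables (m1 : {sigma_finite_measure set T1 -> \bar R}).
Variables (m2 : {sigma_finite_measure set T2 -> \bar R}).

Lemma integrable_prod_mul (f : T1 -> R) (g : T2 -> R) :
  m1.-integrable setT (EFin \o f) -> m2.-integrable setT (EFin \o g) ->
  (m1 \x m2)%E.-integrable setT (fun p => (f p.1 * g p.2)%:E).
Proof.
move=> intf intg.
have mf : measurable_fun setT f by apply/measurable_EFinP; apply: (measurable_int m1).
have mg : measurable_fun setT g by apply/measurable_EFinP; apply: (measurable_int m2).
apply/integrable12ltyP.
  apply/measurable_EFinP; apply: measurable_funM.
    exact: measurableT_comp.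
  exact: measurableT_comp.
move: intf intg => /integrableP[_ +] /integrableP[_ +].
have -> : (\int[m1]_x \int[m2]_y `|(f x * g y)%:E| =
    \int[m1]_x `|(f x)%:E| * \int[m2]_y `|(g y)%:E|)%E.
  under eq_integral => x _.
    under eq_integral => y _ do rewrite EFinM abseM.
    rewrite ge0_integralZl//; first over.
    by do 2 apply: measurableT_comp => //.
  rewrite ge0_integralZr//; first by do 2 apply: measurableT_comp => //.
  exact: integral_ge0.
move=> fin1 fin2; apply: lte_mul_pinfty => //; first exact: integral_ge0.
by rewrite ge0_fin_numE//; exact: integral_ge0.
Qed.

Lemma Rintegral_prod_mul (f : T1 -> R) (g : T2 -> R) :
  m1.-integrable setT (EFin \o f) -> m2.-integrable setT (EFin \o g) ->
  (\int[(m1 \x m2)%E]_p (f p.1 * g p.2) =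
   (\int[m1]_x f x) * (\int[m2]_y g y))%R.
Proof.
move=> intf intg; rewrite /Rintegral -integral12_prod_meas1; last first.
  exact: integrable_prod_mul.
rewrite /fubini_F -fineM; [|exact: integrable_fin_num..].
congr fine.
transitivity (\int[m1]_x ((f x)%:E * \int[m2]_y (g y)%:E)%E)%E.
  by apply: eq_integral => x _; rewrite -integralZl.
by rewrite -(fineK (integrable_fin_num measurableT intg)) integralZr.
Qed.

End product.
End lebesgue_space.

(** * Integrals of products *)

Section product_integral.
Context {R : realType}.
Local Notation mu n := (lebesgue_rV R n).
Local Notation leb := (@lebesgue_measure R).

Lemma cintable_prod_mul d1 d2 (T1 : measurableType d1) (T2 : measurableType d2)
    (m1 : {sigma_finite_measure set T1 -> \bar R})
    (m2 : {sigma_finite_measure set T2 -> \bar R}) (f : T1 -> R[i]) (g : T2 -> R[i]) :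
  cintable m1 f -> cintable m2 g ->
  cintable (m1 \x m2)%E (fun p => f p.1 * g p.2) /\
  cint (m1 \x m2)%E (fun p => f p.1 * g p.2) = cint m1 f * cint m2 g.
Proof.
move=> [rf jf] [rg jg].
have I := @integrable_prod_mul R _ _ T1 T2 m1 m2.
have E := @Rintegral_prod_mul R _ _ T1 T2 m1 m2.
have rr := I _ _ rf rg; have jj := I _ _ jf jg.
have rj := I _ _ rf jg; have jr := I _ _ jf rg.
split.
  split.
    under eq_fun do rewrite ReM EFinB; exact: integrableB.
  under eq_fun do rewrite ImM EFinD; exact: integrableD.
apply: complex_eqP; rewrite ?ReM ?ImM.
  transitivity (\int[(m1 \x m2)%E]_p (Re (f p.1) * Re (g p.2) - Im (f p.1) * Im (g p.2))).
    by apply: eq_Rintegral => p _; rewrite ReM.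
  by rewrite RintegralB// (E _ _ rf rg) (E _ _ jf jg).
transitivity (\int[(m1 \x m2)%E]_p (Re (f p.1) * Im (g p.2) + Im (f p.1) * Re (g p.2))).
  by apply: eq_Rintegral => p _; rewrite ImM.
by rewrite RintegralD// (E _ _ rf jg) (E _ _ jf rg).
Qed.

Lemma cint_cons n (F : 'rV[R]_n.+1 -> R[i]) : cmeas F ->
  cintable (leb \x mu n)%E (F \o @rV_cons R n) ->
  cintable (mu n.+1) F /\ cint (mu n.+1) F = cint (leb \x mu n)%E (F \o @rV_cons R n).
Proof.
move=> [mr mi] [rF jF].
have mc := @measurable_rV_cons R n.
have P := @integrable_pushforward _ _ _ _ R _ mc (leb \x mu n)%E setT.
have Q := @integral_pushforward _ _ _ _ R _ mc (leb \x mu n)%E setT.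
split.
  by split; apply: P => //; exact/measurable_EFinP.
apply: complex_eqP => /=; congr fine; rewrite [LHS]Q//; exact/measurable_EFinP.
Qed.

Lemma cmeas_prod n (I : Type) (r : seq I) (F : I -> 'rV[R]_n -> R[i]) :
  (forall i, cmeas (F i)) -> cmeas (fun x => \prod_(i <- r) F i x).
Proof.
move=> mF; elim: r => [|i r ih].
  by under eq_fun do rewrite big_nil; exact: cmeas_cst.
by under eq_fun do rewrite big_cons; apply: cmeasM.
Qed.

(** By induction on the dimension, with Fubini's theorem for the first coordinate. *)
Lemma cint_prod n (h : 'I_n -> R -> R[i]) :
  (forall i, cintable leb (h i)) ->
  cintable (mu n) (fun x => \prod_i h i (x ord0 i)) /\
  cint (mu n) (fun x => \prod_i h i (x ord0 i)) = \prod_i cint leb (h i).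
Proof.
elim: n => [|n ih] in h * => ih_h.
  rewrite big_ord0 (_ : (fun x => _) = fun=> 1); last first.
    by apply/funext => x; rewrite big_ord0.
  have E (c : R) : (\int[mu 0]_x c%:E = c%:E)%E.
    by rewrite [LHS]integral_dirac// diracT mul1e.
  split.
    by split; apply/integrableP; split => //=; rewrite E ltry.
  by apply: complex_eqP; rewrite /= /Rintegral E.
have [I1 E1] := ih (fun j => h (lift ord0 j)) (fun j => ih_h _).
have mF : cmeas (fun x : 'rV[R]_n.+1 => \prod_i h i (x ord0 i)).
  apply: cmeas_prod => i; have [mh _] := (cintableP _ _).1 (ih_h i).
  exact: cmeas_comp mh (measurable_coord i).
have E : (fun x : 'rV[R]_n.+1 => \prod_i h i (x ord0 i)) \o @rV_cons R n =
    (fun p => h ord0 p.1 * \prod_(j < n) h (lift ord0 j) (p.2 ord0 j)).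
  apply/funext => -[t v] /=; rewrite big_ord_recl mxE unlift_none /=.
  by congr (_ * _); apply: eq_bigr => j _; rewrite mxE liftK.
have [I2 E2] := cintable_prod_mul (ih_h ord0) I1.
by have [|I3 ->] := cint_cons mF; rewrite E ?E2 ?E1 ?big_ord_recl.
Qed.

Lemma cis_sum (I : Type) (r : seq I) (F : I -> R) :
  cis (\sum_(i <- r) F i) = \prod_(i <- r) cis (F i).
Proof.
elim: r => [|i r ih]; first by rewrite !big_nil cis0.
by rewrite !big_cons cisD ih.
Qed.

Lemma cint_prod_cis n (w : R -> R) (z : 'rV[R]_n) :
  leb.-integrable setT (EFin \o w) ->
  cintable (mu n) (fun x => ((\prod_i w (x ord0 i))%:C)%C * cis (dot z x)) /\
  cint (mu n) (fun x => ((\prod_i w (x ord0 i))%:C)%C * cis (dot z x)) =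
  \prod_i cint leb (fun t => ((w t)%:C)%C * cis (z ord0 i * t)).
Proof.
move=> iw.
have mw : measurable_fun setT w by apply/measurable_EFinP; apply: (measurable_int leb).
have -> : (fun x : 'rV[R]_n => ((\prod_i w (x ord0 i))%:C)%C * cis (dot z x)) =
    (fun x => \prod_i (((w (x ord0 i))%:C)%C * cis (z ord0 i * x ord0 i))).
  by apply/funext => x; rewrite /dot cis_sum big_split rmorph_prod.
apply: (@cint_prod n (fun i t => ((w t)%:C)%C * cis (z ord0 i * t))) => i.
apply: (@cintable_le _ _ _ leb (fun t => ((w t)%:C)%C * cis (z ord0 i * t))
  (fun t => `|w t|)).
- apply: cmeasM; first exact: cmeas_real.
  by apply: cmeas_cis; exact: measurable_funM.
- by move=> t; rewrite Normc.normcM normc_cis mulr1 normc_real.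
- exact: integrable_abse iw.
Qed.

End product_integral.

Section one_dimensional.
Context {R : realType}.
Local Notation leb := (@lebesgue_measure R).

Lemma Rintegral_is_derive (f F : R -> R) a b : a < b -> continuous f ->
  (forall x : R, is_derive x (1 : R) F (f x)) ->
  \int[leb]_(x in `[a, b]) f x = F b - F a.
Proof.
move=> ab cf dF.
have cF : continuous F.
  by move=> x; apply: differentiable_continuous; apply/derivable1_diffP.
rewrite /Rintegral (@continuous_FTC2 _ _ F)//.
- exact: continuous_subspaceT.
- split.
  + by move=> x _.
  + by apply: cvg_at_right_filter; exact: cF.
  + by apply: cvg_at_left_filter; exact: cF.
- by move=> x _; rewrite derive1E; exact: derive_val.
Qed.

(** The tile [-pi, pi[ in one variable; half-open so that its translates by
    2 pi Z partition the line. *)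
Definition arc : set R := `[- pi, pi[%classic.

Lemma integrable_arc (f : R -> R) : continuous f ->
  leb.-integrable setT (EFin \o (fun t => \1_arc t * f t)).
Proof.
move=> cf; have ms : measurable (arc : set (measurableTypeR R)) by exact: measurable_itv.
have -> : EFin \o (fun t => \1_arc t * f t) = (EFin \o f) \_ arc.
  apply/funext => t; rewrite patchE /= indicE; case: ifP => _; first by rewrite mul1r.
  by rewrite mul0r.
apply/(integrable_mkcond _ ms).
apply: (@integrableS _ (measurableTypeR R) R leb `[- pi, pi]%classic) => //.
  exact: subset_itv_co_cc.
apply: continuous_compact_integrable; first exact: segment_compact.
exact: continuous_subspaceT.
Qed.

Lemma Rintegral_arc (f F : R -> R) : continuous f ->
  (forall x : R, is_derive x (1 : R) F (f x)) ->
  \int[leb]_t (\1_arc t * f t) = F pi - F (- pi).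
Proof.
move=> cf dF.
have ms : measurable (arc : set (measurableTypeR R)) by exact: measurable_itv.
have -> : \int[leb]_t (\1_arc t * f t) = \int[leb]_(t in arc) f t.
  rewrite [RHS]Rintegral_mkcond; apply: eq_Rintegral => t _.
  by rewrite patchE indicE; case: ifP => _; rewrite ?mul1r ?mul0r.
rewrite Rintegral_itv_bndo_bndc.
  by rewrite (Rintegral_is_derive _ cf dF)// gtrN// pi_gt0.
apply: (@integrableS _ (measurableTypeR R) R leb `[- pi, pi]%classic) => //.
  exact: subset_itv_co_cc.
apply: continuous_compact_integrable; first exact: segment_compact.
exact: continuous_subspaceT.
Qed.

Lemma continuous_cosM (a : R) : continuous (fun t : R => cos (a * t)).
Proof.
move=> t; apply: (@continuous_comp _ _ _ (fun t => a * t) cos).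
  exact: mulrl_continuous.
exact: continuous_cos.
Qed.

Lemma continuous_sinM (a : R) : continuous (fun t : R => sin (a * t)).
Proof.
move=> t; apply: (@continuous_comp _ _ _ (fun t => a * t) sin).
  exact: mulrl_continuous.
exact: continuous_sin.
Qed.

Lemma sin_pi_int (k : int) : sin (k%:~R * pi : R) = 0.
Proof.
have nat_case (m : nat) : sin (m%:R * pi : R) = 0.
  elim: m => [|m ih]; first by rewrite mul0r sin0.
  by rewrite (mulrSr _ m) mulrDl mul1r sinDpi ih oppr0.
case: k => m; first exact: nat_case.
by rewrite NegzE mulrNz mulNr sinN nat_case oppr0.
Qed.

(** For nonzero frequency the integrand has a 2 pi-periodic primitive. *)
Lemma cint_arc_cis (k : int) :
  cintable leb (fun t => ((\1_arc t)%:C)%C * cis (k%:~R * t)) /\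
  cint leb (fun t => ((\1_arc t)%:C)%C * cis (k%:~R * t)) =
  (if k == 0 then 2 * pi else 0)%:C%C.
Proof.
have reE t : Re (((\1_arc t)%:C)%C * cis (k%:~R * t)) = \1_arc t * cos (k%:~R * t).
  by rewrite ReM /= mul0r subr0.
have imE t : Im (((\1_arc t)%:C)%C * cis (k%:~R * t)) = \1_arc t * sin (k%:~R * t).
  by rewrite ImM /= mul0r addr0.
split.
  split.
    under eq_fun do rewrite reE.
    exact: (integrable_arc (@continuous_cosM k%:~R)).
  under eq_fun do rewrite imE.
  exact: (integrable_arc (@continuous_sinM k%:~R)).
apply: complex_eqP.
  transitivity (\int[leb]_t (\1_arc t * cos (k%:~R * t))).
    by apply: eq_Rintegral => t _; rewrite -reE.
  rewrite /=.
  case: (eqVneq k 0) => [->|k0].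
    have D (x : R) : is_derive x (1 : R) id (cos (0%:~R * x)).
      by rewrite mul0r cos0; exact: is_derive_id.
    rewrite (Rintegral_arc (@continuous_cosM _) D) opprK.
    by rewrite mulr_natl mulr2n.
  have k0' : k%:~R != 0 :> R by rewrite intr_eq0.
  have D (x : R) : is_derive x (1 : R) (fun t => k%:~R^-1 * sin (k%:~R * t)) (cos (k%:~R * x)).
    apply: is_derive_eq.
    by rewrite /GRing.scale/=; field.
  rewrite (Rintegral_arc (@continuous_cosM _) D).
  by rewrite mulrN sinN sin_pi_int oppr0 subrr.
transitivity (\int[leb]_t (\1_arc t * sin (k%:~R * t))).
  by apply: eq_Rintegral => t _; rewrite -imE.
rewrite /=.
case: (eqVneq k 0) => [->|k0].
  under eq_Rintegral do rewrite mul0r sin0 mulr0.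
  by rewrite Rintegral_cst// mul0r.
have k0' : k%:~R != 0 :> R by rewrite intr_eq0.
have D (x : R) : is_derive x (1 : R) (fun t => - k%:~R^-1 * cos (k%:~R * t)) (sin (k%:~R * x)).
  apply: is_derive_eq.
  by rewrite /GRing.scale/=; field.
rewrite (Rintegral_arc (@continuous_sinM _) D).
by rewrite mulrN cosN subrr.
Qed.

End one_dimensional.

(** * Countable sums and tilings by cubes *)

Section countable_sums.
Context {R : realType} {I : countType}.
Implicit Types a : I -> \bar R.
Local Open Scope ereal_scope.

(** An enumeration of the index type turns the sum into a series, to which the
    monotone convergence theorem applies. *)
Lemma esum_pickle a : (forall i, 0 <= a i) ->
  \esum_(i in setT) a i = \sum_(m <oo) oapp a 0 (pickle_inv m).
Proof.
move=> a0; rewrite nneseries_esumT; last by move=> m; case: pickle_inv => /=.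
have -> : \esum_(m in [set: nat]) oapp a 0 (pickle_inv m) =
    \esum_(m in [set @choice.pickle I i | i in [set: I]]) oapp a 0 (pickle_inv m).
  rewrite [RHS]esum_mkcond; apply: eq_esum => m _.
  case: ifPn => // /negP pm.
  have := @pickle_invK I m; case: (pickle_inv m) => //= i im.
  exfalso; apply: pm; apply/mem_set; exists i => //; exact: im.
rewrite (@reindex_esum R _ _ setT _ (@choice.pickle I)).
  by apply: eq_esum => i _; rewrite pickleK_inv.
by split.
Qed.

Lemma esumZl (c : R) a : (0 <= c)%R -> (forall i, 0 <= a i) ->
  \esum_(i in setT) (c%:E * a i) = c%:E * \esum_(i in setT) a i.
Proof.
move=> c0 a0; rewrite !esum_pickle//; last by move=> i; rewrite mule_ge0.
rewrite -nneseriesZl//; last by move=> m _; case: pickle_inv => /=.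
by apply: eq_eseriesr => m _; case: pickle_inv => //=; rewrite mule0.
Qed.

Lemma esum_single (i : I) a : (0 <= a i) -> (forall j, j != i -> a j = 0) ->
  \esum_(j in setT) a j = a i.
Proof.
move=> ai0 aj; rewrite -[RHS]esum_set1//.
rewrite [RHS]esum_mkcond; apply: eq_esum => j _.
by case: ifPn => // /negP ji; rewrite aj//; apply/eqP => ji'; apply: ji; rewrite ji'; exact/mem_set.
Qed.

Section integral.
Context d {T : measurableType d}.
Variables (mu : {measure set T -> \bar R}) (D : set T).

Lemma measurable_esum (f : I -> T -> \bar R) :
  (forall i, measurable_fun D (f i)) -> (forall i x, 0 <= f i x) ->
  measurable_fun D (fun x => \esum_(i in setT) f i x).
Proof.
move=> mf f0; under eq_fun do rewrite esum_pickle//.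
apply: (@ge0_emeasurable_sum _ _ _ _
  (fun m x => oapp (f^~ x) 0 (pickle_inv m)) xpredT) => m.
  by move=> x _ _; case: pickle_inv => /=.
by move=> _; case: pickle_inv => //= _; exact: measurable_cst.
Qed.

Lemma integral_esum (f : I -> T -> \bar R) : measurable D ->
  (forall i, measurable_fun D (f i)) -> (forall i x, 0 <= f i x) ->
  \int[mu]_(x in D) (\esum_(i in setT) f i x) =
  \esum_(i in setT) \int[mu]_(x in D) f i x.
Proof.
move=> mD mf f0; rewrite esum_pickle; last by move=> i; exact: integral_ge0.
under eq_integral do rewrite esum_pickle//.
rewrite integral_nneseries//; last 2 first.
- by move=> m; case: pickle_inv => //= _; exact: measurable_cst.
- by move=> m x _; case: pickle_inv => /=.
by apply: eq_eseriesr => m _; case: pickle_inv => //=; exact: integral0.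
Qed.

End integral.
End countable_sums.

Section tiles.
Context {R : realType} {n : nat}.
Local Notation mu := (lebesgue_rV R n).
Variables (a p : R).
Hypothesis p0 : 0 < p.
Implicit Types (x : 'rV[R]_n) (k : 'rV[int]_n).

(** Half-open, so that the translates by [p Z^n] partition the space; [cell x]
    is the index of the translate that contains [x]. *)
Definition box : set 'rV[R]_n := [set x | forall i, a <= x ord0 i < a + p].

Definition cell x : 'rV[int]_n := \row_i Num.floor ((x ord0 i - a) / p).

Lemma measurable_box_tile : measurable box.
Proof.
rewrite (_ : box = [set x | forall i, `[a, a + p[%classic (x ord0 i)]).
  by apply: (@measurable_box R n (fun i => `[a, a + p[%classic)) => i; exact: measurable_itv.
by apply/seteqP; split => x /= xb i; have := xb i; rewrite in_itv.
Qed.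

Lemma cell_unique x k : box (x - p *: lat k) <-> k = cell x.
Proof.
have E (t : R) (m : int) : (a <= t - p * m%:~R < a + p) =
    (m%:~R <= (t - a) / p < (m + 1)%:~R).
  rewrite ler_pdivlMr// ltr_pdivrMr// intrD mulrDl mul1r.
  by apply/idP/idP => /andP[? ?]; apply/andP; split; lra.
split.
  move=> xb; apply/rowP => i; rewrite mxE; apply/esym/floor_def.
  by have := xb i; rewrite !mxE E.
by move=> -> i; rewrite !mxE E; exact: floor_itv.
Qed.

Lemma latD k l : lat (k + l) = lat k + lat l :> 'rV[R]_n.
Proof. by apply/rowP => i; rewrite !mxE intrD. Qed.

Lemma latN k : lat (- k) = - lat k :> 'rV[R]_n.
Proof. by apply/rowP => i; rewrite !mxE intrN. Qed.

Lemma cell_shift x k : cell (x + p *: lat k) = cell x + k.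
Proof.
apply/esym/cell_unique; rewrite latD scalerDr opprD addrACA addrN addr0.
exact/cell_unique.
Qed.

Lemma box_cell0 x : box x <-> cell x = 0.
Proof.
have := cell_unique x 0; rewrite (_ : lat 0 = 0) ?scaler0 ?subr0.
  by move=> [A B]; split => [/A|/esym/B].
by apply/rowP => i; rewrite !mxE.
Qed.

Definition wrap x := x - p *: lat (cell x).

Lemma box_wrap x : box (wrap x).
Proof. exact/cell_unique. Qed.

Lemma wrap_shift x k : wrap (x + p *: lat k) = wrap x.
Proof.
by rewrite /wrap cell_shift latD scalerDr opprD addrACA subrr addr0.
Qed.

Lemma wrap_id x : box x -> wrap x = x.
Proof.
move=> /box_cell0; rewrite /wrap => ->; rewrite (_ : lat 0 = 0) ?scaler0 ?subr0//.
by apply/rowP => i; rewrite !mxE.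
Qed.

Lemma measurable_wrap : measurable_fun setT wrap.
Proof.
apply: measurable_fun_rV => i.
rewrite (_ : (fun x => _) = (fun t : R => t - p * (Num.floor ((t - a) / p))%:~R) \o
    (fun x => x ord0 i)); last by apply/funext => x; rewrite /= !mxE.
apply: measurableT_comp (measurable_coord i).
apply: measurable_funB => //; apply: measurable_funM; first exact: measurable_cst.
apply: nondecreasing_measurable => // s t st.
by rewrite ler_int le_floor// ler_pM2r ?invr_gt0// lerB.
Qed.

Local Open Scope ereal_scope.

(** Summing the indicators of the translated cubes gives 1, so an integral over
    the space folds up into an integral over one cube. *)
Lemma integral_fold (F : 'rV[R]_n -> \bar R) :
  measurable_fun setT F -> (forall x, 0 <= F x) ->
  \int[mu]_x F x = \esum_(k in setT) \int[mu]_(x in box) F (x + p *: lat k)%R.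
Proof.
move=> mF F0.
have mB := measurable_box_tile.
have mS k : measurable_fun setT (fun x => F (x + p *: lat k)%R).
  by apply: measurableT_comp => //; exact: measurable_addv.
have mI : measurable_fun setT (fun x => (\1_box x)%:E : \bar R).
  by apply/measurable_EFinP; exact: measurable_indic.
pose g k x := (\1_box (x - p *: lat k)%R)%:E * F x.
have mg k : measurable_fun setT (g k).
  apply: emeasurable_funM => //.
  exact: (measurableT_comp mI (measurable_addv _)).
have g0 k x : 0 <= g k x by rewrite mule_ge0.
transitivity (\int[mu]_x \esum_(k in setT) g k x).
  apply: eq_integral => x _; rewrite (esum_single (i := cell x))//.
    rewrite /g indicE mem_set ?mul1e//; exact: box_wrap.
  move=> k kx; rewrite /g indicE memNset ?mul0e// => /cell_unique kE.
  by move: kx; rewrite kE eqxx.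
rewrite integral_esum//; apply: eq_esum => k _.
rewrite -(ge0_integral_translate (p *: lat k))//.
rewrite [RHS]integral_mkcond; apply: eq_integral => x _.
rewrite /g addrK patchE indicE; case: ifP => _; first by rewrite mul1e.
by rewrite mul0e.
Qed.

(** After folding onto one cube, the periodic factor comes out of the sum over
    the coset, and what remains of that sum is 1. *)
Lemma integral_periodic_weight (s : 'rV[R]_n -> R) (G : 'rV[R]_n -> R) :
  measurable_fun setT s -> (forall x, 0 <= s x)%R ->
  (forall x, \esum_(k in setT) (s (x + p *: lat k)%R)%:E = 1) ->
  measurable_fun setT G -> (forall x, 0 <= G x)%R ->
  (forall x k, G (x + p *: lat k)%R = G x) ->
  \int[mu]_x (s x * G x)%:E = \int[mu]_(x in box) (G x)%:E.
Proof.
move=> ms s0 s1 mG G0 perG.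
have mE : measurable_fun setT (fun x => (s x * G x)%:E).
  by apply/measurable_EFinP; exact: measurable_funM.
have mS k : measurable_fun setT (fun x : 'rV[R]_n => (s (x + p *: lat k) * G (x + p *: lat k))%:E).
  exact: (measurableT_comp mE (measurable_addv (p *: lat k))).
rewrite integral_fold//; last by move=> x; rewrite lee_fin mulr_ge0.
rewrite -integral_esum//; last 3 first.
- exact: measurable_box_tile.
- by move=> k; exact: measurable_funTS.
- by move=> k x; rewrite lee_fin mulr_ge0.
apply: eq_integral => x _.
under eq_esum do rewrite perG mulrC EFinM.
by rewrite esumZl ?s1 ?mule1// => k; rewrite lee_fin.
Qed.

End tiles.

(** * The torus *)

Section fourier_series.
Context {R : realType} {n : nat}.
Local Notation mu := (lebesgue_rV R n).
Implicit Types (G H : 'rV[R]_n -> R[i]) (j k : 'rV[int]_n) (J : {fset 'rV[int]_n}).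

Definition torus : set 'rV[R]_n := box (- pi) (2 * pi).

Lemma twopi_gt0 : 0 < 2 * pi :> R.
Proof. by rewrite mulr_gt0// pi_gt0. Qed.

Lemma measurable_torus : measurable torus.
Proof. exact: measurable_box_tile. Qed.

Lemma indic_torus x : \1_torus x = \prod_i \1_arc (x ord0 i) :> R.
Proof.
have arcE (t : R) : arc t = (- pi <= t < - pi + 2 * pi) :> Prop.
  by rewrite /arc /= in_itv/= (_ : - pi + 2 * pi = pi)//; ring.
rewrite indicE; case: (boolP (x \in torus)) => [|xT].
  move=> /set_mem xT; rewrite big1// => i _; rewrite indicE mem_set// arcE; exact: xT.
have : ~ (forall i, arc (x ord0 i)).
  by move=> xa; move/negP: xT; apply; apply/mem_set => i; rewrite -arcE.
move=> /existsNP[i xi].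
by rewrite (bigD1 i)//= indicE memNset// mul0r.
Qed.

Local Notation c := (@fourier_const R n).

Lemma fourier_const_gt0 : 0 < c.
Proof. by rewrite powR_gt0// twopi_gt0. Qed.

Lemma sqr_fourier_const : c ^+ 2 * (2 * pi) ^+ n = 1.
Proof.
have P0 (b : bool) : b ==> (2 * pi != 0 :> R).
  by apply/implyP => _; rewrite gt_eqF// twopi_gt0.
rewrite /fourier_const expr2 -powRD; last exact: P0.
rewrite -powR_mulrn ?ltW ?twopi_gt0// -powRD; last exact: P0.
by rewrite (_ : _ + _ = 0) ?powRr0//; field.
Qed.

Definition tint G : R[i] := cint mu (fun x => ((\1_torus x)%:C)%C * G x).
Definition tintable G := cintable mu (fun x => ((\1_torus x)%:C)%C * G x).
Definition mode j (x : 'rV[R]_n) : R[i] := cis (- dot (lat j) x).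

Lemma lat0 : lat (0 : 'rV[int]_n) = 0 :> 'rV[R]_n.
Proof. by apply/rowP => i; rewrite !mxE. Qed.

Lemma row_neq0 j : j != 0 -> exists i, j ord0 i != 0.
Proof.
move=> j0; apply/existsP; rewrite -negb_forall; apply: contra j0 => /forallP j0.
by apply/eqP/rowP => i; rewrite mxE; exact/eqP.
Qed.

Lemma cint_torus_cis j :
  tintable (fun x => cis (dot (lat j) x)) /\
  tint (fun x => cis (dot (lat j) x)) = (if j == 0 then (2 * pi) ^+ n else 0)%:C%C.
Proof.
have iarc : (@lebesgue_measure R).-integrable setT (EFin \o (\1_arc : R -> R)).
  rewrite (_ : (\1_arc : R -> R) = fun t => \1_arc t * cst 1 t); last first.
    by apply/funext => t; rewrite mulr1.
  by apply: integrable_arc => x; exact: cvg_cst.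
have [I E] := cint_prod_cis (lat j) iarc.
have EI : (fun x : 'rV[R]_n => ((\1_torus x)%:C)%C * cis (dot (lat j) x)) =
    (fun x => ((\prod_i \1_arc (x ord0 i))%:C)%C * cis (dot (lat j) x)).
  by apply/funext => x; rewrite indic_torus.
rewrite /tintable /tint EI; split => //; rewrite E; under eq_bigr => i _ do rewrite mxE (cint_arc_cis _).2.
case: eqVneq => [->|].
  by under eq_bigr => i _ do rewrite mxE eqxx; rewrite prodr_const card_ord rmorphXn.
move=> j0; have [i ji] := row_neq0 j0.
by rewrite (bigD1 i)//= (negbTE ji) mul0r.
Qed.

Lemma conj_mode j x : ((mode j x)^*)%C = cis (dot (lat j) x).
Proof. by rewrite -cisN opprK. Qed.

Lemma mode_conj_mode j k x :
  mode j x * ((mode k x)^*)%C = cis (dot (lat (k - j)) x).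
Proof. by rewrite conj_mode -cisD latD latN dotDl dotNl addrC. Qed.

Lemma mode_mul j k x : mode j x * mode k x = mode (j + k) x.
Proof. by rewrite /mode -cisD latD dotDl opprD. Qed.

Lemma measurable_mode j : cmeas (mode j).
Proof.
apply: cmeas_cis; apply: measurableT_comp => //.
by apply: measurable_dot; [exact: measurable_cst|exact: measurable_id].
Qed.

Lemma measurable_indic_torus : cmeas (fun x => ((\1_torus x)%:C)%C : R[i]).
Proof. by apply: cmeas_real; apply: measurable_indic; exact: measurable_torus. Qed.

(** * Square integrable functions on the torus *)

Definition tnorm2 G : \bar R := (\int[mu]_(x in torus) (nsq (G x))%:E)%E.
Definition tL2 G := cmeas G /\ (tnorm2 G < +oo)%E.

Lemma measurable_nsqE G : cmeas G -> measurable_fun torus (fun x => (nsq (G x))%:E).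
Proof. by move=> mG; apply/measurable_EFinP; apply: measurable_funTS; exact: measurable_nsq. Qed.

Lemma tnorm2_indic G : tnorm2 G = (\int[mu]_x (\1_torus x * nsq (G x))%:E)%E.
Proof.
rewrite /tnorm2 integral_mkcond; apply: eq_integral => x _.
by rewrite patchE indicE; case: ifP => _; rewrite ?mul1r ?mul0r.
Qed.

Lemma tnorm2_ge0 G : (0 <= tnorm2 G)%E.
Proof. by apply: integral_ge0 => x _; rewrite lee_fin nsq_ge0. Qed.

Lemma tnorm2Zl (K : R) G : 0 <= K -> cmeas G ->
  (K%:E * tnorm2 G = \int[mu]_(x in torus) (K%:E * (nsq (G x))%:E))%E.
Proof.
move=> K0 mG; rewrite ge0_integralZl//; try solve
  [exact: measurable_torus|exact: measurable_nsqE|by move=> x _; rewrite lee_fin nsq_ge0].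
Qed.

Lemma tnorm2D_le G H : cmeas G -> cmeas H ->
  (tnorm2 (fun x => G x + H x)%R <= 2%:E * tnorm2 G + 2%:E * tnorm2 H)%E.
Proof.
move=> mG mH; have mT := measurable_torus.
have mG2 := measurable_nsqE mG; have mH2 := measurable_nsqE mH.
rewrite !tnorm2Zl//.
rewrite -ge0_integralD//; last 4 first.
- by move=> x _; rewrite mule_ge0// lee_fin nsq_ge0.
- exact: measurable_funeM.
- by move=> x _; rewrite mule_ge0// lee_fin nsq_ge0.
- exact: measurable_funeM.
apply: ge0_le_integral => //.
- by move=> x _; rewrite lee_fin nsq_ge0.
- by apply: measurable_nsqE; exact: cmeasD.
- by apply: emeasurable_funD; exact: measurable_funeM.
- by move=> x _; rewrite -!EFinM -EFinD lee_fin nsqD_le.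
Qed.

Lemma tnorm2N G : tnorm2 (fun x => - G x) = tnorm2 G.
Proof. by apply: eq_integral => x _; rewrite nsqN. Qed.

Lemma tL2D G H : tL2 G -> tL2 H -> tL2 (fun x => G x + H x).
Proof.
move=> [mG fG] [mH fH]; split; first exact: cmeasD.
by apply: le_lt_trans (tnorm2D_le mG mH) _; rewrite lte_add_pinfty// lte_mul_pinfty.
Qed.

Lemma tnorm2_bounded_mul (K : R) u G : cmeas u -> cmeas G ->
  (forall x, nsq (u x) <= K) ->
  (tnorm2 (fun x => u x * G x)%R <= K%:E * tnorm2 G)%E.
Proof.
move=> mu_ mG uK; have K0 : 0 <= K by apply: le_trans (nsq_ge0 (u 0)) _.
rewrite tnorm2Zl//; apply: ge0_le_integral => //.
- exact: measurable_torus.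
- by move=> x _; rewrite lee_fin nsq_ge0.
- by apply: measurable_nsqE; exact: cmeasM.
- by apply: measurable_funeM; exact: measurable_nsqE.
- by move=> x _; rewrite -EFinM lee_fin nsqM ler_wpM2r// nsq_ge0.
Qed.

Lemma tL2_bounded_mul (K : R) u G : cmeas u -> (forall x, nsq (u x) <= K) ->
  tL2 G -> tL2 (fun x => u x * G x).
Proof.
move=> mu_ uK [mG fG]; split; first exact: cmeasM.
apply: le_lt_trans (tnorm2_bounded_mul mu_ mG uK) _.
by rewrite lte_mul_pinfty// lee_fin (le_trans (nsq_ge0 (u 0))).
Qed.

Lemma tL2Z z G : tL2 G -> tL2 (fun x => z * G x).
Proof. by apply: (@tL2_bounded_mul (nsq z)); first exact: cmeas_cst. Qed.

Lemma tL2N G : tL2 G -> tL2 (fun x => - G x).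
Proof. by move=> [mG fG]; split; [exact: cmeasN|rewrite tnorm2N]. Qed.

Lemma tL2B G H : tL2 G -> tL2 H -> tL2 (fun x => G x - H x).
Proof. by move=> lG lH; apply: tL2D => //; exact: tL2N. Qed.

Lemma torus_measure : mu torus = ((2 * pi) ^+ n)%:E.
Proof.
have -> : torus = [set x | forall i, `[- pi, - pi + 2 * pi[%classic (x ord0 i)].
  by apply/seteqP; split => x /= xb i; have := xb i; rewrite in_itv.
rewrite (@lebesgue_rV_box R n (fun i => `[- pi, - pi + 2 * pi[%classic)); last first.
  by move=> i; exact: measurable_itv.
rewrite (eq_bigr (fun=> (2 * pi)%:E))  => [|i _].
  by rewrite prodEFin prodr_const card_ord.
by rewrite lebesgue_measure_itv/= lte_fin ltrDl twopi_gt0 -EFinB; congr EFin; ring.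
Qed.

Lemma tL2_bounded (K : R) u : cmeas u -> (forall x, nsq (u x) <= K) -> tL2 u.
Proof.
move=> mu_ uK; split => //.
apply: (@le_lt_trans _ _ (\int[mu]_(x in torus) K%:E)%E).
  apply: ge0_le_integral => //; try solve [exact: measurable_torus|exact: measurable_nsqE].
  - by move=> x _; rewrite lee_fin nsq_ge0.
  - by move=> x _; rewrite lee_fin.
have mT := measurable_torus.
rewrite integral_cst// [X in (_ * X < _)%E](_ : _ = ((2 * pi) ^+ n)%:E).
  by rewrite -EFinM ltry.
exact: torus_measure.
Qed.

Lemma tL2_mode j : tL2 (mode j).
Proof. by apply: (@tL2_bounded 1); [exact: measurable_mode|move=> x; rewrite nsq_cis]. Qed.

Lemma tL2_cst z : tL2 (fun=> z).
Proof. by apply: (@tL2_bounded (nsq z)) => //; exact: cmeas_cst. Qed.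

Lemma tL2_sum (I : Type) (r : seq I) (F : I -> 'rV[R]_n -> R[i]) :
  (forall i, tL2 (F i)) -> tL2 (fun x => \sum_(i <- r) F i x).
Proof.
move=> mF; elim: r => [|i r ih].
  by under eq_fun do rewrite big_nil; exact: tL2_cst.
by under eq_fun do rewrite big_cons; exact: tL2D.
Qed.

(** Pointwise, [|G| |H| <= |G|^2 + |H|^2]. *)
Lemma tintable_mul G H : tL2 G -> tL2 H -> tintable (fun x => G x * ((H x)^*)%C).
Proof.
move=> [mG fG] [mH fH].
have P F : cmeas F -> (tnorm2 F < +oo)%E ->
    mu.-integrable setT (fun x => (\1_torus x * nsq (F x))%:E).
  move=> mF fF; apply/integrableP; split.
    apply/measurable_EFinP; apply: measurable_funM; last exact: measurable_nsq.
    by apply: measurable_indic; exact: measurable_torus.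
  under eq_integral do rewrite gee0_abs ?lee_fin ?mulr_ge0 ?nsq_ge0//.
  by rewrite -tnorm2_indic.
apply: (@cintable_le _ _ _ mu _ (fun x => \1_torus x * nsq (G x) + \1_torus x * nsq (H x))).
- apply: cmeasM; first exact: measurable_indic_torus.
  by apply: cmeasM => //; exact: cmeas_conj.
- move=> x; rewrite !Normc.normcM normc_real normc_conj ger0_norm// -mulrDr ler_wpM2l//.
  rewrite -!sqr_normc; have := normc_ge0 (G x); have := normc_ge0 (H x).
  by nra.
- by rewrite /comp; under eq_fun do rewrite EFinD; apply: integrableD => //; exact: P.
Qed.

Lemma tintD G H : tintable G -> tintable H ->
  tint (fun x => G x + H x) = tint G + tint H.
Proof.
rewrite /tintable /tint => iG iH; rewrite -cintD//; congr cint.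
by apply/funext => x; rewrite mulrDr.
Qed.

Lemma tintZ z G : tintable G -> tint (fun x => z * G x) = z * tint G.
Proof.
rewrite /tintable /tint => iG; rewrite -cintZ//; congr cint.
by apply/funext => x; rewrite mulrCA.
Qed.

Lemma tint_sum (I : Type) (r : seq I) (F : I -> 'rV[R]_n -> R[i]) :
  (forall i, tintable (F i)) ->
  tint (fun x => \sum_(i <- r) F i x) = \sum_(i <- r) tint (F i).
Proof.
move=> iF; rewrite /tint -cint_sum//; congr cint.
by apply/funext => x; rewrite mulr_sumr.
Qed.

Definition ip G H : R[i] := tint (fun x => G x * ((H x)^*)%C).

Lemma ipDl G H K : tL2 G -> tL2 H -> tL2 K ->
  ip (fun x => G x + H x) K = ip G K + ip H K.
Proof.
move=> lG lH lK; rewrite /ip -tintD; [|exact: tintable_mul..].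
by congr tint; apply/funext => x; rewrite mulrDl.
Qed.

Lemma ipZl z G K : tL2 G -> tL2 K -> ip (fun x => z * G x) K = z * ip G K.
Proof.
move=> lG lK; rewrite /ip -tintZ; last exact: tintable_mul.
by congr tint; apply/funext => x; rewrite mulrA.
Qed.

Lemma ip_suml (I : Type) (r : seq I) (F : I -> 'rV[R]_n -> R[i]) K :
  (forall i, tL2 (F i)) -> tL2 K ->
  ip (fun x => \sum_(i <- r) F i x) K = \sum_(i <- r) ip (F i) K.
Proof.
move=> lF lK; rewrite /ip -tint_sum; last by move=> i; exact: tintable_mul.
by congr tint; apply/funext => x; rewrite mulr_suml.
Qed.

Lemma ipC G H : tL2 G -> tL2 H -> ip H G = ((ip G H)^*)%C.
Proof.
move=> lG lH; have [_ iI] := tintable_mul lG lH.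
rewrite /ip /tint; apply: complex_eqP => /=.
  apply: eq_Rintegral => x _.
  by case: (G x) (H x) => [a b] [a' b'] /=; ring.
rewrite -[RHS]mulN1r -RintegralZl//; apply: eq_Rintegral => x _.
by case: (G x) (H x) => [a b] [a' b'] /=; ring.
Qed.

Lemma ip_tnorm2 G : tL2 G -> tnorm2 G = (Re (ip G G))%:E.
Proof.
move=> lG; have [iR _] := tintable_mul lG lG.
rewrite /ip /= /Rintegral fineK; last exact: integrable_fin_num.
rewrite tnorm2_indic; apply: eq_integral => x _; congr EFin.
by rewrite conj_mul_nsq ReM /= mulr0 subr0.
Qed.

Lemma ip_mode j k : ip (mode j) (mode k) = (if j == k then (2 * pi) ^+ n else 0)%:C%C.
Proof.
rewrite /ip; under eq_fun do rewrite mode_conj_mode.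
by rewrite (cint_torus_cis _).2 subr_eq0 eq_sym.
Qed.

End fourier_series.

(** * Fourier series of square integrable functions *)

Section bessel.
Context {R : realType} {n : nat}.
Local Notation mu := (lebesgue_rV R n).
Local Notation c := (@fourier_const R n).
Implicit Types (G H : 'rV[R]_n -> R[i]) (j k : 'rV[int]_n) (J : {fset 'rV[int]_n}).

(** Normalized so that the summands with unit coefficients are orthonormal. *)
Definition trig_sum J (a : 'rV[int]_n -> R[i]) (x : 'rV[R]_n) : R[i] :=
  \sum_(j <- J) a j * ((c%:C)%C * mode j x).

Definition coef G j : R[i] := (c%:C)%C * ip G (mode j).

Definition proj J G := trig_sum J (coef G).

Lemma tL2_trig_sum J a : tL2 (trig_sum J a).
Proof. by apply: tL2_sum => j; do 2 apply: tL2Z; exact: tL2_mode. Qed.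

Lemma sqr_const_complex : ((c%:C)%C * (c%:C)%C) * (((2 * pi) ^+ n)%:C)%C = 1 :> R[i].
Proof. by rewrite -!rmorphM /= -expr2 sqr_fourier_const. Qed.

Lemma big_fset_delta J k (F : 'rV[int]_n -> R[i]) :
  \sum_(j <- J) (if j == k then F j else 0) = if k \in J then F k else 0.
Proof.
case: ifPn => kJ.
  rewrite (bigD1_seq k) ?fset_uniq//= eqxx big1 ?addr0// => j /negbTE ->//.
rewrite big_seq big1// => j jJ; case: eqP => // jk.
by move: kJ; rewrite -jk jJ.
Qed.

Lemma coef_trig_sum J a k : coef (trig_sum J a) k = if k \in J then a k else 0.
Proof.
rewrite /coef /trig_sum ip_suml; [|by move=> j; do 2 apply: tL2Z; exact: tL2_mode|exact: tL2_mode].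
rewrite -(big_fset_delta J k a) mulr_sumr; apply: eq_bigr => j _.
rewrite !ipZl; try solve [exact: tL2_mode|apply: tL2Z; exact: tL2_mode].
rewrite ip_mode; case: eqP => _; last by rewrite !mulr0.
rewrite -[RHS]mulr1 -sqr_const_complex; ring.
Qed.

Lemma ip_trig_sum J a G : tL2 G ->
  ip (trig_sum J a) G = \sum_(j <- J) a j * ((coef G j)^*)%C.
Proof.
move=> lG; rewrite /trig_sum ip_suml//; last first.
  by move=> j; do 2 apply: tL2Z; exact: tL2_mode.
apply: eq_bigr => j _.
rewrite !ipZl//; try solve [exact: tL2_mode|apply: tL2Z; exact: tL2_mode].
rewrite (ipC lG (tL2_mode j)) /coef rmorphM /=; congr (_ * (_ * _)).
by rewrite oppr0.
Qed.

Lemma tnorm2_trig_sum J a : tnorm2 (trig_sum J a) = (\sum_(j <- J) nsq (a j))%:E.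
Proof.
rewrite ip_tnorm2; last exact: tL2_trig_sum.
rewrite ip_trig_sum; last exact: tL2_trig_sum.
rewrite big_seq (eq_bigr (fun j => ((nsq (a j))%:C)%C)); last first.
  by move=> j jJ; rewrite coef_trig_sum jJ conj_mul_nsq.
by rewrite -big_seq -rmorph_sum.
Qed.

Lemma coefD G H j : tL2 G -> tL2 H -> coef (fun x => G x + H x) j = coef G j + coef H j.
Proof. by move=> lG lH; rewrite /coef ipDl ?mulrDr//; exact: tL2_mode. Qed.

Lemma coefN G j : tL2 G -> coef (fun x => - G x) j = - coef G j.
Proof.
move=> lG; rewrite /coef -mulrN; congr (_ * _).
rewrite -[RHS]mulN1r -(ipZl _ lG (tL2_mode j)); congr ip.
by apply/funext => x; rewrite mulN1r.
Qed.

Lemma coefB G H j : tL2 G -> tL2 H -> coef (fun x => G x - H x) j = coef G j - coef H j.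
Proof. by move=> lG lH; rewrite coefD ?coefN//; exact: tL2N. Qed.

(** Pythagoras: the residual is orthogonal to the partial sum. *)
Lemma bessel_identity J G : tL2 G ->
  tnorm2 G = (tnorm2 (fun x => G x - proj J G x)%R + (\sum_(j <- J) nsq (coef G j))%:E)%E.
Proof.
move=> lG; set P := proj J G; set H := fun x => _.
have lP : tL2 P by exact: tL2_trig_sum.
have lH : tL2 H by exact: tL2B.
have PH : ip P H = 0.
  rewrite ip_trig_sum// big_seq big1// => j jJ.
  by rewrite /H coefB// [coef P j]coef_trig_sum jJ subrr rmorph0 mulr0.
have HP : ip H P = 0 by rewrite (ipC lP lH) PH rmorph0.
have GE : G = fun x => H x + P x by apply/funext => x; rewrite /H subrK.
rewrite -tnorm2_trig_sum -/P !ip_tnorm2// -EFinD; congr EFin.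
rewrite -ReD; congr Re.
have A K : tL2 K -> ip G K = ip H K + ip P K by move=> lK; rewrite {1}GE ipDl.
rewrite A// (ipC lG lH) (ipC lG lP) !A// PH HP addr0 add0r.
by rewrite -(ipC lH lH) -(ipC lP lP).
Qed.

Lemma bessel_residual J G : tL2 G -> (tnorm2 (fun x => G x - proj J G x)%R <= tnorm2 G)%E.
Proof.
by move=> lG; rewrite [leRHS](bessel_identity J)// leeDl// lee_fin sumr_ge0// => j _; exact: nsq_ge0.
Qed.

(** * Approximation by trigonometric polynomials *)

Definition trig_poly (l : seq (R[i] * 'rV[int]_n)) (x : 'rV[R]_n) : R[i] :=
  \sum_(p <- l) p.1 * mode p.2 x.

Definition approximable G := cmeas G /\
  forall e : R, 0 < e -> exists l, (tnorm2 (fun x => G x - trig_poly l x)%R <= e%:E)%E.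

Lemma tL2_trig_poly l : tL2 (trig_poly l).
Proof. by apply: tL2_sum => p; apply: tL2Z; exact: tL2_mode. Qed.

Lemma proj_mode J k : k \in J -> proj J (mode k) = mode k.
Proof.
move=> kJ; apply/funext => x; rewrite /proj /trig_sum.
rewrite (eq_bigr (fun j => if j == k then mode k x else 0)); last first.
  move=> j _; rewrite /coef ip_mode eq_sym; case: eqP => [->|_]; last by rewrite mulr0 mul0r.
  by rewrite -[RHS]mul1r -sqr_const_complex; ring.
by rewrite big_fset_delta kJ.
Qed.

Lemma proj_trig_poly J l : (forall p, p \in l -> p.2 \in J) ->
  proj J (trig_poly l) = trig_poly l.
Proof.
move=> lJ; apply/funext => x; rewrite /proj /trig_sum /trig_poly.
have coefE j : coef (trig_poly l) j = \sum_(p <- l) p.1 * coef (mode p.2) j.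
  rewrite /coef /trig_poly ip_suml; [|by move=> p; apply: tL2Z; exact: tL2_mode|exact: tL2_mode].
  rewrite mulr_sumr; apply: eq_bigr => p _.
  by rewrite ipZl; [rewrite mulrCA|exact: tL2_mode|exact: tL2_mode].
under eq_bigr do rewrite coefE mulr_suml.
rewrite exchange_big /= big_seq [RHS]big_seq; apply: eq_bigr => p pl.
transitivity (p.1 * proj J (mode p.2) x); last by rewrite proj_mode// lJ.
rewrite /proj /trig_sum mulr_sumr.
by apply: eq_bigr => j _; rewrite -mulrA.
Qed.

Lemma projB J G H : tL2 G -> tL2 H ->
  proj J (fun x => G x - H x) = fun x => proj J G x - proj J H x.
Proof.
move=> lG lH; apply/funext => x; rewrite /proj /trig_sum -sumrB.
by apply: eq_bigr => j _; rewrite coefB// mulrBl.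
Qed.

(** A partial sum is at least as close to [G] as any trigonometric polynomial
    with the same frequencies: both have the same residual after projection. *)
Lemma proj_cvg G : tL2 G -> approximable G -> forall e : R, 0 < e ->
  exists J0, forall J, (J0 `<=` J)%fset ->
    (tnorm2 (fun x => G x - proj J G x)%R <= e%:E)%E.
Proof.
move=> lG [_ aG] e e0; have [l le] := aG e e0.
exists (seq_fset tt (map snd l)) => J J0J.
have lJ p : p \in l -> p.2 \in J.
  by move=> pl; apply: (fsubsetP J0J); rewrite seq_fsetE; exact: map_f.
apply: le_trans le.
have lP := tL2_trig_poly l.
rewrite (_ : (fun x => G x - proj J G x) = (fun x => (G x - trig_poly l x) -
    proj J (fun y => G y - trig_poly l y) x)).
  exact: bessel_residual (tL2B lG lP).
by apply/funext => x; rewrite projB// proj_trig_poly//; ring.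
Qed.

Lemma trig_polyD l m x : trig_poly l x + trig_poly m x = trig_poly (l ++ m) x.
Proof. by rewrite /trig_poly big_cat. Qed.

Lemma trig_polyM l m x : trig_poly l x * trig_poly m x =
  trig_poly [seq (p.1 * q.1, p.2 + q.2) | p <- l, q <- m] x.
Proof.
rewrite /trig_poly big_allpairs_dep mulr_suml; apply: eq_bigr => p _.
rewrite mulr_sumr; apply: eq_bigr => q _ /=.
by rewrite -mode_mul; ring.
Qed.

Lemma trig_poly_bounded l : exists K : R, forall x, nsq (trig_poly l x) <= K.
Proof.
exists ((\sum_(p <- l) normc p.1) ^+ 2) => x; rewrite -sqr_normc.
rewrite lerXn2r ?nnegrE ?normc_ge0//; first by rewrite sumr_ge0// => p _; exact: normc_ge0.
rewrite (le_trans (normc_sum _ _))// ler_sum// => p _.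
by rewrite Normc.normcM normc_cis mulr1.
Qed.

Lemma approximable_trig_poly l : approximable (trig_poly l).
Proof.
split; first by case: (tL2_trig_poly l).
move=> e e0; exists l; rewrite /tnorm2 integral0_eq ?lee_fin ?ltW// => x _.
by rewrite subrr /nsq /= expr0n addr0.
Qed.

Lemma approximable_lim G : cmeas G ->
  (forall e : R, 0 < e -> exists2 H, approximable H &
     (tnorm2 (fun x => G x - H x)%R <= e%:E)%E) -> approximable G.
Proof.
move=> mG aG; split => // e e0.
have e4 : 0 < e / 4 by rewrite divr_gt0.
have [H [mH aH] GH] := aG _ e4; have [l Hl] := aH _ e4; exists l.
have [ml _] := tL2_trig_poly l.
rewrite (_ : (fun x => G x - trig_poly l x) =
    fun x => (G x - H x) + (H x - trig_poly l x)); last by apply/funext => x; ring.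
apply: le_trans (tnorm2D_le (cmeasB mG mH) (cmeasB mH ml)) _.
rewrite [leRHS](_ : _ = 2%:E * (e / 4)%:E + 2%:E * (e / 4)%:E)%E; last first.
  by rewrite -!EFinM -EFinD; congr EFin; field.
by rewrite leeD// lee_pmul2l// lte_fin.
Qed.

Lemma approximableD G H : approximable G -> approximable H ->
  approximable (fun x => G x + H x).
Proof.
move=> [mG aG] [mH aH]; split; first exact: cmeasD.
move=> e e0; have e4 : 0 < e / 4 by rewrite divr_gt0.
have [l Gl] := aG _ e4; have [m Hm] := aH _ e4; exists (l ++ m).
have [ml _] := tL2_trig_poly l; have [mm _] := tL2_trig_poly m.
rewrite (_ : (fun x => _ - _) =
    fun x => (G x - trig_poly l x) + (H x - trig_poly m x)); last first.
  by apply/funext => x; rewrite -trig_polyD; ring.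
apply: le_trans (tnorm2D_le (cmeasB mG ml) (cmeasB mH mm)) _.
rewrite [leRHS](_ : _ = 2%:E * (e / 4)%:E + 2%:E * (e / 4)%:E)%E; last first.
  by rewrite -!EFinM -EFinD; congr EFin; field.
by rewrite leeD// lee_pmul2l// lte_fin.
Qed.

Lemma tnorm2_mul_small (K e : R) u G : 0 < e -> cmeas u -> cmeas G ->
  (forall x, nsq (u x) <= K) ->
  (tnorm2 G <= (e / (K + 1))%:E)%E -> (tnorm2 (fun x => u x * G x)%R <= e%:E)%E.
Proof.
move=> e0 mu_ mG uK Ge; have K0 : 0 <= K by apply: le_trans (uK 0); exact: nsq_ge0.
apply: le_trans (tnorm2_bounded_mul mu_ mG uK) _.
apply: (@le_trans _ _ (K%:E * (e / (K + 1))%:E)%E); first by rewrite lee_wpmul2l ?lee_fin.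
rewrite -EFinM lee_fin mulrCA; apply: ler_piMr; first exact: ltW.
by rewrite ler_pdivrMr ?mul1r ?ltr_wpDl// lerDl.
Qed.

(** With [l] close to [u] and [m] close to [G], the identity
    [u G - l m = u (G - m) + m (u - l)] leaves two errors with a bounded factor:
    choose [m] first, then [l] according to the bound of [m]. *)
Lemma approximableM (K : R) u G : approximable u -> (forall x, nsq (u x) <= K) ->
  approximable G -> approximable (fun x => u x * G x).
Proof.
move=> [mu_ au] uK [mG aG]; split; first exact: cmeasM.
move=> e e0; have e4 : 0 < e / 4 by rewrite divr_gt0.
have K0 : 0 <= K by apply: le_trans (uK 0); exact: nsq_ge0.
have [|m Gm] := aG (e / 4 / (K + 1)); first by rewrite divr_gt0// ltr_wpDl.
have [B mB] := trig_poly_bounded m.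
have B0 : 0 <= B by apply: le_trans (mB 0); exact: nsq_ge0.
have [|l ul] := au (e / 4 / (B + 1)); first by rewrite divr_gt0// ltr_wpDl.
have [ml _] := tL2_trig_poly l; have [mm _] := tL2_trig_poly m.
exists [seq (p.1 * q.1, p.2 + q.2) | p <- l, q <- m].
rewrite (_ : (fun x => _ - _) = fun x => u x * (G x - trig_poly m x) +
    trig_poly m x * (u x - trig_poly l x)); last first.
  by apply/funext => x; rewrite -trig_polyM; ring.
apply: le_trans (tnorm2D_le (cmeasM mu_ (cmeasB mG mm)) (cmeasM mm (cmeasB mu_ ml))) _.
rewrite [leRHS](_ : _ = 2%:E * (e / 4)%:E + 2%:E * (e / 4)%:E)%E; last first.
  by rewrite -!EFinM -EFinD; congr EFin; field.
rewrite leeD// lee_pmul2l// ?lte_fin//.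
  by apply: (tnorm2_mul_small e4 mu_ (cmeasB mG mm) uK Gm).
by apply: (tnorm2_mul_small e4 mm (cmeasB mu_ ml) mB ul).
Qed.

End bessel.

(** * Completeness of the trigonometric system *)

Section density.
Context {R : realType} {n : nat}.
Local Notation mu := (lebesgue_rV R n).
Implicit Types (u v h : 'rV[R]_n -> R) (E : set 'rV[R]_n).

Lemma cvge0_near_small (w : nat -> \bar R) (e : R) : w @ \oo --> 0%E -> 0 < e ->
  \forall m \near \oo, (w m <= e%:E)%E.
Proof.
move=> /fine_cvgP[fw w0] e0.
have near_small : \forall m \near \oo, `|0 - fine (w m)| <= e.
  by move/cvgrPdist_le : w0; exact.
near=> m.
have fm : w m \is a fin_num by near: m.
rewrite -(fineK fm) lee_fin.
have : `|0 - fine (w m)| <= e by near: m.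
by rewrite sub0r normrN; apply: le_trans; exact: ler_norm.
Unshelve. all: by end_near. Qed.

Definition rapprox u := approximable (fun x => ((u x)%:C)%C).

Lemma rapprox_measurable u : rapprox u -> measurable_fun setT u.
Proof. by case => -[]. Qed.

(** Dominated pointwise convergence on the torus entails convergence in L^2
    there, under which approximability is preserved. *)
Lemma rapprox_dct (u_ : nat -> 'rV[R]_n -> R) u h :
  (forall m, rapprox (u_ m)) -> measurable_fun setT u -> measurable_fun setT h ->
  (forall x, torus x -> u_ m x @[m --> \oo] --> u x) ->
  (forall m x, torus x -> `|u_ m x| <= h x) -> (forall x, torus x -> `|u x| <= h x) ->
  (\int[mu]_(x in torus) (h x ^+ 2)%:E < +oo)%E -> rapprox u.
Proof.
move=> au mu_ mh cu bu bu' fh; apply: approximable_lim; first exact: cmeas_real.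
move=> e e0.
have mT := @measurable_torus R n.
have cvg0 : (\int[mu]_(x in torus) ((u x - u_ m x) ^+ 2)%:E)%E @[m --> \oo] --> 0%E.
  rewrite [X in _ --> X](_ : _ = \int[mu]_(x in torus) 0%E)%E; last by rewrite integral0.
  apply: (@dominated_cvg _ _ _ mu torus mT _ _ (fun x => (4 * h x ^+ 2)%:E)) => //.
  - move=> m; apply/measurable_EFinP; apply: measurable_funTS; apply: measurable_funX.
    by apply: measurable_funB => //; exact: rapprox_measurable.
  - move=> x Tx; apply/fine_cvgP; split; first exact: nearW.
    rewrite [X in _ --> X](_ : _ = (u x - u x) ^+ 2); last by rewrite subrr expr0n.
    rewrite /comp /=; under eq_fun do rewrite expr2.
    by rewrite expr2; apply: cvgM; apply: cvgB; [exact: cvg_cst|exact: cu|exact: cvg_cst|exact: cu].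
  - apply/integrableP; split.
      apply/measurable_EFinP; apply: measurable_funTS; apply: measurable_funM => //.
      exact: measurable_funX.
    have E x : `|(4 * h x ^+ 2)%:E|%E = (4%:E * (h x ^+ 2)%:E)%E.
      by rewrite gee0_abs// lee_fin mulr_ge0// sqr_ge0.
    under eq_integral do rewrite E.
    rewrite ge0_integralZl//.
    + by rewrite lte_mul_pinfty.
    + by apply/measurable_EFinP; apply: measurable_funTS; exact: measurable_funX.
    + by move=> x _; rewrite lee_fin sqr_ge0.
  - move=> m x Tx; rewrite /= lee_fin ger0_norm ?sqr_ge0//.
    rewrite (_ : 4 * h x ^+ 2 = (h x + h x) ^+ 2); last by ring.
    rewrite -real_normK ?num_real//.
    have hx := bu m x Tx; have hx' := bu' x Tx.
    rewrite lerXn2r ?nnegrE//; first by rewrite addr_ge0// (le_trans _ hx).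
    by rewrite (le_trans (ler_normB _ _))// lerD.
have [m _ /(_ m (leqnn m)) /= le] := cvge0_near_small cvg0 e0.
exists (fun x => ((u_ m x)%:C)%C); first exact: au.
apply: le_trans le; rewrite le_eqVlt; apply/orP; left; apply/eqP.
by apply: eq_integral => x _; rewrite -rmorphB nsq_real.
Qed.

Lemma rapprox_eq u v : measurable_fun setT v -> (forall x, torus x -> u x = v x) ->
  rapprox u -> rapprox v.
Proof.
move=> mv uv [_ au]; split; first exact: cmeas_real.
move=> e e0; have [l le] := au e e0; exists l; apply: le_trans le.
rewrite le_eqVlt; apply/orP; left; apply/eqP.
by apply: eq_integral => x /set_mem Tx; rewrite uv.
Qed.

Lemma rapproxD u v : rapprox u -> rapprox v -> rapprox (fun x => u x + v x).
Proof.
by move=> au av; rewrite /rapprox; under eq_fun do rewrite rmorphD; exact: approximableD.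
Qed.

Lemma rapproxM (K : R) u v : rapprox u -> (forall x, `|u x| <= K) -> rapprox v ->
  rapprox (fun x => u x * v x).
Proof.
move=> au uK av; rewrite /rapprox; under eq_fun do rewrite rmorphM.
apply: (@approximableM _ _ (K ^+ 2)) => // x.
rewrite nsq_real -real_normK ?num_real// lerXn2r ?nnegrE//.
by rewrite (le_trans _ (uK x)).
Qed.

Lemma rapprox_cst (t : R) : rapprox (fun=> t).
Proof.
rewrite /rapprox (_ : (fun _ => _) = @trig_poly R n [:: ((t%:C)%C, 0)]).
  exact: approximable_trig_poly.
by apply/funext => x; rewrite /trig_poly big_seq1 /mode lat0 dot0l oppr0 cis0 mulr1.
Qed.

Lemma rapproxZ (t : R) u : rapprox u -> rapprox (fun x => t * u x).
Proof. by move=> au; apply: (@rapproxM `|t|) => //; exact: rapprox_cst. Qed.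

Lemma rapproxB u v : rapprox u -> rapprox v -> rapprox (fun x => u x - v x).
Proof.
move=> au av; under eq_fun do rewrite -mulN1r.
by apply: rapproxD => //; exact: rapproxZ.
Qed.

Lemma rapprox_sum (I : Type) (r : seq I) (F : I -> 'rV[R]_n -> R) :
  (forall i, rapprox (F i)) -> rapprox (fun x => \sum_(i <- r) F i x).
Proof.
move=> aF; elim: r => [|i r ih].
  by under eq_fun do rewrite big_nil; exact: rapprox_cst.
by under eq_fun do rewrite big_cons; exact: rapproxD.
Qed.

Lemma dot_delta (i : 'I_n) (s : int) (x : 'rV[R]_n) :
  dot (lat (s *: delta_mx ord0 i : 'rV[int]_n)) x = s%:~R * x ord0 i.
Proof.
rewrite /dot (bigD1 i)//= big1 ?addr0 => [|k ki]; rewrite !mxE !eqxx/=.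
  by rewrite mulr1.
by rewrite (negbTE ki) mulr0 mul0r.
Qed.

Lemma rapprox_cos i : rapprox (fun x => cos (x ord0 i)).
Proof.
rewrite /rapprox (_ : (fun _ => _) = @trig_poly R n
  [:: (((2^-1)%:C)%C, 1 *: delta_mx ord0 i); (((2^-1)%:C)%C, -1 *: delta_mx ord0 i)]).
  exact: approximable_trig_poly.
apply/funext => x; rewrite /trig_poly big_cons big_seq1 /mode !dot_delta mul1r mulN1r opprK.
by apply: complex_eqP; rewrite ?ReD ?ImD ?ReM ?ImM /= ?cosN ?sinN; field.
Qed.

Lemma rapprox_sin i : rapprox (fun x => sin (x ord0 i)).
Proof.
rewrite /rapprox (_ : (fun _ => _) = @trig_poly R n
  [:: ((0 +i* 2^-1)%C, 1 *: delta_mx ord0 i); ((0 -i* 2^-1)%C, -1 *: delta_mx ord0 i)]).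
  exact: approximable_trig_poly.
apply/funext => x; rewrite /trig_poly big_cons big_seq1 /mode !dot_delta mul1r mulN1r opprK.
by apply: complex_eqP; rewrite ?ReD ?ImD ?ReM ?ImM /= ?cosN ?sinN; field.
Qed.

(** * Indicator functions *)

(** The cubic [3 t^2 - 2 t^3] maps [0, 1] to itself, and its iterates push every
    point there other than 1/2 to 0 or to 1. *)
Definition sharpen (t : R) : R := 3 * t ^+ 2 - 2 * t ^+ 3.

Lemma sharpen_itv t : 0 <= t <= 1 -> 0 <= sharpen t <= 1.
Proof.
move=> /andP[t0 t1]; apply/andP; split.
  have -> : sharpen t = t ^+ 2 * (3 - 2 * t) by rewrite /sharpen; ring.
  by rewrite mulr_ge0 ?sqr_ge0//; lra.
rewrite -subr_ge0; have -> : 1 - sharpen t = (1 - t) ^+ 2 * (1 + 2 * t).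
  by rewrite /sharpen; ring.
by rewrite mulr_ge0 ?sqr_ge0//; lra.
Qed.

Lemma iter_sharpen_itv m t : 0 <= t <= 1 -> 0 <= iter m sharpen t <= 1.
Proof. by move=> t01; elim: m => [//|m ih] /=; exact: sharpen_itv. Qed.

Lemma sharpen_compl t : sharpen (1 - t) = 1 - sharpen t.
Proof. by rewrite /sharpen; ring. Qed.

Lemma iter_sharpen_compl m t : iter m sharpen (1 - t) = 1 - iter m sharpen t.
Proof. by elim: m => [//|m ih] /=; rewrite ih sharpen_compl. Qed.

Lemma cvg_iter_sharpen0 (t : R) : 0 <= t < 1 / 2 -> iter m sharpen t @[m --> \oo] --> 0.
Proof.
move=> /andP[t0 t12].
(* [sharpen s = s * (s * (3 - 2 * s))], and the last factor is at most [r < 1]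
   for [s <= t]. *)
pose r := t * (3 - 2 * t).
have r0 : 0 <= r by rewrite /r; nra.
have r1 : r < 1.
  have : 0 < (1 - t) * (1 - 2 * t) by rewrite mulr_gt0//; lra.
  by move=> lt0; rewrite -subr_gt0 (_ : 1 - r = (1 - t) * (1 - 2 * t))// /r; ring.
have bound m : 0 <= iter m sharpen t <= t * r ^+ m.
  elim: m => [|m /andP[i0 ir]] /=; first by rewrite expr0 mulr1 t0 lexx.
  have it : iter m sharpen t <= t.
    rewrite (le_trans ir)// ler_piMr// exprn_ile1// ltW//.
  set s := iter m sharpen t in i0 ir it *.
  have -> : sharpen s = s * (s * (3 - 2 * s)) by rewrite /sharpen; ring.
  have sr : s * (3 - 2 * s) <= r by rewrite /r; nra.
  have s3 : 0 <= s * (3 - 2 * s) by rewrite mulr_ge0//; lra.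
  apply/andP; split; first by rewrite mulr_ge0.
  by rewrite exprSr [leRHS]mulrA ler_pM.
apply: (squeeze_cvgr (f := cst 0) (h := fun m => t * r ^+ m)).
- by apply: nearW => m; exact: bound.
- exact: cvg_cst.
- rewrite -[X in _ --> X](mulr0 t); apply: cvgM; first exact: cvg_cst.
  by apply: cvg_expr; rewrite ger0_norm.
Qed.

Lemma cvg_iter_sharpen (t : R) : 0 <= t <= 1 ->
  iter m sharpen t @[m --> \oo] --> (if t < 1 / 2 then 0 else if t == 1 / 2 then 1 / 2 else 1 : R).
Proof.
move=> /andP[t0 t1]; case: ltgtP => t12.
- by apply: cvg_iter_sharpen0; rewrite t0.
- rewrite -[X in _ --> X]subr0.
  rewrite (_ : (fun m => _) = fun m => 1 - iter m sharpen (1 - t)); last first.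
    by apply/funext => m; rewrite iter_sharpen_compl subKr.
  apply: cvgB; first exact: cvg_cst.
  by apply: cvg_iter_sharpen0; apply/andP; split; lra.
- rewrite (_ : (fun m => _) = cst (1 / 2)); first exact: cvg_cst.
  apply/funext => m; rewrite t12 /cst; elim: m => [//|m ih] /=; rewrite ih /sharpen.
  by field.
Qed.

Lemma indic_boolE (p : pred 'rV[R]_n) x : \1_[set x | p x] x = (p x)%:R :> R.
Proof.
rewrite indicE; case: (boolP (p x)) => px; first by rewrite mem_set.
by rewrite memNset//; exact/negP.
Qed.

(** The iterates of [sharpen] on [u] converge to a function [w] with values 0,
    1/2 and 1, and [2 w^2 - w] sends these values to 0, 0 and 1. *)
Lemma rapprox_gt_half u : rapprox u -> (forall x, 0 <= u x <= 1) ->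
  rapprox (\1_[set x | 1 / 2 < u x]).
Proof.
move=> au u01.
have mu_ := rapprox_measurable au.
have b1 (t : R) : 0 <= t <= 1 -> `|t| <= 1 by move=> /andP[t0 t1]; rewrite ger0_norm.
have asharp v : rapprox v -> (forall x, 0 <= v x <= 1) -> rapprox (fun x => sharpen (v x)).
  move=> av v01; rewrite /sharpen.
  have vb x : `|v x| <= 1 by exact: b1.
  have a2 : rapprox (fun x => v x ^+ 2).
    by under eq_fun do rewrite expr2; exact: (rapproxM av vb av).
  apply: rapproxB; apply: rapproxZ => //.
  by under eq_fun do rewrite exprS; exact: (rapproxM av vb a2).
have aiter m : rapprox (fun x => iter m sharpen (u x)).
  by elim: m => [//|m ih] /=; apply: asharp => // x; exact: iter_sharpen_itv.
pose w x : R := if u x < 1 / 2 then 0 else if u x == 1 / 2 then 1 / 2 else 1.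
have w01 x : 0 <= w x <= 1.
  by rewrite /w; case: ifP => _; [|case: ifP => _]; apply/andP; split; lra.
have aw : rapprox w.
  apply: (rapprox_dct (h := cst 1) aiter) => //.
  - apply: measurable_fun_ifT.
    + by apply: measurable_fun_ltr => //; exact: measurable_cst.
    + exact: measurable_cst.
    + apply: measurable_fun_ifT; [|exact: measurable_cst|exact: measurable_cst].
      by apply: measurable_fun_eqr => //; exact: measurable_cst.
  - by move=> x _; exact: cvg_iter_sharpen.
  - by move=> m x _; apply: b1; exact: iter_sharpen_itv.
  - by move=> x _; exact: b1.
  - rewrite /cst expr1n integral_cst; last exact: measurable_torus.
    by rewrite mul1e [X in (X < _)%E]torus_measure ltry.
have aww : rapprox (fun x => 2 * (w x * w x) - w x).
  apply: rapproxB => //; apply: rapproxZ; apply: (@rapproxM 1) => // x; exact: b1.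
apply: rapprox_eq aww.
  apply: measurable_indic; rewrite -[X in measurable X]setTI.
  by apply: measurable_fun_ltr => //; exact: measurable_cst.
move=> x _; rewrite indic_boolE /w.
by case: ltgtP => _ /=; lra.
Qed.

(** By an affine change of [u] that maps the threshold [a] to 1/2. *)
Lemma rapprox_gt (K a : R) u : rapprox u -> (forall x, `|u x| <= K) ->
  rapprox (\1_[set x | a < u x]).
Proof.
move=> au uK.
have K0 : 0 <= K by rewrite (le_trans _ (uK 0)).
(* [M] exceeds the modulus of [u - a]. *)
pose M := K + `|a| + 1.
have M0 : 0 < M by rewrite /M ltr_wpDl// addr_ge0.
have := @rapprox_gt_half (fun x => (u x - a) / (2 * M) + 1 / 2).
rewrite (_ : [set x | a < u x] = [set x | 1 / 2 < (u x - a) / (2 * M) + 1 / 2]).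
  apply.
    apply: rapproxD; last exact: rapprox_cst.
    under eq_fun do rewrite mulrC; apply: rapproxZ; apply: rapproxB => //.
    exact: rapprox_cst.
  move=> x; have : `|(u x - a) / (2 * M)| <= 1 / 2.
    have M2 : 0 < 2 * M by rewrite mulr_gt0.
    rewrite normrM normfV (gtr0_norm M2) ler_pdivrMr// (_ : 1 / 2 * (2 * M) = M); last by field.
    rewrite (le_trans (ler_normB _ _))// /M -addrA lerD// lerDl//.
  by rewrite ler_norml => /andP[? ?]; apply/andP; split; lra.
apply/seteqP; split => x /=; rewrite ltrDr pmulr_lgt0 ?invr_gt0 ?mulr_gt0// subr_gt0//.
Qed.

Definition approx_set E := measurable E /\ rapprox (\1_E).

Lemma approx_setC E : approx_set E -> approx_set (~` E).
Proof.
move=> [mE aE]; split; first exact: measurableC.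
rewrite (_ : \1_(~` E) = fun x => 1 - \1_E x :> R).
  by apply: rapproxB => //; exact: rapprox_cst.
by apply/funext => x; rewrite !indicE in_setC; case: (x \in E); rewrite ?subrr ?subr0.
Qed.

Lemma indic_le1 E x : `|\1_E x| <= 1 :> R.
Proof. by rewrite indicE; case: (x \in E); rewrite ?normr1 ?normr0. Qed.

Lemma approx_setI E F : approx_set E -> approx_set F -> approx_set (E `&` F).
Proof.
move=> [mE aE] [mF aF]; split; first exact: measurableI.
rewrite indicI; apply: (@rapproxM 1) => // x; exact: indic_le1.
Qed.

Lemma approx_setU E F : approx_set E -> approx_set F -> approx_set (E `|` F).
Proof.
move=> aE aF; rewrite -[E]setCK -[F]setCK -setCI.
by apply: approx_setC; apply: approx_setI; exact: approx_setC.
Qed.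

Lemma approx_set0 : approx_set set0.
Proof. by split => //; rewrite indic0; exact: rapprox_cst. Qed.

Lemma approx_setT : approx_set setT.
Proof. by rewrite -setC0; apply: approx_setC; exact: approx_set0. Qed.

Lemma approx_bigcup (F : nat -> set 'rV[R]_n) : (forall m, approx_set (F m)) ->
  approx_set (\bigcup_m F m).
Proof.
move=> aF.
have aU m : approx_set (\big[setU/set0]_(k < m) F k).
  by elim/big_ind : _ => //; [exact: approx_set0|exact: approx_setU].
have mU : measurable (\bigcup_m F m) by apply: bigcup_measurable => m _; case: (aF m).
split => //.
apply: (rapprox_dct (h := cst 1) (fun m => (aU m).2)) => //.
- move=> x _; apply: cvg_near_cst; rewrite /indic.
  case: (pselect ((\bigcup_m F m) x)) => [[k _ Fkx]|nFx].
    exists k.+1 => // m /= km; rewrite !mem_set//; first by exists k.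
    by rewrite -bigcup_mkord; exists k.
  apply: nearW => m; rewrite !memNset// -bigcup_mkord => -[k _ Fkx].
  by apply: nFx; exists k.
- by move=> m x _; exact: indic_le1.
- by move=> x _; exact: indic_le1.
- rewrite /cst expr1n integral_cst; last exact: measurable_torus.
  by rewrite mul1e [X in (X < _)%E]torus_measure ltry.
Qed.

Lemma approx_set_sigma : sigma_algebra setT approx_set.
Proof.
split; first exact: approx_set0.
  by move=> E aE; rewrite setTD; exact: approx_setC.
exact: approx_bigcup.
Qed.

Lemma approx_set_eq E F : measurable F -> E `&` torus = F `&` torus ->
  approx_set E -> approx_set F.
Proof.
move=> mF EF [mE aE]; split => //; apply: rapprox_eq aE; first exact: measurable_indic.
move=> x Tx; rewrite !indicE; have EFx : E x <-> F x.
  by split=> H; [have [] : (F `&` torus) x by rewrite -EF|have [] : (E `&` torus) x by rewrite EF].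
by case: (pselect (E x)) => Ex; [rewrite !mem_set//; exact/EFx|rewrite !memNset//; move=> /EFx].
Qed.

Lemma approx_cos_gt i a : approx_set [set x | a < cos (x ord0 i)].
Proof.
have au := rapprox_cos i; split.
  rewrite -[X in measurable X]setTI; apply: measurable_fun_ltr => //; exact: rapprox_measurable.
by apply: (rapprox_gt _ au) => x; exact: cos_max.
Qed.

Lemma approx_cos_lt i a : approx_set [set x | cos (x ord0 i) < a].
Proof.
have au := rapproxZ (-1) (rapprox_cos i).
rewrite (_ : [set x | _] = [set x | - a < -1 * cos (x ord0 i)]); last first.
  by apply/seteqP; split => x /=; rewrite mulN1r ltrN2.
split.
  rewrite -[X in measurable X]setTI; apply: measurable_fun_ltr => //; exact: rapprox_measurable.
by apply: (rapprox_gt _ au) => x; rewrite mulN1r normrN; exact: cos_max.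
Qed.

Lemma approx_sin_lt i a : approx_set [set x | sin (x ord0 i) < a].
Proof.
have au := rapproxZ (-1) (rapprox_sin i).
rewrite (_ : [set x | _] = [set x | - a < -1 * sin (x ord0 i)]); last first.
  by apply/seteqP; split => x /=; rewrite mulN1r ltrN2.
split.
  rewrite -[X in measurable X]setTI; apply: measurable_fun_ltr => //; exact: rapprox_measurable.
by apply: (rapprox_gt _ au) => x; rewrite mulN1r normrN; exact: sin_max.
Qed.

(** On the torus a coordinate is negative iff its sine is negative or its cosine
    is -1, and the cosine is strictly monotone on each of [-pi, 0] and [0, pi]. *)
Lemma approx_coord_lt i (a : R) : approx_set [set x | x ord0 i < a].
Proof.
have mS : measurable [set x : 'rV[R]_n | x ord0 i < a].
  rewrite -[X in measurable X]setTI; apply: measurable_fun_ltr => //.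
  exact: measurable_coord.
have Tp (x : 'rV[R]_n) : torus x -> - pi <= x ord0 i < pi.
  by move=> /(_ i); rewrite (_ : - pi + 2 * pi = pi)//; ring.
have sin_neg (t : R) : - pi < t < 0 -> sin t < 0.
  move=> /andP[t1 t2]; rewrite -oppr_gt0 -sinN; apply: sin_gt0_pi.
  by rewrite oppr_gt0 t2 ltrNl.
have cos_gtN1 (t : R) : 0 <= t < pi -> -1 < cos t.
  move=> /andP[t0 tpi]; rewrite -cospi ltr_cos// in_itv/= ?t0 ?lexx ?pi_ge0 ?ltW//.
have cos_mono (t b : R) : 0 <= t <= pi -> 0 <= b <= pi -> (cos t < cos b) = (b < t).
  by move=> tp bp; rewrite ltr_cos// in_itv.
pose N := [set x : 'rV[R]_n | sin (x ord0 i) < 0] `|` ~` [set x | -1 < cos (x ord0 i)].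
have aN : approx_set N.
  by apply: approx_setU; [exact: approx_sin_lt|apply: approx_setC; exact: approx_cos_gt].
have NE (x : 'rV[R]_n) : torus x -> N x <-> x ord0 i < 0.
  move=> /Tp /andP[x1 x2]; split.
    case=> /= [sx|cx]; rewrite ltNge; apply/negP => x0.
      by move: sx; rewrite ltNge sin_ge0_pi// x0 ltW.
    by apply: cx; apply: cos_gtN1; rewrite x0.
  move=> x0; move: x1; rewrite le_eqVlt => /orP[/eqP x1|x1].
    by right => /=; rewrite -x1 cosN cospi ltxx.
  by left => /=; rewrite sin_neg// x1.
have [a1|a1] := leP a (- pi).
  apply: approx_set_eq approx_set0 => //.
  apply/seteqP; split => x [//= xa /Tp /andP[x1 _]].
  by move: (lt_le_trans xa a1); rewrite ltNge x1.
have [a2|a2] := leP pi a.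
  apply: approx_set_eq approx_setT => //.
  by apply/seteqP; split => x [_ Tx]; split => //=; have /andP[_ /lt_le_trans] := Tp _ Tx; apply.
have [a0|a0] := leP a 0.
  apply: (approx_set_eq _ _ (approx_setI aN (approx_cos_lt i (cos a)))) => //.
  apply/seteqP; split => x [xS Tx]; split => //; have /andP[x1 x2] := Tp _ Tx.
    case: xS => /(NE _ Tx) x0 /=; rewrite -cosN -[cos a]cosN cos_mono ?ltrN2//;
      by apply/andP; split; lra.
  have x0 : x ord0 i < 0 by apply: lt_le_trans xS a0.
  split; first exact/NE.
  rewrite /= -cosN -[cos a]cosN cos_mono ?ltrN2//; by apply/andP; split; lra.
apply: (approx_set_eq _ _ (approx_setU aN (approx_cos_gt i (cos a)))) => //.
apply/seteqP; split => x [xS Tx]; split => //; have /andP[x1 x2] := Tp _ Tx.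
  case: xS => [/(NE _ Tx) /lt_trans|/=]; first exact.
  have [x0|x0] := ltP (x ord0 i) 0; first by move=> _; exact: lt_trans a0.
  by rewrite cos_mono//; apply/andP; split; lra.
have [x0|x0] := ltP (x ord0 i) 0; first by left; exact/NE.
by right => /=; rewrite cos_mono//; apply/andP; split; lra.
Qed.

(** Such sets [B] form a sigma-algebra, and the rays generate the Borel sets. *)
Lemma approx_coord i (B : set R) : measurable B ->
  approx_set ((fun x : 'rV[R]_n => x ord0 i) @^-1` B).
Proof.
move=> mB; pose S : set (set R) := [set B | approx_set ((fun x : 'rV[R]_n => x ord0 i) @^-1` B)].
have gB : <<s @RGenInftyO.G R >> B.
  by have := mB; rewrite -[<<s _ >> B]/((@RGenInftyO.G R).-sigma.-measurable B) -RGenInftyO.measurableE.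
apply: (smallest_sub (X := S) _ _ gB).
  split; first by rewrite /S /= preimage_set0; exact: approx_set0.
    by move=> D aD; rewrite setTD /S /= preimage_setC; exact: approx_setC.
  by move=> F aF; rewrite /S /= preimage_bigcup; exact: approx_bigcup.
move=> _ [a ->].
rewrite /S /mkset; have <- : [set x : 'rV[R]_n | x ord0 i < a] =
    (fun x : 'rV[R]_n => x ord0 i) @^-1` `]-oo, a[%classic.
  by apply/seteqP; split => x /=; rewrite in_itv.
exact: approx_coord_lt.
Qed.

Lemma approx_setP E : measurable E -> approx_set E.
Proof.
move=> mE; apply: (smallest_sub (X := approx_set) _ _ mE); first exact: approx_set_sigma.
rewrite -bigcup_seq/=; apply: bigcup_sub => i _ A [B mB <-].
by rewrite setTI; exact: approx_coord.
Qed.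

Import HBNNSimple.

Lemma rapprox_nnsfun (g : {nnsfun 'rV[R]_n >-> R}) : rapprox g.
Proof.
rewrite (_ : (g : 'rV[R]_n -> R) =
    fun x => \sum_(y <- fset_set (range g)) y * \1_(g @^-1` [set y]) x); last first.
  by apply/funext => x; rewrite [LHS]fimfunE fsbig_finite.
apply: rapprox_sum => y; apply: rapproxZ.
have mg : measurable (g @^-1` [set y]) by [].
exact: (approx_setP mg).2.
Qed.

Lemma rapprox_ge0 u : measurable_fun setT u -> (forall x, 0 <= u x) ->
  (\int[mu]_(x in torus) (u x ^+ 2)%:E < +oo)%E -> rapprox u.
Proof.
move=> mu_ u0 fu.
have mE : measurable_fun setT (EFin \o u) by exact/measurable_EFinP.
have E0 x : [set: 'rV[R]_n] x -> (0 <= (EFin \o u) x)%E by move=> _; rewrite lee_fin.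
pose g := nnsfun_approx measurableT mE.
have gu m x : g m x <= u x.
  by rewrite -lee_fin /g nnsfun_approxE; exact: (le_approx m E0).
apply: (rapprox_dct (h := u) (fun m => rapprox_nnsfun (g m))) => //.
- move=> x _; have := cvg_nnsfun_approx measurableT mE E0 (x := x) Logic.I.
  by move=> /fine_cvgP[].
- by move=> m x _; rewrite ger0_norm.
- by move=> x _; rewrite ger0_norm.
Qed.

Lemma rapprox_sqr_integrable u : measurable_fun setT u ->
  (\int[mu]_(x in torus) (u x ^+ 2)%:E < +oo)%E -> rapprox u.
Proof.
move=> mu_ fu.
have half v : measurable_fun setT v -> (forall x, v x ^+ 2 = u x ^+ 2) ->
    rapprox (fun x => Num.max (v x) 0).
  move=> mv vu; have mmax : measurable_fun setT (fun x => Num.max (v x) 0).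
    by apply: measurable_maxr => //; exact: measurable_cst.
  apply: rapprox_ge0 => //; first by move=> x; rewrite le_max lexx orbT.
  apply: le_lt_trans fu; apply: ge0_le_integral => //.
  - exact: measurable_torus.
  - by move=> x _; rewrite lee_fin sqr_ge0.
  - by apply/measurable_EFinP; apply: measurable_funTS; exact: measurable_funX.
  - by apply/measurable_EFinP; apply: measurable_funTS; exact: measurable_funX.
  - move=> x _; rewrite lee_fin -vu; case: (leP (v x) 0) => _ //.
    by rewrite expr0n sqr_ge0.
rewrite (_ : u = fun x => Num.max (u x) 0 - Num.max (- u x) 0); last first.
  by apply/funext => x; case: (leP (u x) 0); case: (leP (- u x) 0); lra.
apply: rapproxB; first exact: half.
by apply: half => [|x]; [exact: measurableT_comp|rewrite sqrrN].
Qed.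

(** Every measurable set has an approximable indicator; hence so are simple
    functions, and by dominated convergence the positive and negative parts of
    the real and imaginary parts of a square integrable function. *)
Lemma approximable_tL2 (G : 'rV[R]_n -> R[i]) : tL2 G -> approximable G.
Proof.
move=> [[mr mi] fG].
have part (v : 'rV[R]_n -> R) : measurable_fun setT v ->
    (forall x, v x ^+ 2 <= nsq (G x)) -> rapprox v.
  move=> mv vG; apply: rapprox_sqr_integrable => //.
  apply: le_lt_trans fG; apply: ge0_le_integral => //.
  - exact: measurable_torus.
  - by move=> x _; rewrite lee_fin sqr_ge0.
  - by apply/measurable_EFinP; apply: measurable_funTS; exact: measurable_funX.
  - exact: measurable_nsqE.
  - by move=> x _; rewrite lee_fin.
have aR : rapprox (fun x => Re (G x)) by apply: part => // x; rewrite lerDl sqr_ge0.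
have aI : rapprox (fun x => Im (G x)) by apply: part => // x; rewrite lerDr sqr_ge0.
rewrite (_ : G = fun x => ((Re (G x))%:C)%C + 'i%C * ((Im (G x))%:C)%C); last first.
  by apply/funext => x; rewrite -complexE.
apply: approximableD => //; apply: (@approximableM _ _ 1) => //.
  rewrite (_ : (fun _ => _) = @trig_poly R n [:: ('i%C, 0)]).
    exact: approximable_trig_poly.
  by apply/funext => x; rewrite /trig_poly big_seq1 /mode lat0 dot0l oppr0 cis0 mulr1.
by move=> x; rewrite /nsq /= expr0n add0r expr1n.
Qed.

End density.

(** * The Fourier transform of a Gaussian *)

Section gaussian.
Context {R : realType}.
Local Notation leb := (@lebesgue_measure R).
Variable s : R.
Hypothesis s0 : 0 < s.

Definition gauss (r t : R) : R := normal_peak r * expR (- (t ^+ 2 / (2 * r ^+ 2))).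

Lemma gaussE r : 0 < r -> gauss r = normal_pdf 0 r.
Proof.
move=> r0; apply/funext => t; rewrite normal_pdfE ?gt_eqF// /gauss /normal_fun.
by rewrite subr0 mulNr -[r ^+ 2 *+ 2]mulr_natl.
Qed.

Lemma gauss_ge0 r t : 0 <= gauss r t.
Proof. by rewrite mulr_ge0 ?normal_peak_ge0 ?expR_ge0. Qed.

Lemma integrable_gauss r : 0 < r -> leb.-integrable setT (EFin \o gauss r).
Proof. by move=> r0; rewrite gaussE//; exact: integrable_normal_pdf. Qed.

Lemma Rintegral_gauss r : 0 < r -> \int[leb]_t gauss r t = 1.
Proof. by move=> r0; rewrite gaussE// /Rintegral integral_normal_pdf. Qed.

Lemma continuous_gauss : continuous (gauss s).
Proof. by rewrite gaussE//; apply: continuous_normal_pdf; rewrite gt_eqF. Qed.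

Lemma measurable_gauss : measurable_fun setT (gauss s).
Proof. by rewrite gaussE//; exact: measurable_normal_pdf. Qed.

Lemma is_derive_gauss (t : R) : is_derive t (1 : R) (gauss s) (- (t / s ^+ 2) * gauss s t).
Proof.
have s2 : s ^+ 2 != 0 by rewrite expf_neq0// gt_eqF.
apply: is_derive_eq.
rewrite /GRing.scale /gauss /=; move: (expR _) => e; field.
by rewrite gt_eqF.
Qed.

(** The factor [t] is absorbed by doubling the width. With [v = |t| / s] the
    claim is [v <= exp (3/8 v^2)], where 3/8 is the difference 1/2 - 1/8 of the
    two exponents, and it follows from [exp y >= 1 + y]. *)
Lemma gauss_moment : exists2 C : R, 0 <= C & forall t, `|t| * gauss s t <= C * gauss (2 * s) t.
Proof.
have p2 : 0 < @normal_peak R (2 * s) by rewrite normal_peak_gt0// gt_eqF// mulr_gt0.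
exists (s * normal_peak s / normal_peak (2 * s)).
  by rewrite divr_ge0 ?mulr_ge0 ?normal_peak_ge0// ltW.
move=> t; rewrite /gauss.
rewrite (_ : s * _ / _ * _ = normal_peak s * (s * expR (- (t ^+ 2 / (2 * (2 * s) ^+ 2)))));
  last by field; rewrite gt_eqF.
rewrite mulrCA ler_wpM2l ?normal_peak_ge0//.
rewrite (_ : - (t ^+ 2 / (2 * (2 * s) ^+ 2)) =
  3 / 8 * (t / s) ^+ 2 + - (t ^+ 2 / (2 * s ^+ 2))); last by field; rewrite gt_eqF.
rewrite expRD mulrA ler_wpM2r ?expR_ge0// mulrC -ler_pdivrMr//.
rewrite -{1}(gtr0_norm s0) -normf_div; set u := t / s.
apply: le_trans (expR_ge1Dx _).
rewrite -real_normK ?num_real//; set v := `|u|.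
(* [3/8 v^2 - v + 2/3] is 3/8 times the square of [v - 4/3]. *)
have := sqr_ge0 (v - 4 / 3); nra.
Qed.

Variable theta : R.

(** The phases 0 and [-pi/2] give the cosine and the sine transforms. *)
Definition gcos (z : R) : R := \int[leb]_t (gauss s t * cos (z * t + theta)).

Lemma continuous_phase (z : R) : continuous (fun t : R => z * t + theta).
Proof. by move=> t; apply: cvgD; [exact: mulrl_continuous|exact: cvg_cst]. Qed.

Lemma integrable_gcos (z : R) :
  leb.-integrable setT (EFin \o (fun t => gauss s t * cos (z * t + theta))).
Proof.
apply: (@le_integrable _ _ _ leb _ measurableT _ (EFin \o gauss s)); last exact: integrable_gauss.
  apply/measurable_EFinP; apply: measurable_funM; first exact: measurable_gauss.
  apply: continuous_measurable_fun => t.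
  by apply: continuous_comp; [exact: continuous_phase|exact: continuous_cos].
move=> t _; rewrite /= lee_fin normrM (ger0_norm (gauss_ge0 _ _)) ler_piMr ?gauss_ge0//.
exact: cos_max.
Qed.

Lemma integrable_moment : leb.-integrable setT (EFin \o (fun t => `|t| * gauss s t)).
Proof.
have [C C0 mC] := gauss_moment.
apply: (@le_integrable _ _ _ leb _ measurableT _ (EFin \o (fun t => C * gauss (2 * s) t))).
- apply/measurable_EFinP; apply: measurable_funM; last exact: measurable_gauss.
  by apply: continuous_measurable_fun; exact: norm_continuous.
- move=> t _; rewrite /= lee_fin (ger0_norm (mulr_ge0 (normr_ge0 t) (gauss_ge0 s t))).
  by rewrite (le_trans (mC t))// ler_norm.
- have ig : leb.-integrable setT (EFin \o gauss (2 * s)).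
    by apply: integrable_gauss; rewrite mulr_gt0.
  exact: (integrableZl measurableT C ig).
Qed.

Lemma integrable_gsin (z : R) :
  leb.-integrable setT (EFin \o (fun t => t * gauss s t * sin (z * t + theta))).
Proof.
apply: (@le_integrable _ _ _ leb _ measurableT _ (EFin \o (fun t => `|t| * gauss s t)));
  last exact: integrable_moment.
  apply/measurable_EFinP; apply: measurable_funM.
    by apply: measurable_funM => //; exact: measurable_gauss.
  apply: continuous_measurable_fun => t.
  by apply: continuous_comp; [exact: continuous_phase|exact: continuous_sin].
move=> t _; rewrite /= lee_fin !normrM normr_id ler_piMr ?sin_max// mulr_ge0//.
Qed.

(** Integration by parts: the derivative of [gauss s t * sin (z t + theta)] has
    integral zero, its primitive vanishing at infinity. *)
Lemma gauss_parts (z : R) :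
  \int[leb]_t (t * gauss s t * sin (z * t + theta)) = s ^+ 2 * z * gcos z.
Proof.
pose h t := gauss s t * sin (z * t + theta).
pose g t := z * (gauss s t * cos (z * t + theta)) +
  - s ^- 2 * (t * gauss s t * sin (z * t + theta)).
have s2 : s ^+ 2 != 0 by rewrite expf_neq0// gt_eqF.
have dh (t : R) : is_derive t (1 : R) h (g t).
  have dg := is_derive_gauss t.
  by apply: is_derive_eq; rewrite /GRing.scale/= /g; field; rewrite gt_eqF.
have cg : continuous g.
  move=> t; have cga := @continuous_gauss t.
  have cc : {for t, continuous (fun t => cos (z * t + theta))}.
    by apply: continuous_comp; [exact: continuous_phase|exact: continuous_cos].
  have cs : {for t, continuous (fun t => sin (z * t + theta))}.
    by apply: continuous_comp; [exact: continuous_phase|exact: continuous_sin].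
  apply: cvgD; apply: cvgM; try exact: cvg_cst; apply: cvgM => //.
  by apply: cvgM => //; exact: cvg_id.
have i1 : leb.-integrable setT (EFin \o (fun t => z * (gauss s t * cos (z * t + theta)))).
  exact: (integrableZl measurableT z (integrable_gcos z)).
have i2 : leb.-integrable setT
    (EFin \o (fun t => - s ^- 2 * (t * gauss s t * sin (z * t + theta)))).
  exact: (integrableZl measurableT (- s ^- 2) (integrable_gsin z)).
have [C C0 mC] := gauss_moment.
(* The boundary terms at [t] and [-t] are of order [1 / t]. *)
have hN (t : R) : 0 < t -> `|h t| <= C * normal_peak (2 * s) / t /\
    `|h (- t)| <= C * normal_peak (2 * s) / t.
  move=> t0.
  have P (u : R) : `|u| = t -> `|h u| <= C * normal_peak (2 * s) / t.
    move=> ut; rewrite ler_pdivlMr// /h normrM (ger0_norm (gauss_ge0 s u)).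
    apply: (@le_trans _ _ (`|u| * gauss s u)).
      by rewrite ut mulrC ler_wpM2l ?ler_piMr ?gauss_ge0 ?sin_max// ltW.
    rewrite (le_trans (mC u))// ler_wpM2l// gaussE ?mulr_gt0//.
    by rewrite normal_pdf_ub// gt_eqF// mulr_gt0.
  by split; apply: P; rewrite ?normrN gtr0_norm.
have : \int[leb]_t g t = 0.
  have ig : leb.-integrable setT (EFin \o g).
    by rewrite /g /comp; under eq_fun do rewrite EFinD; exact: integrableD.
  have cv : (\int[leb]_t ((g t * \1_(`[- m.+1%:R, m.+1%:R]%classic) t)%:E))%E
      @[m --> \oo] --> (\int[leb]_t (g t)%:E)%E.
    apply: (@dominated_cvg _ _ _ leb _ measurableT _ _ (EFin \o (fun t => `|g t|))) => //.
    - move=> m; apply/measurable_EFinP; apply: measurable_funM.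
        exact: continuous_measurable_fun.
      by apply: measurable_indic; exact: measurable_itv.
    - move=> t _; apply: cvg_near_cst; near=> m.
      rewrite indicE mem_set ?mulr1//= in_itv/= -ler_norml.
      have : `|t| <= m%:R by near: m; exact: nbhs_infty_ger.
      by move/le_trans; apply; rewrite ler_nat.
    - exact: integrable_abse ig.
    - move=> m t _; rewrite /= lee_fin normrM ler_piMr//.
      by rewrite indicE; case: (_ \in _); rewrite ?normr1 ?normr0.
  have E m : (\int[leb]_t ((g t * \1_(`[- m.+1%:R, m.+1%:R]%classic) t)%:E))%E =
      (h m.+1%:R - h (- m.+1%:R))%:E.
    have mlt : - m.+1%:R < m.+1%:R :> R by rewrite gtrN.
    have <- := Rintegral_is_derive mlt cg dh.
    rewrite /Rintegral fineK.
      rewrite [RHS]integral_mkcond; apply: eq_integral => t _.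
      by rewrite patchE indicE; case: ifP => _; rewrite ?mulr1 ?mulr0.
    apply: integrable_fin_num => //.
    exact: (@integrableS _ (measurableTypeR R) R leb setT).
  have cv0 : (fun m => (h m.+1%:R - h (- m.+1%:R))%:E) @ \oo --> 0%E.
    apply: cvg_EFin; first exact: nearW.
    apply: norm_cvg0.
    apply: (squeeze_cvgr (f := cst 0) (h := fun m => 2 * (C * normal_peak (2 * s)) * m.+1%:R^-1)).
    - apply: nearW => m /=; rewrite normr_ge0 /=.
      have [h1 h2] := hN m.+1%:R (ltr0Sn _ _).
      rewrite (le_trans (ler_normB _ _))// (le_trans (lerD h1 h2))//.
      rewrite (_ : 2 * _ / _ = C * normal_peak (2 * s) / m.+1%:R + C * normal_peak (2 * s) / m.+1%:R)//.
      by rewrite -mulrA mulr2n; ring.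
    - exact: cvg_cst.
    - rewrite -[X in _ --> X](mulr0 (2 * (C * normal_peak (2 * s)))).
      by apply: cvgM; [exact: cvg_cst|exact: cvg_harmonic].
  rewrite /Rintegral; move: cv; under eq_fun do rewrite E.
  by move=> /(cvg_unique (@ereal_hausdorff R) cv0) <-.
rewrite /g RintegralD// !RintegralZl//; [|exact: integrable_gsin|exact: integrable_gcos].
rewrite -/(gcos z) => /eqP; rewrite mulNr subr_eq0 => /eqP zE.
by rewrite -mulrA zE; field; rewrite gt_eqF.
Unshelve. all: by end_near. Qed.

(** Differentiate under the integral, with [gauss_moment] as dominating
    function, then integrate by parts. *)
Lemma is_derive_gcos (z : R) : is_derive z (1 : R) gcos (- (s ^+ 2 * z) * gcos z).
Proof.
pose f (x t : R) := gauss s t * cos (x * t + theta).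
have d1 x t : is_derive x (1 : R) (f ^~ t) (- (t * gauss s t * sin (x * t + theta))).
  by apply: is_derive_eq; rewrite /GRing.scale/=; ring.
have d1E x t : partial1of2 f x t = - (t * gauss s t * sin (x * t + theta)).
  by rewrite partial1of2E; exact: derive_val.
have zI : [set` `]z - 1, z + 1[] z by rewrite /= in_itv/= ltrBlDr ltrDl ltr01.
have H1 x : [set` `]z - 1, z + 1[] x -> leb.-integrable setT (EFin \o f x).
  by move=> _; exact: integrable_gcos.
have H2 x t : [set` `]z - 1, z + 1[] x -> setT t -> derivable (f ^~ t) x 1 by [].
have H3 t : 0 <= `|t| * gauss s t by rewrite mulr_ge0// gauss_ge0.
have H4 x t : [set` `]z - 1, z + 1[] x -> setT t -> `|partial1of2 f x t| <= `|t| * gauss s t.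
  move=> _ _; rewrite d1E normrN normrM (normrM t) (ger0_norm (gauss_ge0 s t)).
  by rewrite ler_piMr ?sin_max.
have D := @derivable_under_integral R _ _ leb f setT measurableT _ _ _ zI H1 H2 _ H3 integrable_moment H4.
have E := @differentiation_under_integral R _ _ leb f setT measurableT _ _ _ zI H1 H2 _ H3 integrable_moment H4.
apply: DeriveDef; first exact: D.
rewrite -derive1E E mulNr -gauss_parts -[RHS]mulN1r -RintegralZl//; last exact: integrable_gsin.
by apply: eq_Rintegral => t _; rewrite d1E mulN1r.
Qed.

(** By [is_derive_gcos] the product of [gcos z] with [exp (s^2 z^2 / 2)] has
    derivative zero. *)
Lemma gcosE (z : R) : gcos z = cos theta * expR (- (s ^+ 2 * z ^+ 2 / 2)).
Proof.
pose h (x : R) := gcos x * expR (s ^+ 2 * x ^+ 2 / 2).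
have dh (x : R) : is_derive x (1 : R) h 0.
  have dg := is_derive_gcos x.
  by apply: is_derive_eq; rewrite /GRing.scale/=; field.
have := is_derive_0_is_cst z 0 dh.
rewrite /h expr0n mulr0 mul0r expR0 mulr1 => hz.
have <- : gcos 0 = cos theta.
  rewrite /gcos; under eq_Rintegral do rewrite mul0r add0r.
  by rewrite RintegralZr ?Rintegral_gauss ?mul1r//; exact: integrable_gauss.
by rewrite -hz -mulrA -expRD subrr expR0 mulr1.
Qed.

End gaussian.

(** * Fubini's theorem, L^2 estimates and the multiplication formula *)

Section fubini_complex.
Context d1 d2 (T1 : measurableType d1) (T2 : measurableType d2) {R : realType}.
Variables (m1 : {sigma_finite_measure set T1 -> \bar R}).
Variables (m2 : {sigma_finite_measure set T2 -> \bar R}).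

Lemma measurable_Rintegral_param (h : T1 * T2 -> R) : measurable_fun setT h ->
  measurable_fun setT (fun x => \int[m2]_y h (x, y)).
Proof.
move=> mh; have mE : measurable_fun setT (EFin \o h) by exact/measurable_EFinP.
apply: (@measurableT_comp _ _ _ _ _ _ (@fine R) _ (fun x => \int[m2]_y (h (x, y))%:E)%E) => //.
rewrite (_ : (fun x => _) = (fubini_F m2 (EFin \o h)^\+ \- fubini_F m2 (EFin \o h)^\-)%E).
  apply: emeasurable_funB; apply: measurable_fun_fubini_tonelli_F => //.
    exact: measurable_funepos.
  exact: measurable_funeneg.
apply/funext => x; rewrite [LHS]integralE /fubini_F.
congr (_ - _)%E; apply: eq_integral => y _; first by rewrite !funeposE.
by rewrite !funenegE.
Qed.

Lemma cmeas_cint_param (h : T1 * T2 -> R[i]) : cmeas h ->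
  cmeas (fun x => cint m2 (fun y => h (x, y))).
Proof. by move=> [mr mi]; split; [exact: (measurable_Rintegral_param mr)|exact: (measurable_Rintegral_param mi)]. Qed.

Lemma Rintegral_swap (h : T1 * T2 -> R) :
  (m1 \x m2)%E.-integrable setT (EFin \o h) ->
  (forall x, m2.-integrable setT (fun y => (h (x, y))%:E)) ->
  (forall y, m1.-integrable setT (fun x => (h (x, y))%:E)) ->
  \int[m1]_x (\int[m2]_y h (x, y)) = \int[m2]_y (\int[m1]_x h (x, y)).
Proof.
move=> ih ix iy; rewrite /Rintegral; congr fine.
transitivity (\int[m1]_x \int[m2]_y (h (x, y))%:E)%E.
  by apply: eq_integral => x _; rewrite fineK//; exact: integrable_fin_num.
rewrite (Fubini ih); apply: eq_integral => y _.
by rewrite fineK//; exact: integrable_fin_num.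
Qed.

Lemma cint_swap (h : T1 * T2 -> R[i]) : cintable (m1 \x m2)%E h ->
  (forall x, cintable m2 (fun y => h (x, y))) ->
  (forall y, cintable m1 (fun x => h (x, y))) ->
  cint m1 (fun x => cint m2 (fun y => h (x, y))) =
  cint m2 (fun y => cint m1 (fun x => h (x, y))).
Proof.
move=> [ir ii] ix iy; apply: complex_eqP => /=.
  by apply: (Rintegral_swap ir) => [x|y]; [case: (ix x)|case: (iy y)].
by apply: (Rintegral_swap ii) => [x|y]; [case: (ix x)|case: (iy y)].
Qed.

End fubini_complex.

Section L2_estimates.
Context {R : realType} {n : nat}.
Local Notation mu := (lebesgue_rV R n).
Implicit Types f g : 'rV[R]_n -> R[i].

Lemma integral_nsq_L2norm f : (\int[mu]_x (nsq (f x))%:E = (L2norm f `^ 2))%E.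
Proof.
rewrite /L2norm poweR_Lnorm//; apply: eq_integral => x _ /=.
by rewrite -sqr_normc ger0_norm ?normc_ge0// powR_mulrn// normc_ge0.
Qed.

Lemma L2normE f : (L2norm f = (\int[mu]_x (nsq (f x))%:E) `^ 2^-1)%E.
Proof.
rewrite integral_nsq_L2norm -poweRrM mulfV// poweRe1// /L2norm; exact: Lnorm_ge0.
Qed.

Lemma L2norm_fin f : (L2norm f < +oo)%E -> (\int[mu]_x (nsq (f x))%:E < +oo)%E.
Proof. by move=> fL; rewrite integral_nsq_L2norm poweR_lty. Qed.

Lemma cauchy_schwarz f g : cmeas f -> cmeas g ->
  (\int[mu]_x (normc (f x) * normc (g x))%:E <= L2norm f * L2norm g)%E.
Proof.
move=> mf mg.
have := @hoelder _ _ _ mu (fun x => normc (f x)) (fun x => normc (g x)) 2 2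
  (measurable_normc mf) (measurable_normc mg) (ltr0Sn _ _) (ltr0Sn _ _).
rewrite Lnorm1 => H; apply: (le_trans _ (H _)); last by field.
apply: ge0_le_integral => //.
- by move=> x _; rewrite lee_fin mulr_ge0 ?normc_ge0.
- by apply/measurable_EFinP; apply: measurable_funM; exact: measurable_normc.
- apply: measurableT_comp => //.
  by apply/measurable_EFinP; apply: measurable_funM; exact: measurable_normc.
- by move=> x _; rewrite /= lee_fin ler_norm.
Qed.

(** By the Cauchy-Schwarz inequality. *)
Lemma L2_mul_cintable f g : in_L2 f -> in_L2 g -> cintable mu (fun x => f x * g x).
Proof.
move=> [mf fL] [mg gL]; apply/cintableP; split; first exact: cmeasM.
under eq_integral do rewrite Normc.normcM.
apply: le_lt_trans (cauchy_schwarz mf mg) _; apply: lte_mul_pinfty => //.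
  by rewrite Lnorm_ge0.
by rewrite ge0_fin_numE// Lnorm_ge0.
Qed.

Lemma in_L2_integrable_bounded (K : R) f : cintable mu f -> (forall x, normc (f x) <= K) -> in_L2 f.
Proof.
move=> /cintableP[mf fi] fK; split => //.
have K0 : 0 <= K by apply: le_trans (fK 0); exact: normc_ge0.
rewrite L2normE poweR_lty//.
apply: (@le_lt_trans _ _ (\int[mu]_x (K%:E * (normc (f x))%:E))%E).
  apply: ge0_le_integral => //.
  - by move=> x _; rewrite lee_fin nsq_ge0.
  - by apply/measurable_EFinP; exact: measurable_nsq.
  - by apply: measurable_funeM; apply/measurable_EFinP; exact: measurable_normc.
  - by move=> x _; rewrite -EFinM lee_fin -sqr_normc expr2 ler_wpM2r ?normc_ge0.
rewrite ge0_integralZl//.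
- by rewrite lte_mul_pinfty.
- by apply/measurable_EFinP; exact: measurable_normc.
- by move=> x _; rewrite lee_fin normc_ge0.
Qed.

Lemma fourier_measurable f : cmeas f -> cmeas (fourier f).
Proof.
move=> mf; apply: cmeasM; first exact: cmeas_cst.
apply: (cmeas_cint_param mu
  (h := fun p : 'rV[R]_n * 'rV[R]_n => f p.2 * cis (- dot p.2 p.1))).
apply: cmeasM.
  exact: cmeas_comp mf measurable_snd.
apply: cmeas_cis; apply: measurableT_comp => //.
by apply: measurable_dot; [exact: measurable_snd|exact: measurable_fst].
Qed.

End L2_estimates.

Section gaussian_inversion.
Context {R : realType} {n : nat}.
Local Notation mu := (lebesgue_rV R n).
Local Notation leb := (@lebesgue_measure R).
Local Notation c := (@fourier_const R n).

Lemma cint_gauss_cis (s z : R) : 0 < s ->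
  cint leb (fun t => ((gauss s t)%:C)%C * cis (z * t)) = ((expR (- (s ^+ 2 * z ^+ 2 / 2)))%:C)%C.
Proof.
move=> s0; apply: complex_eqP.
  transitivity (gcos s 0 z); last by rewrite gcosE// cos0 mul1r.
  by apply: eq_Rintegral => t _; rewrite ReM /= mul0r subr0 addr0.
transitivity (gcos s (- (pi / 2)) z); last by rewrite gcosE// cosN cos_pihalf mul0r.
by apply: eq_Rintegral => t _; rewrite ImM /= mul0r addr0 cosBpihalf.
Qed.

Definition gauss_weight (s : R) (xi : 'rV[R]_n) : R := \prod_i gauss s (xi ord0 i).
(** The transform of [gauss_weight], see [cint_gauss_weight]. *)
Definition gauss_hat (s : R) (z : 'rV[R]_n) : R := \prod_i expR (- (s ^+ 2 * z ord0 i ^+ 2 / 2)).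

Lemma cint_gauss_weight (s : R) (z : 'rV[R]_n) : 0 < s ->
  cintable mu (fun xi => ((gauss_weight s xi)%:C)%C * cis (dot z xi)) /\
  cint mu (fun xi => ((gauss_weight s xi)%:C)%C * cis (dot z xi)) = ((gauss_hat s z)%:C)%C.
Proof.
move=> s0; have [I E] := cint_prod_cis z (integrable_gauss s0); split => //.
by rewrite [LHS]E /gauss_hat rmorph_prod; apply: eq_bigr => i _; exact: cint_gauss_cis.
Qed.

Lemma gauss_weight_ge0 s xi : 0 <= gauss_weight s xi.
Proof. by apply: prodr_ge0 => i _; exact: gauss_ge0. Qed.

Lemma gauss_hat_ge0 s z : 0 <= gauss_hat s z.
Proof. by apply: prodr_ge0 => i _; exact: expR_ge0. Qed.

Lemma gauss_hat_le1 s z : gauss_hat s z <= 1.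
Proof.
apply: prodr_ile1 => i _; rewrite expR_ge0 /= -[leRHS]expR0 ler_expR oppr_le0.
by rewrite divr_ge0// mulr_ge0 ?sqr_ge0.
Qed.

Lemma measurable_gauss_weight s : 0 < s -> measurable_fun setT (gauss_weight s).
Proof.
move=> s0; apply: measurable_prod => i _.
exact: measurableT_comp (measurable_gauss s0) (measurable_coord i).
Qed.

Lemma gauss_hatE (s : R) z : 0 < s ->
  gauss_weight s^-1 z = normal_peak s^-1 ^+ n * gauss_hat s z.
Proof.
move=> s0; rewrite /gauss_weight /gauss_hat /gauss big_split prodr_const card_ord.
congr (_ * _); apply: eq_bigr => i _; congr (expR (- _)).
by field; rewrite gt_eqF.
Qed.

Lemma peak_mul (s : R) : 0 < s -> normal_peak s * normal_peak s^-1 = (2 * pi)^-1.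
Proof.
move=> s0; rewrite /normal_peak -invfM -sqrtrM; last first.
  by rewrite mulrn_wge0// mulr_ge0 ?sqr_ge0 ?pi_ge0.
congr (_^-1); transitivity (Num.sqrt ((2 * pi) ^+ 2 : R)).
  by congr Num.sqrt; rewrite !mulr2n; field; rewrite gt_eqF.
by rewrite sqrtr_sqr ger0_norm// mulr_ge0// pi_ge0.
Qed.

(** By Fubini's theorem: in the double integral of
    [u y * gauss_weight s xi * e^(i (x - y) xi)], the integral over [xi] gives
    [gauss_hat s (x - y)], the integral over [y] the transform of [u]. *)
Lemma fourier_gauss (u : 'rV[R]_n -> R[i]) (x : 'rV[R]_n) (s : R) : 0 < s ->
  cintable mu u ->
  (c%:C)%C * cint mu (fun y => u y * ((gauss_hat s (x - y))%:C)%C) =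
  cint mu (fun xi => ((gauss_weight s xi)%:C)%C * cis (dot x xi) * fourier u xi).
Proof.
move=> s0 iu; have [mu_ _] := (cintableP _ _).1 iu.
pose w xi : R[i] := ((gauss_weight s xi)%:C)%C.
have [iw Ew] := cint_gauss_weight x s0.
have P (xi y : 'rV[R]_n) : w xi * cis (dot x xi) * (u y * cis (- dot y xi)) =
    u y * (w xi * cis (dot (x - y) xi)).
  by rewrite dotDl dotNl cisD; ring.
have iwx (z : 'rV[R]_n) : cintable mu (fun xi => w xi * cis (dot z xi)).
  by have [] := cint_gauss_weight z s0.
have iuy (xi : 'rV[R]_n) : cintable mu (fun y => u y * cis (- dot y xi)).
  under eq_fun do rewrite mulrC; apply: cintable_mul_le1 iu => [|y].
    apply: cmeas_cis; apply: measurableT_comp => //.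
    by apply: measurable_dot => //; exact: measurable_cst.
  by rewrite normc_cis.
rewrite /fourier -cintZ; last first.
  under eq_fun do rewrite mulrC; apply: cintable_mul_le1 iu => [|y].
    apply: cmeas_real; apply: measurable_prod => i _; apply: measurableT_comp => //.
    apply: measurableT_comp => //; apply: measurable_funM => //.
    apply: measurable_funM => //; apply: measurable_funX.
    apply: (measurableT_comp (measurable_coord i)).
    by apply: measurable_subv => //; exact: measurable_cst.
  by rewrite normc_real ger0_norm ?gauss_hat_ge0// gauss_hat_le1.
pose H (p : 'rV[R]_n * 'rV[R]_n) := (c%:C)%C * (u p.1 * (w p.2 * cis (dot (x - p.1) p.2))).
have mw : cmeas w by apply: cmeas_real; exact: measurable_gauss_weight.
have mH : cmeas H.
  apply: cmeasM; first exact: cmeas_cst.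
  apply: cmeasM; first exact: cmeas_comp mu_ measurable_fst.
  apply: cmeasM; first exact: cmeas_comp mw measurable_snd.
  apply: cmeas_cis; apply: measurable_dot; last exact: measurable_snd.
  by apply: measurable_subv; [exact: measurable_cst|exact: measurable_fst].
have iH : cintable (mu \x mu)%E H.
  have [I _] := cintable_prod_mul iu (iwx 0).
  apply: (cintable_le (h := fun p => c * normc (u p.1 * (w p.2 * cis (dot 0 p.2))))) => //.
    move=> p; rewrite !Normc.normcM !normc_cis normc_real ger0_norm//.
    exact/ltW/fourier_const_gt0.
  exact: (integrableZl measurableT c (cintable_normc I)).
transitivity (cint mu (fun y => cint mu (fun xi => H (y, xi)))).
  congr cint; apply/funext => y; rewrite /H /=.
  rewrite cintZ; last exact: cintableZ.
  by rewrite cintZ// (cint_gauss_weight _ s0).2.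
rewrite (cint_swap iH); last 2 first.
- move=> y.
  have I : cintable mu (fun xi => (c%:C)%C * (u y * (w xi * cis (dot (x - y) xi)))).
    by do 2 apply: cintableZ.
  exact: I.
- move=> xi; rewrite (_ : (fun y => H (y, xi)) =
      fun y => (c%:C)%C * (w xi * cis (dot x xi) * (u y * cis (- dot y xi)))).
    by do 2 apply: cintableZ.
  by apply/funext => y; rewrite P.
congr cint; apply/funext => xi; rewrite /H /=.
transitivity ((c%:C)%C * ((w xi * cis (dot x xi)) * cint mu (fun y => u y * cis (- dot y xi)))).
  rewrite -cintZ//; rewrite -cintZ; last first.
    have := cintableZ (w xi * cis (dot x xi)) (iuy xi).
    by under eq_fun do rewrite P.
  by congr cint; apply/funext => y; rewrite P.
by rewrite /w mulrCA.
Qed.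

End gaussian_inversion.

(** * Fourier inversion *)

Section inversion.
Context {R : realType} {n : nat}.
Local Notation mu := (lebesgue_rV R n).
Local Notation leb := (@lebesgue_measure R).
Local Notation c := (@fourier_const R n).
Implicit Types (x y xi : 'rV[R]_n).

(** A probability density in [y], concentrated at [x] when [s] is large. *)
Definition gauss_kernel (s : R) x y : R := \prod_i normal_pdf (x ord0 i) s^-1 (y ord0 i).

Lemma gauss_kernelE (s : R) x y : 0 < s ->
  gauss_kernel s x y = normal_peak s^-1 ^+ n * gauss_hat s (x - y).
Proof.
move=> s0; rewrite -gauss_hatE// /gauss_kernel /gauss_weight; apply: eq_bigr => i _.
rewrite gaussE ?invr_gt0// normal_pdfE ?gt_eqF ?invr_gt0// normal_pdfE ?gt_eqF ?invr_gt0//.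
by rewrite /normal_fun !mxE subr0 -sqrrN opprB.
Qed.

Lemma cint_gauss_kernel (s : R) x : 0 < s ->
  cintable mu (fun y => ((gauss_kernel s x y)%:C)%C) /\
  cint mu (fun y => ((gauss_kernel s x y)%:C)%C) = 1.
Proof.
move=> s0; have [|I E] := @cint_prod R n (fun i t => ((normal_pdf (x ord0 i) s^-1 t)%:C)%C).
  move=> i; split => /=; last exact: integrable0.
  exact: integrable_normal_pdf.
have kE : (fun y => ((gauss_kernel s x y)%:C)%C) =
    (fun y => \prod_i ((normal_pdf (x ord0 i) s^-1 (y ord0 i))%:C)%C).
  by apply/funext => y; rewrite /gauss_kernel rmorph_prod.
rewrite kE; split => //; rewrite E big1// => i _.
apply: complex_eqP => /=; first by rewrite /Rintegral integral_normal_pdf.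
by rewrite Rintegral_cst// mul0r.
Qed.

Lemma gauss_kernel_ge0 s x y : 0 <= gauss_kernel s x y.
Proof. by apply: prodr_ge0 => i _; exact: normal_pdf_ge0. Qed.

Lemma in_L2_gauss_hat (s : R) x : 0 < s ->
  in_L2 (fun y => ((gauss_hat s (x - y))%:C)%C).
Proof.
move=> s0; have [I _] := cint_gauss_kernel x s0.
have p0 : normal_peak s^-1 ^+ n != 0 :> R.
  by rewrite expf_neq0// gt_eqF// normal_peak_gt0// gt_eqF// invr_gt0.
apply: (@in_L2_integrable_bounded _ _ 1).
  have := cintableZ (((normal_peak s^-1 ^+ n)^-1)%:C)%C I.
  under eq_fun do rewrite -rmorphM /= gauss_kernelE// mulKf//.
  by [].
by move=> y; rewrite normc_real ger0_norm ?gauss_hat_ge0// gauss_hat_le1.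
Qed.

Lemma in_L2_gauss_weight (s : R) x : 0 < s ->
  in_L2 (fun xi => ((gauss_weight s xi)%:C)%C * cis (dot x xi)).
Proof.
move=> s0; have [I _] := cint_gauss_weight x s0.
apply: (@in_L2_integrable_bounded _ _ (normal_peak s ^+ n)) => // xi.
rewrite Normc.normcM normc_cis mulr1 normc_real ger0_norm ?gauss_weight_ge0//.
rewrite -[n in X in _ <= X]card_ord -prodr_const; apply: ler_prod => i _.
by rewrite gauss_ge0 gaussE// normal_pdf_ub// gt_eqF.
Qed.

Lemma normc_cint_mul_le (f g : 'rV[R]_n -> R[i]) : in_L2 f -> in_L2 g ->
  ((normc (cint mu (fun x => f x * g x)))%:E <= L2norm f * L2norm g)%E.
Proof.
move=> fL gL; apply: le_trans (normc_cint_le (L2_mul_cintable fL gL)) _.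
by under eq_integral do rewrite Normc.normcM; apply: cauchy_schwarz; [case: fL|case: gL].
Qed.

Lemma in_L2B (f g : 'rV[R]_n -> R[i]) : in_L2 f -> in_L2 g -> in_L2 (fun x => f x - g x).
Proof.
move=> [mf fL] [mg gL]; split; first exact: cmeasB.
rewrite L2normE poweR_lty//.
apply: (@le_lt_trans _ _ (\int[mu]_x (2%:E * (nsq (f x))%:E + 2%:E * (nsq (g x))%:E))%E).
  apply: ge0_le_integral => //.
  - by move=> x _; rewrite lee_fin nsq_ge0.
  - by apply/measurable_EFinP; apply: measurable_nsq; exact: cmeasB.
  - by apply: emeasurable_funD; apply: measurable_funeM; apply/measurable_EFinP; exact: measurable_nsq.
  - move=> x _; rewrite -!EFinM -EFinD lee_fin (le_trans (nsqD_le _ _))// nsqN//.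
rewrite ge0_integralD//.
- by rewrite !ge0_integralZl//; try solve
    [by rewrite lte_add_pinfty// lte_mul_pinfty// L2norm_fin
    |by apply/measurable_EFinP; exact: measurable_nsq
    |by move=> x _; rewrite lee_fin nsq_ge0].
- by move=> x _; rewrite -EFinM lee_fin mulr_ge0// nsq_ge0.
- by apply: measurable_funeM; apply/measurable_EFinP; exact: measurable_nsq.
- by move=> x _; rewrite -EFinM lee_fin mulr_ge0// nsq_ge0.
- by apply: measurable_funeM; apply/measurable_EFinP; exact: measurable_nsq.
Qed.

Lemma small_normc0 (z : R[i]) (K : R) : (forall e : R, 0 < e -> normc z <= K * e) -> z = 0.
Proof.
move=> zK; apply: Normc.eq0_normc; apply/eqP; rewrite eq_le normc_ge0 andbT.
apply/ler_addgt0Pl => e e0; rewrite addr0.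
have K1 : 0 < `|K| + 1 by rewrite ltr_wpDl.
apply: le_trans (zK (e / (`|K| + 1)) _) _; first by rewrite divr_gt0.
rewrite mulrCA; apply: ler_piMr; first exact: ltW.
rewrite ler_pdivrMr// mul1r.
by rewrite (le_trans (ler_norm _))// lerDl.
Qed.

(** Both sides are continuous in the L^2 norm, in [f] and in [fhat] respectively,
    by the Cauchy-Schwarz inequality; so the formula passes from the integrable
    approximants to the limit. *)
Lemma L2_fourier_gauss (f fhat : 'rV[R]_n -> R[i]) x (s : R) : 0 < s -> L2_fourier f fhat ->
  (c%:C)%C * cint mu (fun y => f y * ((gauss_hat s (x - y))%:C)%C) =
  cint mu (fun xi => ((gauss_weight s xi)%:C)%C * cis (dot x xi) * fhat xi).
Proof.
move=> s0 [fL fhL [u [uP uf ufh]]].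
have WL := in_L2_gauss_hat x s0; have wL := in_L2_gauss_weight x s0.
set W := fun y : 'rV[R]_n => _ in WL; set w := fun xi => _ in wL.
apply/eqP; rewrite -subr_eq0; apply/eqP.
have c0 := @fourier_const_gt0 R n.
have fW : L2norm W \is a fin_num by rewrite ge0_fin_numE; [case: WL|exact: Lnorm_ge0].
have fw : L2norm w \is a fin_num by rewrite ge0_fin_numE; [case: wL|exact: Lnorm_ge0].
have W0 : 0 <= fine (L2norm W) by apply/fine_ge0; exact: Lnorm_ge0.
have w0 : 0 <= fine (L2norm w) by apply/fine_ge0; exact: Lnorm_ge0.
apply: (@small_normc0 _ (c * fine (L2norm W) + fine (L2norm w))) => e e0.
near \oo => k.
have k1 : (L2norm (fun x => u k x - f x)%R <= e%:E)%E.
  by near: k; exact: cvge0_near_small.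
have k2 : (L2norm (fun x => fourier (u k) x - fhat x)%R <= e%:E)%E.
  by near: k; exact: cvge0_near_small.
have [uI uL] := uP k.
have FL : in_L2 (fun xi => fourier (u k) xi - fhat xi).
  split; last by apply: le_lt_trans k2 _; rewrite ltry.
  by apply: cmeasB; [apply: fourier_measurable; case: uL|case: fhL].
have -> : (c%:C)%C * cint mu (fun y => f y * W y) - cint mu (fun xi => w xi * fhat xi) =
    cint mu (fun xi => (fourier (u k) xi - fhat xi) * w xi) -
    (c%:C)%C * cint mu (fun y => (u k y - f y) * W y).
  have iuW : cintable mu (fun y => u k y * W y) by exact: L2_mul_cintable.
  have ifW : cintable mu (fun y => f y * W y) by exact: L2_mul_cintable.
  have ifw : cintable mu (fun y => fhat y * w y) by exact: L2_mul_cintable.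
  have iFw : cintable mu (fun y => fourier (u k) y * w y).
    have := cintableD (L2_mul_cintable FL wL) ifw.
    by under eq_fun do rewrite -mulrDl subrK.
  under [in RHS](eq_fun _) do rewrite mulrBl.
  rewrite cintB//.
  under [in X in _ - _ * X](eq_fun _) do rewrite mulrBl.
  rewrite cintB// mulrBr (fourier_gauss x s0 uI) -/w.
  have -> : cint mu (fun xi => w xi * fourier (u k) xi) = cint mu (fun xi => fourier (u k) xi * w xi).
    by congr cint; apply/funext => xi; rewrite mulrC.
  have -> : cint mu (fun xi => w xi * fhat xi) = cint mu (fun xi => fhat xi * w xi).
    by congr cint; apply/funext => xi; rewrite mulrC.
  by ring.
rewrite (le_trans (normc_triangle _ _))// normc_opp Normc.normcM normc_real (gtr0_norm c0).
rewrite mulrDl addrC lerD//.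
  rewrite -mulrA; apply: ler_wpM2l; first exact: ltW.
  rewrite -lee_fin.
  apply: le_trans (normc_cint_mul_le (in_L2B uL fL) WL) _.
  by rewrite mulrC EFinM fineK// lee_wpmul2r// Lnorm_ge0.
rewrite -lee_fin; apply: le_trans (normc_cint_mul_le FL wL) _.
by rewrite mulrC EFinM fineK// lee_wpmul2r// Lnorm_ge0.
Unshelve. all: by end_near. Qed.

End inversion.

Section inversion_limit.
Context {R : realType} {n : nat}.
Local Notation mu := (lebesgue_rV R n).
Local Notation c := (@fourier_const R n).
Implicit Types (x y xi : 'rV[R]_n).

(** The Gaussian weight divided by its value at the origin; it increases to 1
    with [s]. *)
Definition damping (s : R) xi : R := \prod_i expR (- (xi ord0 i ^+ 2 / (2 * s ^+ 2))).

Lemma damping_itv s xi : 0 <= damping s xi <= 1.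
Proof.
apply/andP; split; first by apply: prodr_ge0 => i _; exact: expR_ge0.
apply: prodr_ile1 => i _; rewrite expR_ge0 /= -[leRHS]expR0 ler_expR oppr_le0.
by rewrite divr_ge0 ?sqr_ge0// mulr_ge0 ?sqr_ge0.
Qed.

Lemma gauss_weightE s xi : gauss_weight s xi = normal_peak s ^+ n * damping s xi.
Proof. by rewrite /gauss_weight /gauss big_split prodr_const card_ord. Qed.

Lemma measurable_damping s : measurable_fun setT (damping s).
Proof.
apply: measurable_prod => i _; apply: measurableT_comp => //.
apply: measurableT_comp => //; apply: measurable_funM => //.
by apply: measurable_funX; exact: measurable_coord.
Qed.

(** This is [L2_fourier_gauss] with the normalization of the kernel; the
    constants match because [c^2 (2 pi)^n = 1]. *)
Lemma L2_fourier_kernel (f fhat : 'rV[R]_n -> R[i]) x (s : R) : 0 < s -> L2_fourier f fhat ->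
  cint mu (fun y => f y * ((gauss_kernel s x y)%:C)%C) =
  (c%:C)%C * cint mu (fun xi => ((damping s xi)%:C)%C * (fhat xi * cis (dot x xi))).
Proof.
move=> s0 ff; have E := L2_fourier_gauss x s0 ff.
have [fL fhL _] := ff.
have c0 := @fourier_const_gt0 R n.
have cC : (c%:C)%C != 0 :> R[i] by rewrite -(rmorph0 (real_complex R)) (inj_eq (@complexI R)) gt_eqF.
apply: (mulfI cC).
have -> : (fun y => f y * ((gauss_kernel s x y)%:C)%C) =
    fun y => ((normal_peak s^-1 ^+ n)%:C)%C * (f y * ((gauss_hat s (x - y))%:C)%C).
  by apply/funext => y; rewrite gauss_kernelE// rmorphM mulrCA.
rewrite cintZ; last exact: L2_mul_cintable fL (in_L2_gauss_hat x s0).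
rewrite mulrCA E.
have iw := L2_mul_cintable (in_L2_gauss_weight x s0) fhL.
have p0 : normal_peak s ^+ n != 0 :> R by rewrite expf_neq0// gt_eqF// normal_peak_gt0// gt_eqF.
have wE : (fun xi => ((damping s xi)%:C)%C * (fhat xi * cis (dot x xi))) =
    fun xi => (((normal_peak s ^+ n)^-1)%:C)%C *
      (((gauss_weight s xi)%:C)%C * cis (dot x xi) * fhat xi).
  apply/funext => xi; rewrite gauss_weightE !mulrA -rmorphM mulrA mulVf// mul1r; ring.
rewrite wE cintZ// !mulrA -!rmorphM; congr (_ * _); congr (_%:C)%C.
apply: (mulIf p0); rewrite mulfVK// -exprMn mulrC peak_mul// exprVn -expr2.
apply: (mulIf (x := (2 * pi) ^+ n)); first by rewrite expf_neq0// gt_eqF// twopi_gt0.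
by rewrite sqr_fourier_const mulVf// expf_neq0// gt_eqF// twopi_gt0.
Qed.

Lemma cvg_damping xi : damping m.+1%:R xi @[m --> \oo] --> (1 : R).
Proof.
pose D := \sum_i xi ord0 i ^+ 2.
have E m : damping m.+1%:R xi = expR (- (D / 2) * (m.+1%:R^-1 * m.+1%:R^-1)).
  rewrite /damping -expR_sum; congr expR; rewrite /D sumrN mulNr; congr (- _).
  rewrite 2!mulr_suml; apply: eq_bigr => i _.
  by field; rewrite nat1r pnatr_eq0.
under eq_fun do rewrite E.
have C0 : (fun m : nat => - (D / 2) * (m.+1%:R^-1 * m.+1%:R^-1)) @ \oo --> - (D / 2) * (0 * 0).
  have ch := @cvg_harmonic R.
  by apply: cvgM; [exact: cvg_cst|apply: cvgM].
suff : (fun m : nat => expR (- (D / 2) * (m.+1%:R^-1 * m.+1%:R^-1))) @ \oo -->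
    expR (- (D / 2) * (0 * 0)) by rewrite !mulr0 expR0.
apply: (cvg_comp _ expR); [exact: C0|exact: continuous_expR].
Qed.

Lemma cint_damping_cvg (g : 'rV[R]_n -> R[i]) (e : R) : cintable mu g -> 0 < e ->
  \forall m \near \oo, normc (cint mu (fun xi => ((damping m.+1%:R xi)%:C)%C * g xi) - cint mu g) <= e.
Proof.
move=> ig e0; have [mg _] := (cintableP _ _).1 ig; have ing := cintable_normc ig.
have cv : (\int[mu]_xi (((1 - damping m.+1%:R xi) * normc (g xi))%:E))%E @[m --> \oo] --> 0%E.
  rewrite [X in _ --> X](_ : _ = \int[mu]_xi 0%E)%E; last by rewrite integral0.
  apply: (@dominated_cvg _ _ _ mu _ measurableT _ _ (fun xi => (normc (g xi))%:E)) => //.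
  - move=> m; apply/measurable_EFinP; apply: measurable_funM; last exact: measurable_normc.
    by apply: measurable_funB => //; exact: measurable_damping.
  - move=> xi _; apply: cvg_EFin; first exact: nearW.
    rewrite [X in _ --> X](_ : 0 = (1 - 1) * normc (g xi)); last by rewrite subrr mul0r.
    apply: cvgM; last exact: cvg_cst.
    by apply: cvgB; [exact: cvg_cst|exact: cvg_damping].
  - move=> m xi _; rewrite /= lee_fin ger0_norm.
      by rewrite ler_piMl ?normc_ge0// lerBlDr lerDl; case/andP: (damping_itv m.+1%:R xi).
    by rewrite mulr_ge0 ?normc_ge0// subr_ge0; case/andP: (damping_itv m.+1%:R xi).
near=> m.
have small : (\int[mu]_xi (((1 - damping m.+1%:R xi) * normc (g xi))%:E) <= e%:E)%E.
  by near: m; exact: cvge0_near_small.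
have idg : cintable mu (fun xi => ((damping m.+1%:R xi)%:C)%C * g xi).
  apply: cintable_mul_le1 ig => [|xi].
    by apply: cmeas_real; exact: measurable_damping.
  by have /andP[d0 d1] := damping_itv m.+1%:R xi; rewrite normc_real ger0_norm.
rewrite -cintB// -lee_fin; apply: le_trans small.
apply: le_trans (normc_cint_le (cintableB idg ig)) _.
rewrite le_eqVlt; apply/orP; left; apply/eqP; apply: eq_integral => xi _; congr EFin.
have /andP[d0 d1] := damping_itv m.+1%:R xi.
rewrite -{2}[g xi]mul1r -mulrBl Normc.normcM; congr (_ * _).
by rewrite -(rmorph1 (real_complex R)) -rmorphB normc_real distrC ger0_norm// subr_ge0.
Unshelve. all: by end_near. Qed.

(** Comparison with the kernel of unit width keeps the bound integrable against
    square integrable functions. The peak grows like [m^n], and the exponential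
    gains [m^(n+1)]. *)
Lemma gauss_kernel_far (d : R) : 0 < d -> exists2 K : R, 0 <= K &
  forall m x y, (0 < m)%N -> (exists i, d <= `|x ord0 i - y ord0 i|) ->
    gauss_kernel m.+1%:R x y <= K / m%:R * gauss_kernel 1 x y.
Proof.
move=> d0; pose a := d ^+ 2 / 2; have a0 : 0 < a by rewrite divr_gt0// exprn_gt0.
exists (2 ^+ n * (n.+1)`!%:R / a ^+ n.+1).
  by rewrite divr_ge0 ?exprn_ge0 ?mulr_ge0 ?exprn_ge0// ltW.
move=> m x y m0 [i di].
set s : R := m.+1%:R; have s0 : 0 < s by [].
pose D := \sum_i (x - y) ord0 i ^+ 2.
have hatE (r : R) : gauss_hat r (x - y) = expR (- (r ^+ 2 / 2 * D)).
  rewrite /gauss_hat -expR_sum; congr expR; rewrite /D mulr_sumr sumrN; congr (- _).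
  by apply: eq_bigr => j _; field.
have Dd : d ^+ 2 <= D.
  rewrite /D (bigD1 i)//= -[leLHS]addr0 lerD//; last by apply: sumr_ge0 => j _; exact: sqr_ge0.
  by rewrite !mxE -[leRHS]real_normK ?num_real// lerXn2r ?nnegrE// ltW.
rewrite !gauss_kernelE// !hatE.
have peakE : normal_peak s^-1 = s * normal_peak 1^-1 :> R.
  rewrite /normal_peak invr1 expr1n mul1r -mulrnAr sqrtrM ?sqr_ge0// sqrtr_sqr.
  by rewrite ger0_norm ?invr_ge0 ?ltW// invfM invrK.
rewrite peakE exprMn -[leLHS]mulrA [leLHS]mulrCA [leRHS]mulrCA.
apply: ler_wpM2l; first by rewrite exprn_ge0// normal_peak_ge0.
have -> : - (s ^+ 2 / 2 * D) = - ((s ^+ 2 - 1) / 2 * D) + - (1 ^+ 2 / 2 * D) by field.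
rewrite expRD mulrA ler_wpM2r ?expR_ge0//.
have mR : 0 < m%:R :> R by rewrite ltr0n.
have sm : s = m%:R + 1 by rewrite /s -natr1.
have big : a * m%:R <= (s ^+ 2 - 1) / 2 * D.
  rewrite (_ : a * m%:R = m%:R / 2 * d ^+ 2); last by rewrite /a; ring.
  apply: ler_pM; rewrite ?sqr_ge0 ?divr_ge0//.
  by rewrite ler_pM2r ?invr_gt0// sm; nra.
apply: (@le_trans _ _ (s ^+ n * expR (- (a * m%:R)))).
  by apply: ler_wpM2l; [exact/exprn_ge0/ltW|rewrite ler_expR lerN2].
have := @expR_ge1Dxn R (a * m%:R) n (mulr_ge0 (ltW a0) (ltW mR)).
set X := (a * m%:R) ^+ n.+1 / _ => XE.
have X0 : 0 < X by rewrite /X divr_gt0 ?exprn_gt0 ?mulr_gt0// ltr0n fact_gt0.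
have XE' : X <= expR (a * m%:R) by rewrite (le_trans _ XE)// lerDr.
rewrite expRN.
apply: (@le_trans _ _ ((2 * m%:R) ^+ n / X)).
  apply: ler_pM; [exact/exprn_ge0/ltW|by rewrite invr_ge0 expR_ge0| |].
    apply: lerXn2r; rewrite ?nnegrE; [exact: ltW|by rewrite mulr_ge0|].
    by rewrite sm mulr_natl mulr2n lerD2l ler1n.
  by rewrite lef_pV2 ?posrE ?expR_gt0.
have m0' : m%:R != 0 :> R by rewrite gt_eqF.
have a0' : a ^+ n.+1 != 0 by rewrite expf_neq0// gt_eqF.
have M0 : m%:R ^+ n != 0 :> R by rewrite expf_neq0.
have F0 : (n.+1)`!%:R != 0 :> R by rewrite pnatr_eq0 -lt0n fact_gt0.
rewrite /X !exprMn (exprS m%:R); move: (a ^+ n.+1) a0' (m%:R ^+ n) M0 ((n.+1)`!%:R) F0.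
move=> A A0 M M0 F F0; rewrite le_eqVlt; apply/orP; left; apply/eqP; field.
by rewrite m0' F0 M0 !expf_neq0 ?invr_eq0 ?pnatr_eq0 ?gt_eqF.
Qed.

(** Within distance [d] of [x] use the continuity of [f] and the unit mass of the
    kernel, and beyond it [gauss_kernel_far]. *)
Lemma gauss_kernel_cvg (f : 'rV[R]_n -> R[i]) x (e : R) :
  Ccontinuous f -> in_L2 f -> 0 < e ->
  \forall m \near \oo,
    normc (cint mu (fun y => f y * ((gauss_kernel m.+1%:R x y)%:C)%C) - f x) <= e.
Proof.
move=> [cr ci] fL e0; have [mf _] := fL.
have kL (s : R) : 0 < s -> in_L2 (fun y => ((gauss_kernel s x y)%:C)%C).
  move=> s0; have [I _] := cint_gauss_kernel x s0.
  apply: (@in_L2_integrable_bounded _ _ (normal_peak s^-1 ^+ n)) => // y.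
  rewrite normc_real ger0_norm ?gauss_kernel_ge0//.
  rewrite -[n in X in _ <= X]card_ord -prodr_const; apply: ler_prod => i _.
  by rewrite normal_pdf_ge0 normal_pdf_ub// gt_eqF// invr_gt0.
have [d d0 near_x] : exists2 d : R, 0 < d &
    forall y, (forall i, `|x ord0 i - y ord0 i| < d) -> normc (f y - f x) <= e / 2.
  have e4 : 0 < e / 4 by rewrite divr_gt0.
  have := cr x; move/cvgrPdist_lt => /(_ _ e4) nr.
  have := ci x; move/cvgrPdist_lt => /(_ _ e4) ni.
  have [d /= d0 dP] := (nbhs_ballP _ _).1 (filterI nr ni).
  exists d => // y xy; have [h1 h2] : `|Re (f x) - Re (f y)| < e / 4 /\ `|Im (f x) - Im (f y)| < e / 4.
    by apply: (dP y); split => // i j; rewrite (ord1 i); exact: xy.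
  apply: le_trans (normc_le_ReIm _) _; rewrite ReD ImD ReN ImN.
  by rewrite distrC [X in _ + X]distrC; lra.
have [K K0 KP] := gauss_kernel_far d0.
(* The part of the integral far from [x] is at most [K / m] times the
   integral [B] of [G]. *)
pose G y := (normc (f y) + normc (f x)) * gauss_kernel 1 x y.
have iG : mu.-integrable setT (EFin \o G).
  have [I1 _] := cint_gauss_kernel x (ltr01 : 0 < 1 :> R).
  have J1 := cintable_normc (cintableZ (f x) I1).
  have J2 := cintable_normc (L2_mul_cintable fL (kL 1 ltr01)).
  have := integrableD measurableT J2 J1.
  rewrite (_ : EFin \o G = (fun y => (normc (f y * ((gauss_kernel 1 x y)%:C)%C))%:E +
    (normc (f x * ((gauss_kernel 1 x y)%:C)%C))%:E)%E)//.
  apply/funext => y; rewrite /= /G !Normc.normcM normc_real ger0_norm ?gauss_kernel_ge0//.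
  by rewrite -EFinD mulrDl.
pose B := \int[mu]_y G y.
have G0 y : 0 <= G y by rewrite mulr_ge0 ?gauss_kernel_ge0// addr_ge0 ?normc_ge0.
have B0 : 0 <= B by apply: Rintegral_ge0 => y _; exact: G0.
near=> m.
have m0 : (0 < m)%N by near: m; exact: nbhs_infty_gt.
have mB : 2 * (K * B) / e <= m%:R by near: m; exact: nbhs_infty_ger.
have s0 : 0 < m.+1%:R :> R by [].
have [Ik Ek] := cint_gauss_kernel x s0.
have ifk := L2_mul_cintable fL (kL _ s0).
have iD : cintable mu (fun y => (f y - f x) * ((gauss_kernel m.+1%:R x y)%:C)%C).
  have := cintableB ifk (cintableZ (f x) Ik).
  by under eq_fun do rewrite -mulrBl.
have -> : cint mu (fun y => f y * ((gauss_kernel m.+1%:R x y)%:C)%C) - f x =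
    cint mu (fun y => (f y - f x) * ((gauss_kernel m.+1%:R x y)%:C)%C).
  rewrite -{1}[f x]mulr1 -Ek -cintZ// -cintB//; last exact: cintableZ.
  by congr cint; apply/funext => y; rewrite mulrBl.
rewrite -lee_fin; apply: le_trans (normc_cint_le iD) _.
have ik : mu.-integrable setT (EFin \o (fun y => e / 2 * gauss_kernel m.+1%:R x y)).
  have [ir _] := Ik; exact: (integrableZl measurableT (e / 2) ir).
have iKG : mu.-integrable setT (EFin \o (fun y => K / m%:R * G y)).
  exact: (integrableZl measurableT (K / m%:R) iG).
apply: (@le_trans _ _ (\int[mu]_y (e / 2 * gauss_kernel m.+1%:R x y + K / m%:R * G y)%:E)%E).
  apply: le_integral => //; first exact: cintable_normc.
    by under eq_fun do rewrite EFinD; exact: integrableD.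
  move=> y _; rewrite lee_fin Normc.normcM normc_real ger0_norm ?gauss_kernel_ge0//.
  have [far|near_y] := pselect (exists i, d <= `|x ord0 i - y ord0 i|).
    apply: ler_wpDl; first by rewrite mulr_ge0 ?gauss_kernel_ge0// divr_ge0// ltW.
    rewrite /G [leRHS]mulrCA; apply: ler_pM; rewrite ?normc_ge0 ?gauss_kernel_ge0//.
      by rewrite (le_trans (normc_triangle _ _))// normc_opp.
    exact: KP.
  rewrite -[leLHS]addr0 lerD//; last by rewrite mulr_ge0// divr_ge0.
  rewrite ler_wpM2r ?gauss_kernel_ge0// near_x// => i.
  by rewrite ltNge; apply/negP => di; apply: near_y; exists i.
have E1 : \int[mu]_y gauss_kernel m.+1%:R x y = 1.
  by have := congr1 (@complex.Re R) Ek.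
under eq_integral do rewrite EFinD.
rewrite integralD//.
have -> : (\int[mu]_y (e / 2 * gauss_kernel m.+1%:R x y)%:E = (e / 2)%:E)%E.
  have [ir _] := Ik.
  rewrite -[LHS]fineK; last exact: integrable_fin_num ik.
  congr EFin; rewrite -[LHS]/(\int[mu]_y (e / 2 * gauss_kernel m.+1%:R x y)).
  by rewrite RintegralZl// E1 mulr1.
have -> : (\int[mu]_y (K / m%:R * G y)%:E = (K / m%:R * B)%:E)%E.
  rewrite -[LHS]fineK; last exact: integrable_fin_num iKG.
  congr EFin; rewrite -[LHS]/(\int[mu]_y (K / m%:R * G y)).
  by rewrite RintegralZl.
rewrite -EFinD lee_fin.
have mR : 0 < m%:R :> R by rewrite ltr0n.
have : K / m%:R * B <= e / 2.
  rewrite mulrAC ler_pdivrMr//; move: mB; rewrite ler_pdivrMr//; lra.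
lra.
Unshelve. all: by end_near. Qed.

(** In [L2_fourier_kernel] the left side tends to [f x] by continuity, the right
    side to the integral by dominated convergence. *)
Theorem L2_fourier_inversion (f fhat : 'rV[R]_n -> R[i]) x :
  Ccontinuous f -> L2_fourier f fhat -> cintable mu fhat ->
  f x = (c%:C)%C * cint mu (fun xi => fhat xi * cis (dot x xi)).
Proof.
move=> cf ff ifhat; have [fL fhL _] := ff; have [mfhat _] := (cintableP _ _).1 ifhat.
have ig : cintable mu (fun xi => fhat xi * cis (dot x xi)).
  under eq_fun do rewrite mulrC; apply: cintable_mul_le1 ifhat => [|xi].
    by apply: cmeas_cis; apply: measurable_dot; [exact: measurable_cst|exact: measurable_id].
  by rewrite normc_cis.
apply/eqP; rewrite -subr_eq0; apply/eqP; apply: (@small_normc0 _ _ (1 + c)) => e e0.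
near \oo => m.
have s0 : 0 < m.+1%:R :> R by [].
have A : normc (cint mu (fun y => f y * ((gauss_kernel m.+1%:R x y)%:C)%C) - f x) <= e.
  by near: m; exact: gauss_kernel_cvg.
have B : normc (cint mu (fun xi => ((damping m.+1%:R xi)%:C)%C * (fhat xi * cis (dot x xi))) -
    cint mu (fun xi => fhat xi * cis (dot x xi))) <= e.
  by near: m; exact: cint_damping_cvg.
rewrite (L2_fourier_kernel x s0 ff) in A.
rewrite mulrDl mul1r; apply: le_trans (lerD A (ler_wpM2l (ltW (@fourier_const_gt0 R n)) B)).
have -> : c * normc (cint mu (fun xi => ((damping m.+1%:R xi)%:C)%C * (fhat xi * cis (dot x xi))) -
    cint mu (fun xi => fhat xi * cis (dot x xi))) =
  normc ((c%:C)%C * (cint mu (fun xi => ((damping m.+1%:R xi)%:C)%C * (fhat xi * cis (dot x xi))) -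
    cint mu (fun xi => fhat xi * cis (dot x xi)))).
  by rewrite Normc.normcM normc_real gtr0_norm// fourier_const_gt0.
rewrite -(normc_opp (_ - f x)); apply: (le_trans _ (normc_triangle _ _)).
by rewrite le_eqVlt; apply/orP; left; apply/eqP; congr normc; ring.
Unshelve. all: by end_near. Qed.

End inversion_limit.

(** * Interpolation with a partition of unity *)

Section weighted_interpolation.
Context {R : realType} {n : nat}.
Local Notation mu := (lebesgue_rV R n).
Local Notation c := (@fourier_const R n).
Local Notation twopi := (2 * pi : R).
Implicit Types (x y xi : 'rV[R]_n) (j k : 'rV[int]_n) (J : {fset 'rV[int]_n}).

Variable s : 'rV[R]_n -> R.
Hypothesis ms : measurable_fun setT s.
Hypothesis s0 : forall xi, 0 <= s xi.
Hypothesis s1 : forall xi, (\esum_(k in setT) (s (xi + twopi *: lat k)%R)%:E = 1)%E.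

Variable F : 'rV[R]_n -> R[i].
Hypothesis lF : tL2 F.
Hypothesis perF : forall xi k, F (xi + twopi *: lat k) = F xi.

Let cF : cmeas F. Proof. by case: lF. Qed.

Lemma weight_le1 xi : s xi <= 1.
Proof.
rewrite -lee_fin -(s1 xi); apply: esum_ge; exists [set (0 : 'rV[int]_n)].
  by split => //; exact: finite_set1.
by rewrite fsbig_set1 lat0 scaler0 addr0.
Qed.

Lemma integral_weight (G : 'rV[R]_n -> R) : measurable_fun setT G ->
  (forall xi, 0 <= G xi) -> (forall xi k, G (xi + twopi *: lat k) = G xi) ->
  (\int[mu]_xi (s xi * G xi)%:E = \int[mu]_(xi in torus) (G xi)%:E)%E.
Proof.
move=> mG G0 pG.
exact: (@integral_periodic_weight R n (- pi) twopi (@twopi_gt0 R) s G ms s0 s1 mG G0 pG).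
Qed.

Definition discrepancy xi : R := s xi - \1_torus xi.

Lemma measurable_discrepancy : measurable_fun setT discrepancy.
Proof. by apply: measurable_funB => //; apply: measurable_indic; exact: measurable_torus. Qed.

(** On the torus the modulus of the discrepancy is [1 - s], off the torus it is
    [s]; by [integral_weight] the mass of [s G] off the torus is the mass of
    [(1 - s) G] on it. *)
Lemma integral_discrepancy (G : 'rV[R]_n -> R) : measurable_fun setT G ->
  (forall xi, 0 <= G xi) -> (forall xi k, G (xi + twopi *: lat k) = G xi) ->
  (\int[mu]_(xi in torus) (G xi)%:E < +oo)%E ->
  (\int[mu]_xi (`|discrepancy xi| * G xi)%:E =
   \int[mu]_(xi in torus) (2 * (1 - s xi) * G xi)%:E)%E.
Proof.
move=> mG G0 perG fG; have mT := @measurable_torus R n.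
have mI : measurable_fun setT (\1_torus : 'rV[R]_n -> R) by exact: measurable_indic.
have msG : measurable_fun setT (fun xi => s xi * G xi) by exact: measurable_funM.
have msG0 xi : 0 <= s xi * G xi by rewrite mulr_ge0.
have torusE (H : 'rV[R]_n -> R) :
    (\int[mu]_(xi in torus) (H xi)%:E = \int[mu]_xi (\1_torus xi * H xi)%:E)%E.
  rewrite integral_mkcond; apply: eq_integral => xi _.
  by rewrite patchE indicE; case: ifP => _; rewrite ?mul1r ?mul0r.
have fsG : (\int[mu]_(xi in torus) (2 * (s xi * G xi))%:E \is a fin_num)%E.
  rewrite ge0_fin_numE; last by apply: integral_ge0 => xi _; rewrite lee_fin mulr_ge0.
  apply: (@le_lt_trans _ _ (2%:E * \int[mu]_(xi in torus) (G xi)%:E)%E); last exact: lte_mul_pinfty.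
  rewrite -ge0_integralZl//; last 2 first.
  - by apply/measurable_EFinP; exact: measurable_funTS.
  - by move=> xi _; rewrite lee_fin.
  apply: ge0_le_integral => //.
  - by move=> xi _; rewrite lee_fin mulr_ge0.
  - by apply/measurable_EFinP; apply: measurable_funTS; apply: measurable_funM.
  - by apply: measurable_funeM; apply/measurable_EFinP; exact: measurable_funTS.
  - by move=> xi _; rewrite -EFinM lee_fin ler_wpM2l// ler_piMl// weight_le1.
rewrite -[LHS](addeK _ fsG) -[RHS](addeK _ fsG); congr (_ - _)%E.
rewrite [LHS]addeC [RHS]addeC.
have mG' : measurable_fun torus G by exact: measurable_funTS.
have ms' : measurable_fun torus s by exact: measurable_funTS.
transitivity (\int[mu]_xi ((s xi * G xi)%:E + (\1_torus xi * G xi)%:E))%E.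
  rewrite torusE -ge0_integralD//.
  - apply: eq_integral => xi _; rewrite -!EFinD; congr EFin; rewrite /discrepancy indicE.
    case: (xi \in torus) => /=.
      by rewrite distrC ger0_norm ?subr_ge0 ?weight_le1//; ring.
    by rewrite subr0 ger0_norm//; ring.
  - by move=> xi _; rewrite lee_fin !mulr_ge0.
  - by apply/measurable_EFinP; do 2 apply: measurable_funM => //.
  - by move=> xi _; rewrite lee_fin mulr_ge0.
  - apply/measurable_EFinP; apply: measurable_funM => //.
    by apply: measurableT_comp => //; exact: measurable_discrepancy.
rewrite ge0_integralD//; last 4 first.
- by move=> xi _; rewrite lee_fin mulr_ge0.
- exact/measurable_EFinP.
- by move=> xi _; rewrite lee_fin mulr_ge0.
- by apply/measurable_EFinP; exact: measurable_funM.
rewrite integral_weight// -torusE -!ge0_integralD//; try solve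
  [by move=> xi _; rewrite lee_fin ?mulr_ge0// ?mulr_ge0// subr_ge0 weight_le1
  |by apply/measurable_EFinP; apply: measurable_funTS; exact: measurable_funM
  |apply/measurable_EFinP; apply: measurable_funM => //; apply: measurable_funM => //;
   exact: measurable_funB
  |exact/measurable_EFinP].
by apply: eq_integral => xi _; rewrite -!EFinD; congr EFin; ring.
Qed.

Lemma mode_periodic j xi k : mode j (xi + twopi *: lat k) = mode j xi.
Proof.
rewrite /mode dotDr opprD cisD [X in _ * X](_ : _ = 1) ?mulr1//.
rewrite dotC dotZl (_ : dot (lat k) (lat j) = (\sum_i k ord0 i * j ord0 i)%:~R); last first.
  by rewrite rmorph_sum; apply: eq_bigr => i _; rewrite !mxE rmorphM.
by rewrite -mulrN -intrN cis_2pi_int.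
Qed.

Lemma trig_sum_periodic J a xi k : trig_sum J a (xi + twopi *: lat k) = trig_sum J a xi.
Proof. by apply: eq_bigr => j _; rewrite mode_periodic. Qed.

(** Pointwise, [v <= t + v^2 / t] for [v >= 0]. *)
Lemma torus_integral_normc_le (G : 'rV[R]_n -> R[i]) (t : R) : cmeas G -> 0 < t ->
  (\int[mu]_(xi in torus) (normc (G xi))%:E <= (t * twopi ^+ n)%:E + (t^-1)%:E * tnorm2 G)%E.
Proof.
move=> mG t0; have mT := @measurable_torus R n; have t0' := ltW t0.
rewrite tnorm2Zl ?invr_ge0//.
rewrite (_ : (t * twopi ^+ n)%:E = \int[mu]_(xi in torus) t%:E)%E; last first.
  by rewrite integral_cst// [X in (_ * X)%E](_ : _ = (twopi ^+ n)%:E)//; exact: torus_measure.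
rewrite -ge0_integralD//; last 2 first.
- by move=> xi _; rewrite -EFinM lee_fin mulr_ge0 ?nsq_ge0// invr_ge0.
- by apply: measurable_funeM; exact: measurable_nsqE.
apply: ge0_le_integral => //.
- by move=> xi _; rewrite lee_fin normc_ge0.
- by apply/measurable_EFinP; apply: measurable_funTS; exact: measurable_normc.
- by apply: emeasurable_funD => //; apply: measurable_funeM; exact: measurable_nsqE.
- move=> xi _; rewrite -EFinM -EFinD lee_fin -sqr_normc -(ler_pM2l t0) mulrDr mulrA.
  rewrite mulfV ?gt_eqF// mul1r; have := normc_ge0 (G xi); move: (normc (G xi)) => v v0.
  nra.
Qed.

Lemma tL2_normc_fin (G : 'rV[R]_n -> R[i]) : tL2 G ->
  (\int[mu]_(xi in torus) (normc (G xi))%:E < +oo)%E.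
Proof.
move=> [mG fG]; apply: le_lt_trans (torus_integral_normc_le mG ltr01) _.
by rewrite lte_add_pinfty ?ltry// invr1 mul1e.
Qed.

Lemma cintable_weight_mul (u G : 'rV[R]_n -> R[i]) : tL2 G -> cmeas u ->
  (forall xi, normc (u xi) <= 1) -> (forall xi k, G (xi + twopi *: lat k) = G xi) ->
  cintable mu (fun xi => ((s xi)%:C)%C * (u xi * G xi)).
Proof.
move=> lG mu_ u1 perG; have [mG _] := lG; apply/cintableP; split.
  by apply: cmeasM; [exact: cmeas_real|exact: cmeasM].
apply: le_lt_trans (tL2_normc_fin lG).
rewrite -integral_weight; last 3 first.
- exact: measurable_normc.
- by move=> xi; exact: normc_ge0.
- by move=> xi k; rewrite perG.
apply: ge0_le_integral => //.
- by move=> xi _; rewrite lee_fin normc_ge0.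
- apply/measurable_EFinP; apply: measurable_normc.
  by apply: cmeasM; [exact: cmeas_real|exact: cmeasM].
- by apply/measurable_EFinP; apply: measurable_funM => //; exact: measurable_normc.
- move=> xi _; rewrite lee_fin !Normc.normcM normc_real ger0_norm// ler_wpM2l//.
  by rewrite ler_piMl// normc_ge0.
Qed.

Lemma cmeas_cis_dot x : cmeas (fun xi => cis (dot x xi)).
Proof.
apply: cmeas_cis; apply: measurable_dot; [exact: measurable_cst|exact: measurable_id].
Qed.

Lemma normc_cis_le1 (t : R) : normc (cis t) <= 1.
Proof. by rewrite normc_cis. Qed.

(** The limit of the interpolation series, see [weighted_series]. *)
Definition weighted_value x : R[i] :=
  (c%:C)%C * cint mu (fun xi => ((s xi)%:C)%C * (cis (dot x xi) * F xi)).

Definition weighted_fundamental : 'rV[R]_n -> R[i] :=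
  inverse_fourier (fun xi => ((c * s xi)%:C)%C).

Lemma weighted_partial_sum J x :
  \sum_(j <- J) coef F j * weighted_fundamental (x - lat j) =
  (c%:C)%C * cint mu (fun xi => ((s xi)%:C)%C * (cis (dot x xi) * proj J F xi)).
Proof.
have is_mode j : cintable mu (fun xi => ((s xi)%:C)%C * (cis (dot x xi) * mode j xi)).
  apply: (cintable_weight_mul (tL2_mode j) (cmeas_cis_dot x)) => [xi|xi k].
    exact: normc_cis_le1.
  exact: mode_periodic.
have -> : (fun xi => ((s xi)%:C)%C * (cis (dot x xi) * proj J F xi)) =
    fun xi => \sum_(j <- J) (coef F j * (c%:C)%C) * (((s xi)%:C)%C * (cis (dot x xi) * mode j xi)).
  by apply/funext => xi; rewrite /proj /trig_sum !mulr_sumr; apply: eq_bigr => j _; ring.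
rewrite cint_sum; last by move=> j; exact: cintableZ.
rewrite mulr_sumr; apply: eq_bigr => j _.
rewrite cintZ// /weighted_fundamental /inverse_fourier.
rewrite -[Cintegral _]/(cint mu (fun xi => ((c * s xi)%:C)%C * cis (dot (x - lat j) xi))).
have -> : (fun xi => ((c * s xi)%:C)%C * cis (dot (x - lat j) xi)) =
    fun xi => (c%:C)%C * (((s xi)%:C)%C * (cis (dot x xi) * mode j xi)).
  by apply/funext => xi; rewrite rmorphM /= /mode dotDl dotNl cisD; ring.
by rewrite cintZ//; ring.
Qed.

(** The interpolation series converges because the Fourier series of [F]
    converges in the weighted L^2 space, which is L^2 of the torus. *)
Lemma weighted_series x :
  lattice_sums_to (fun j => coef F j * weighted_fundamental (x - lat j)) (weighted_value x).
Proof.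
move=> e e0; have c0 := @fourier_const_gt0 R n.
have P0 : 0 < twopi ^+ n by rewrite exprn_gt0// twopi_gt0.
(* Makes the first term of [torus_integral_normc_le] equal to [e / (4 c)]; the
   second is made as small by taking the squared norm below [t e / (4 c)]. *)
pose t := e / (4 * c * twopi ^+ n).
have t0 : 0 < t by rewrite divr_gt0// !mulr_gt0.
have et0 : 0 < t * (e / (4 * c)) by rewrite mulr_gt0// divr_gt0// mulr_gt0.
have [J0 J0P] := proj_cvg lF (approximable_tL2 lF) et0.
exists J0 => J /J0P le; rewrite weighted_partial_sum /weighted_value -mulrBr.
have lP : tL2 (proj J F) by exact: tL2_trig_sum.
have perP xi k : proj J F (xi + twopi *: lat k) = proj J F xi by exact: trig_sum_periodic.
have iP := cintable_weight_mul lP (cmeas_cis_dot x) (fun xi => normc_cis_le1 _) perP.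
have iF := cintable_weight_mul lF (cmeas_cis_dot x) (fun xi => normc_cis_le1 _) perF.
rewrite -cintB// Normc.normcM normc_real (gtr0_norm c0).
pose G xi := F xi - proj J F xi.
have lG : tL2 G by exact: tL2B.
have mG : cmeas G by case: lG.
suff : normc (cint mu (fun xi => ((s xi)%:C)%C * (cis (dot x xi) * proj J F xi) -
    ((s xi)%:C)%C * (cis (dot x xi) * F xi))) <= e / (2 * c).
  move=> small; apply: (@le_lt_trans _ _ (c * (e / (2 * c)))); first by rewrite ler_pM2l.
  by rewrite (_ : c * _ = e / 2); [lra|field; rewrite gt_eqF].
rewrite -lee_fin; apply: le_trans (normc_cint_le (cintableB iP iF)) _.
apply: (@le_trans _ _ (\int[mu]_xi (s xi * normc (G xi))%:E)%E).
  rewrite le_eqVlt; apply/orP; left; apply/eqP; apply: eq_integral => xi _; congr EFin.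
  rewrite -mulrBr -mulrBr !Normc.normcM normc_real ger0_norm// normc_cis mul1r.
  by rewrite -normc_opp opprB.
rewrite integral_weight; last 3 first.
- exact: measurable_normc.
- by move=> xi; exact: normc_ge0.
- by move=> xi k; rewrite /G perF perP.
apply: le_trans (torus_integral_normc_le mG t0) _.
apply: (@le_trans _ _ ((t * twopi ^+ n)%:E + (t^-1)%:E * (t * (e / (4 * c)))%:E)%E).
  by rewrite leeD2l// lee_wpmul2l// lee_fin invr_ge0 ltW.
rewrite -EFinM -EFinD lee_fin mulKf ?gt_eqF// /t.
rewrite le_eqVlt; apply/orP; left; apply/eqP; field.
by rewrite !gt_eqF.
Qed.

Variable f : 'rV[R]_n -> R[i].
Hypothesis fE : forall x, f x = (c%:C)%C * tint (fun xi => F xi * cis (dot x xi)).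

Lemma cintable_discrepancy x : cintable mu
  (fun xi => ((discrepancy xi)%:C)%C * (cis (dot x xi) * F xi)).
Proof.
apply/cintableP; split.
  apply: cmeasM; first by apply: cmeas_real; exact: measurable_discrepancy.
  by apply: cmeasM => //; exact: cmeas_cis_dot.
under eq_integral do rewrite !Normc.normcM normc_real normc_cis mul1r.
rewrite integral_discrepancy; last 4 first.
- exact: measurable_normc.
- by move=> xi; exact: normc_ge0.
- by move=> xi k; rewrite perF.
- exact: tL2_normc_fin.
apply: (@le_lt_trans _ _ (2%:E * \int[mu]_(xi in torus) (normc (F xi))%:E)%E); last first.
  by apply: lte_mul_pinfty => //; exact: tL2_normc_fin.
have mT := @measurable_torus R n.
have mnF : measurable_fun torus (fun xi => normc (F xi)).
  by apply: measurable_funTS; exact: measurable_normc.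
have ms' : measurable_fun torus s by exact: measurable_funTS.
rewrite -ge0_integralZl//; last 2 first.
- exact/measurable_EFinP.
- by move=> xi _; rewrite lee_fin normc_ge0.
apply: ge0_le_integral => //.
- by move=> xi _; rewrite lee_fin !mulr_ge0 ?normc_ge0// subr_ge0 weight_le1.
- apply/measurable_EFinP; apply: measurable_funM => //; apply: measurable_funM => //.
  exact: measurable_funB.
- by apply: measurable_funeM; exact/measurable_EFinP.
- move=> xi _; rewrite -EFinM lee_fin -mulrA ler_wpM2l// ler_piMl ?normc_ge0//.
  by rewrite lerBlDr lerDl.
Qed.

Lemma weighted_error x : weighted_value x - f x =
  (c%:C)%C * cint mu (fun xi => ((discrepancy xi)%:C)%C * (cis (dot x xi) * F xi)).
Proof.
have iF := cintable_weight_mul lF (cmeas_cis_dot x) (fun xi => normc_cis_le1 _) perF.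
rewrite fE /weighted_value /tint -mulrBr; congr (_ * _).
have iT : cintable mu (fun xi => ((\1_torus xi)%:C)%C * (F xi * cis (dot x xi))).
  have := cintableB iF (cintable_discrepancy x).
  rewrite (_ : (fun xi => _ - _) = fun xi => ((\1_torus xi)%:C)%C * (F xi * cis (dot x xi)))//.
  by apply/funext => xi; rewrite /discrepancy rmorphB /=; ring.
rewrite -cintB//; congr cint; apply/funext => xi.
by rewrite /discrepancy rmorphB /=; ring.
Qed.

Lemma weighted_error_sup x :
  ((normc (weighted_value x - f x))%:E <=
   c%:E * \int[mu]_(xi in torus) (2 * (1 - s xi) * normc (F xi))%:E)%E.
Proof.
have c0 := @fourier_const_gt0 R n.
rewrite weighted_error Normc.normcM normc_real (gtr0_norm c0) EFinM.
apply: lee_wpmul2l; first by rewrite lee_fin ltW.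
apply: le_trans (normc_cint_le (cintable_discrepancy x)) _.
under eq_integral do rewrite !Normc.normcM normc_real normc_cis mul1r.
rewrite integral_discrepancy//.
- exact: measurable_normc.
- by move=> xi; exact: normc_ge0.
- by move=> xi k; rewrite perF.
- exact: tL2_normc_fin.
Qed.

End weighted_interpolation.

(** * The L^2 norm of the error *)

Section weighted_L2_error.
Context {R : realType} {n : nat}.
Local Notation mu := (lebesgue_rV R n).
Local Notation c := (@fourier_const R n).
Local Notation twopi := (2 * pi : R).
Implicit Types (x y xi : 'rV[R]_n) (j k : 'rV[int]_n) (J : {fset 'rV[int]_n}).

Variable s : 'rV[R]_n -> R.
Hypothesis ms : measurable_fun setT s.
Hypothesis s0 : forall xi, 0 <= s xi.
Hypothesis s1 : forall xi, (\esum_(k in setT) (s (xi + twopi *: lat k)%R)%:E = 1)%E.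
Variable F : 'rV[R]_n -> R[i].
Hypothesis lF : tL2 F.
Hypothesis perF : forall xi k, F (xi + twopi *: lat k) = F xi.
Variable f : 'rV[R]_n -> R[i].
Hypothesis fE : forall x, f x = (c%:C)%C * tint (fun xi => F xi * cis (dot x xi)).

Let D x := weighted_value s F x - f x.

Definition error_bound : \bar R := tnorm2 (fun xi => ((2 * (1 - s xi))%:C)%C * F xi).

Let cF : cmeas F. Proof. by case: lF. Qed.

Let mdeficit : cmeas (fun xi => ((2 * (1 - s xi))%:C)%C).
Proof. by apply: cmeas_real; apply: measurable_funM => //; exact: measurable_funB. Qed.

Let deficit_itv xi : 0 <= 1 - s xi <= 1.
Proof. by rewrite subr_ge0 (weight_le1 s1) lerBlDr lerDl s0. Qed.

Lemma error_bound_fin : error_bound \is a fin_num.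
Proof.
rewrite ge0_fin_numE ?tnorm2_ge0//.
suff : tL2 (fun xi => ((2 * (1 - s xi))%:C)%C * F xi) by case.
apply: (tL2_bounded_mul (K := 4) mdeficit) => // xi.
by have /andP[d0 d1] := deficit_itv xi; rewrite nsq_real; nra.
Qed.

(** Testing the values of the error along a coset of Z^n against the
    trigonometric polynomial with these values as coefficients bounds their sum
    of squares by duality. *)
Lemma error_coset_sum J x :
  ((\sum_(j <- J) nsq (D (x + lat j)))%:E <= error_bound)%E.
Proof.
have mT := @measurable_torus R n.
pose d j := D (x + lat j); pose P := trig_sum J d.
set A := \sum_(j <- J) _.
have tP : tnorm2 P = A%:E by exact: tnorm2_trig_sum.
have lP : tL2 P by exact: tL2_trig_sum.
have [mP _] := lP.
pose G xi := normc (F xi) * normc (P xi).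
have mG : measurable_fun setT G by apply: measurable_funM; exact: measurable_normc.
have G0 xi : 0 <= G xi by rewrite mulr_ge0 ?normc_ge0.
have perG xi k : G (xi + twopi *: lat k) = G xi by rewrite /G perF /P trig_sum_periodic.
have fG : (\int[mu]_(xi in torus) (G xi)%:E < +oo)%E.
  apply: (@le_lt_trans _ _ (tnorm2 F + tnorm2 P)%E); last first.
    by rewrite lte_add_pinfty//; [case: lF|case: lP].
  rewrite /tnorm2 -ge0_integralD//; try solve
    [exact: measurable_nsqE|by move=> xi _; rewrite lee_fin nsq_ge0].
  apply: ge0_le_integral => //.
  - by move=> xi _; rewrite lee_fin.
  - by apply/measurable_EFinP; exact: measurable_funTS.
  - by apply: emeasurable_funD; exact: measurable_nsqE.
  - move=> xi _; rewrite -EFinD lee_fin -!sqr_normc /G.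
    have := normc_ge0 (F xi); have := normc_ge0 (P xi).
    by move: (normc (F xi)) (normc (P xi)) => a b a0 b0; nra.
pose H xi := ((discrepancy s xi)%:C)%C * (cis (dot x xi) * F xi * ((P xi)^*)%C).
have icd y := cintable_discrepancy ms s0 s1 lF perF y.
have AE : ((A%:C)%C : R[i]) = cint mu H.
  have -> : H = fun xi => \sum_(j <- J) (((d j)^*)%C * (c%:C)%C) *
      (((discrepancy s xi)%:C)%C * (cis (dot (x + lat j) xi) * F xi)).
    apply/funext => xi; rewrite /H.
    have -> : ((P xi)^*)%C = \sum_(j <- J) ((d j)^*)%C * ((c%:C)%C * cis (dot (lat j) xi)).
      rewrite /P /trig_sum rmorph_sum; apply: eq_bigr => j _.
      rewrite rmorphM rmorphM; congr (_ * (_ * _)); first by rewrite /= oppr0.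
      exact: conj_mode.
    rewrite !mulr_sumr; apply: eq_bigr => j _; rewrite dotDl cisD; ring.
  rewrite cint_sum; last by move=> j; exact: cintableZ (icd _).
  rewrite rmorph_sum; apply: eq_bigr => j _; rewrite cintZ; last exact: icd.
  by rewrite -mulrA -(weighted_error ms s0 s1 lF perF fE) mulrC conj_mul_nsq.
have iH : cintable mu H.
  apply/cintableP; split.
    apply: cmeasM; first by apply: cmeas_real; exact: measurable_discrepancy.
    apply: cmeasM; last exact: cmeas_conj.
    by apply: cmeasM => //; exact: cmeas_cis_dot.
  under eq_integral do rewrite !Normc.normcM normc_real normc_cis mul1r normc_conj.
  rewrite (integral_discrepancy ms s0 s1 mG G0 perG fG).
  apply: (@le_lt_trans _ _ (2%:E * \int[mu]_(xi in torus) (G xi)%:E)%E); last exact: lte_mul_pinfty.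
  rewrite -ge0_integralZl//; last 2 first.
  - by apply/measurable_EFinP; exact: measurable_funTS.
  - by move=> xi _; rewrite lee_fin.
  apply: ge0_le_integral => //.
  - by move=> xi _; rewrite lee_fin mulr_ge0// mulr_ge0//; case/andP: (deficit_itv xi).
  - apply/measurable_EFinP; apply: measurable_funTS; apply: measurable_funM => //.
    by apply: measurable_funM => //; exact: measurable_funB.
  - by apply: measurable_funeM; apply/measurable_EFinP; exact: measurable_funTS.
  - move=> xi _; rewrite -EFinM lee_fin -mulrA ler_wpM2l// ler_piMl//.
    by case/andP: (deficit_itv xi).
have A0 : 0 <= A by apply: sumr_ge0 => j _; exact: nsq_ge0.
(* [a b <= (a^2 + b^2) / 2]; the half with [A] is then absorbed on the left. *)
have AH : (A%:E <= (2^-1)%:E * error_bound + (2^-1)%:E * A%:E)%E.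
  have -> : A = normc (cint mu H) by rewrite -AE normc_real ger0_norm.
  apply: le_trans (normc_cint_le iH) _.
  under eq_integral do rewrite !Normc.normcM normc_real normc_cis mul1r normc_conj.
  rewrite (integral_discrepancy ms s0 s1 mG G0 perG fG).
  have -> : normc (cint mu H) = A by rewrite -AE normc_real ger0_norm.
  rewrite -tP /error_bound !tnorm2Zl//; last exact: cmeasM.
  have mE := cmeasM mdeficit cF.
  rewrite -ge0_integralD//; try solve
    [by move=> xi _; rewrite -EFinM lee_fin mulr_ge0// nsq_ge0
    |by apply: measurable_funeM; exact: measurable_nsqE].
  apply: ge0_le_integral => //.
  - by move=> xi _; rewrite lee_fin mulr_ge0// mulr_ge0//; case/andP: (deficit_itv xi).
  - apply/measurable_EFinP; apply: measurable_funTS; apply: measurable_funM => //.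
    by apply: measurable_funM => //; exact: measurable_funB.
  - by apply: emeasurable_funD; apply: measurable_funeM; exact: measurable_nsqE.
  - move=> xi _; rewrite -!EFinM -EFinD lee_fin nsqM nsq_real -!sqr_normc /G mulrA.
    rewrite -exprMn; move: (_ * normc (F xi)) (normc (P xi)) => a b.
    rewrite -subr_ge0 (_ : _ - _ = 2^-1 * (a - b) ^+ 2); last by field.
    by rewrite mulr_ge0// sqr_ge0.
move: AH; rewrite -(fineK error_bound_fin) -!EFinM -EFinD !lee_fin; lra.
Qed.

Lemma measurable_error : cmeas D.
Proof.
have -> : D = fun x => (c%:C)%C *
    cint mu (fun xi => ((discrepancy s xi)%:C)%C * (cis (dot x xi) * F xi)).
  by apply/funext => x; exact: weighted_error.
apply: cmeasM; first exact: cmeas_cst.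
apply: (cmeas_cint_param mu (h := fun p : 'rV[R]_n * 'rV[R]_n =>
  ((discrepancy s p.2)%:C)%C * (cis (dot p.1 p.2) * F p.2))).
apply: cmeasM.
  apply: (@cmeas_comp _ _ R _ _ snd (fun xi => ((discrepancy s xi)%:C)%C)) => //.
  by apply: cmeas_real; exact: measurable_discrepancy.
apply: cmeasM; last exact: cmeas_comp cF measurable_snd.
by apply: cmeas_cis; apply: measurable_dot; [exact: measurable_fst|exact: measurable_snd].
Qed.

(** Fold the integral onto the unit cube, where [error_coset_sum] bounds the sum
    over each coset of Z^n. *)
Lemma weighted_error_L2 : (\int[mu]_x (nsq (D x))%:E <= error_bound)%E.
Proof.
have mD : measurable_fun setT (fun x => nsq (D x)) by apply: measurable_nsq; exact: measurable_error.
have mE : measurable_fun setT (fun x => (nsq (D x))%:E) by exact/measurable_EFinP.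
have mB := @measurable_box_tile R n 0 1.
rewrite (@integral_fold R n 0 1 ltr01)//; last by move=> x; rewrite lee_fin nsq_ge0.
have mS k : measurable_fun setT (fun x : 'rV[R]_n => (nsq (D (x + 1 *: lat k)))%:E).
  exact: (measurableT_comp mE (measurable_addv (1 *: lat k))).
rewrite -integral_esum//; last 2 first.
- by move=> k; exact: measurable_funTS.
- by move=> k x; rewrite lee_fin nsq_ge0.
apply: (@le_trans _ _ (\int[mu]_(x in box 0 1) error_bound)%E).
  apply: ge0_le_integral => //.
  - by move=> x _; apply: esum_ge0 => k _; rewrite lee_fin nsq_ge0.
  - apply: measurable_funTS; apply: measurable_esum => //.
    by move=> k x; rewrite lee_fin nsq_ge0.
  - move=> x _; rewrite ge_ereal_sup// => _ [X [finX _] <-].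
    rewrite fsbig_finite//= sumEFin.
    apply: le_trans (error_coset_sum (fset_set X) x).
    by rewrite lee_fin; apply: ler_sum => k _; rewrite scale1r.
rewrite -(fineK error_bound_fin) integral_cst//.
rewrite [X in (_ * X <= _)%E](_ : _ = 1%E) ?mule1//.
have -> : box 0 1 = [set x : 'rV[R]_n | forall i, `[0, 0 + 1[%classic (x ord0 i)].
  by apply/seteqP; split => x /= xb i; have := xb i; rewrite in_itv.
transitivity (\prod_(i < n) @lebesgue_measure R `[0%R, (0 + 1)%R[%classic)%E.
  apply: (@lebesgue_rV_box R n (fun i => `[0, 0 + 1[%classic)) => i; exact: measurable_itv.
rewrite big1// => i _.
by rewrite lebesgue_measure_itv/= add0r lte_fin ltr01 oppr0 adde0.
Qed.

End weighted_L2_error.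

(** * Band-limited functions *)

Section paley_wiener_extension.
Context {R : realType} {n : nat}.
Local Notation mu := (lebesgue_rV R n).
Local Notation c := (@fourier_const R n).
Local Notation twopi := (2 * pi : R).
Implicit Types (x xi : 'rV[R]_n) (k : 'rV[int]_n).

(** The difference lies in finitely many hyperplanes. *)
Lemma cube_torus_ae : {ae mu, forall xi, cube xi -> torus xi}.
Proof.
have N i : mu.-negligible [set xi : 'rV[R]_n | xi ord0 i = pi].
  apply/negligibleP; last exact: lebesgue_rV_hyperplane.
  have -> : [set xi : 'rV[R]_n | xi ord0 i = pi] =
      [set v | forall j, (if j == i then [set pi] else setT) (v ord0 j)].
    apply/seteqP; split=> v /= => [vi j|/(_ i)]; last by rewrite eqxx.
    by case: eqP => // ->.
  apply: (@measurable_box R n (fun j => if j == i then [set pi] else setT)) => j; case: (j == i) => //; exact: measurable_set1.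
have NU : mu.-negligible (\big[setU/set0]_(i < n) [set xi : 'rV[R]_n | xi ord0 i = pi]).
  by elim/big_ind : _ => [|A B|i _]; [exact: negligible_set0|exact: negligibleU|exact: N].
apply: negligibleS NU => xi /= /not_implyP[cxi nT].
have [i xii] : exists i, xi ord0 i = pi.
  apply: contrapT => /forallNP no; apply: nT => i.
  have /andP[h1 h2] := cxi i; rewrite h1 /= (_ : - pi + 2 * pi = pi); last by ring.
  by rewrite lt_neqAle h2 andbT; apply/eqP; exact: no.
by rewrite -bigcup_seq; exists i => //=; rewrite mem_index_enum.
Qed.

Lemma supported_indic (g : 'rV[R]_n -> R[i]) : supported_in cube g ->
  {ae mu, forall xi, g xi = ((\1_torus xi)%:C)%C * g xi}.
Proof.
move=> gs; apply: filterS2 gs cube_torus_ae => xi g0 ct.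
rewrite indicE; case: (pselect (torus xi)) => [T|nT].
  by rewrite mem_set// mul1r.
by rewrite memNset//= mul0r g0// => /ct.
Qed.

Variables (f fhat : 'rV[R]_n -> R[i]).
Hypotheses (cf : Ccontinuous f) (ff : L2_fourier f fhat) (fs : supported_in cube fhat).

Definition periodized : 'rV[R]_n -> R[i] := fhat \o wrap (- pi) twopi.

Lemma periodized_torus xi : torus xi -> periodized xi = fhat xi.
Proof. by move=> T; rewrite /periodized /= wrap_id//; exact: twopi_gt0. Qed.

Lemma periodized_periodic xi k : periodized (xi + twopi *: lat k) = periodized xi.
Proof. by rewrite /periodized /= wrap_shift//; exact: twopi_gt0. Qed.

Let fhatL : in_L2 fhat. Proof. by case: ff. Qed.

Lemma tL2_of_L2 (g : 'rV[R]_n -> R[i]) : in_L2 g -> tL2 g.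
Proof.
move=> [mg /L2norm_fin gL]; split => //; apply: le_lt_trans gL.
apply: ge0_subset_integral => //.
- exact: measurable_torus.
- by apply/measurable_EFinP; exact: measurable_nsq.
- by move=> x _; rewrite lee_fin nsq_ge0.
Qed.

Lemma tL2_periodized : tL2 periodized.
Proof.
have [mg gT] := tL2_of_L2 fhatL; split.
  exact: cmeas_comp mg (@measurable_wrap R n (- pi) twopi (@twopi_gt0 R)).
rewrite /tnorm2 (eq_integral (fun xi => (nsq (fhat xi))%:E))// => xi /set_mem T.
by rewrite periodized_torus.
Qed.

(** Square integrable functions are integrable on sets of finite measure, and
    [fhat] vanishes almost everywhere off the torus. *)
Lemma cintable_fhat : cintable mu fhat.
Proof.
have lg := tL2_of_L2 fhatL; have [mg _] := lg.
apply/cintableP; split => //.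
rewrite (ae_eq_integral (fun xi => (normc (((\1_torus xi)%:C)%C * fhat xi))%:E))//.
- apply: le_lt_trans (tL2_normc_fin lg).
  rewrite [leRHS]integral_mkcond le_eqVlt; apply/orP; left; apply/eqP.
  apply: eq_integral => xi _; rewrite patchE indicE Normc.normcM normc_real.
  by case: ifP => _; rewrite ?normr1 ?normr0 ?mul1r ?mul0r.
- by apply/measurable_EFinP; exact: measurable_normc.
- apply/measurable_EFinP; apply: measurable_normc; apply: cmeasM => //.
  exact: measurable_indic_torus.
- by apply: filterS (supported_indic fs) => xi E _; rewrite -E.
Qed.

Lemma paley_wiener_inversion x :
  f x = (c%:C)%C * tint (fun xi => periodized xi * cis (dot x xi)).
Proof.
rewrite (L2_fourier_inversion x cf ff cintable_fhat); congr (_ * _).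
have [mg _] := tL2_of_L2 fhatL; have [mp _] := tL2_periodized.
apply: ae_eq_cint.
- by apply: cmeasM => //; exact: cmeas_cis_dot.
- apply: cmeasM; first exact: measurable_indic_torus.
  by apply: cmeasM => //; exact: cmeas_cis_dot.
apply: filterS (supported_indic fs) => xi E; rewrite {1}E -mulrA indicE.
case: (pselect (torus xi)) => T; last by rewrite memNset// !mul0r.
by rewrite periodized_torus.
Qed.

(** The coefficient is the inversion integral at the lattice point. *)
Lemma coef_periodized k : coef periodized k = f (lat k).
Proof.
rewrite paley_wiener_inversion /coef /ip; congr (_ * tint _).
by apply/funext => xi; rewrite conj_mode.
Qed.

End paley_wiener_extension.

(** * The weight of a cardinal interpolator *)

Section weights.
Context {R : realType} {n : nat}.
Local Notation mu := (lebesgue_rV R n).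
Local Notation c := (@fourier_const R n).
Local Notation twopi := (2 * pi : R).
Implicit Types (x xi : 'rV[R]_n) (k : 'rV[int]_n) (Y Z : {fset 'rV[int]_n}).
Hypothesis n_gt0 : (0 < n)%N.

Lemma esum_lattice_shift (G : 'rV[int]_n -> \bar R) k :
  (\esum_(j in setT) G (j + k)%R = \esum_(j in setT) G j)%E.
Proof.
rewrite [RHS](@reindex_esum R _ _ setT _ (fun j => j + k))//.
split => //; first by move=> i j _ _ /addIr.
by move=> j _; exists (j - k) => //; rewrite subrK.
Qed.

Lemma esum_lattice_opp (G : 'rV[int]_n -> \bar R) :
  (\esum_(j in setT) G (- j)%R = \esum_(j in setT) G j)%E.
Proof.
rewrite [RHS](@reindex_esum R _ _ setT _ (fun j => - j))//.
Qed.

(** Negative terms never raise a supremum of finite sums. *)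
Lemma esum_positive_part (G : 'rV[int]_n -> R) :
  (\esum_(j in setT) (G j)%:E = \esum_(j in setT) (Num.max (G j) 0)%:E)%E.
Proof.
apply/eqP; rewrite eq_le; apply/andP; split.
  by apply: le_esum => j _; rewrite lee_fin le_max lexx.
pose I := [set j | 0 <= G j].
apply: (@le_trans _ _ (\esum_(j in I) (G j)%:E)%E).
  rewrite [leRHS]esum_mkcond; apply: le_esum => j _.
  case: (pselect (I j)) => Ij; first by rewrite mem_set//= max_l.
  rewrite memNset// max_r//; apply: ltW; rewrite ltNge; apply/negP; exact: Ij.
apply: ge_ereal_sup => _ [X [finX _] <-]; apply: esum_ge; exists X => //; split => //.
Qed.

(** What makes the sums of [ph] along the cosets of 2 pi Z^n finite and positive
    off the lattice itself. *)
Definition dominated_symbol (M : 'rV[int]_n -> R) (ph : 'rV[R]_n -> R) :=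
  [/\ measurable_fun (~` [set (0 : 'rV[R]_n)]) ph,
      forall xi, xi != 0 -> 0 <= ph xi,
      forall xi, cube xi -> xi != 0 -> 0 < ph xi &
      forall k xi, k != 0 -> cube xi -> xi != 0 -> fourier_ratio ph k xi <= M k].

Variables (M : 'rV[int]_n -> R) (ph : 'rV[R]_n -> R).
Hypothesis sumM : summable [set k | k != 0] (fun k => (M k)%:E).
Hypothesis Mph : dominated_symbol M ph.

Let mph : measurable_fun (~` [set (0 : 'rV[R]_n)]) ph. Proof. by case: Mph. Qed.
Let ph0 : forall xi, xi != 0 -> 0 <= ph xi. Proof. by case: Mph. Qed.
Let ph_gt0 : forall xi, cube xi -> xi != 0 -> 0 < ph xi. Proof. by case: Mph. Qed.
Let phM : forall k xi, k != 0 -> cube xi -> xi != 0 -> fourier_ratio ph k xi <= M k.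
Proof. by case: Mph. Qed.

Lemma measurable_ph : measurable_fun setT ph.
Proof.
rewrite -(setUv [set (0 : 'rV[R]_n)]); apply/measurable_funU => //.
- exact: measurable_rV_set1.
- by apply: measurableC; exact: measurable_rV_set1.
- by split => //; exact: measurable_fun_set1.
Qed.

Definition lattice_points : set 'rV[R]_n := [set xi | wrap (- pi) twopi xi = 0].

(** Positive parts make the terms nonnegative at every point, and leave the sum
    unchanged by [esum_positive_part]. *)
Definition periodic_sum xi : \bar R :=
  (\esum_(j in setT) (Num.max (ph (xi + twopi *: lat j)%R) 0)%:E)%E.

(** On the lattice, a null set, the quotient would involve the value of [ph] at 0;
    the indicator keeps the sum along that coset equal to 1. *)
Definition weight xi : R :=
  if wrap (- pi) twopi xi == 0 then \1_torus xi else ph xi / fine (periodic_sum xi).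

Lemma wrap_shift_torus xi k : wrap (- pi) twopi (xi + twopi *: lat k) = wrap (- pi) twopi xi.
Proof. by rewrite wrap_shift// twopi_gt0. Qed.

Lemma measurable_lattice_points : measurable lattice_points.
Proof.
have mw := @measurable_wrap R n (- pi) twopi (@twopi_gt0 R).
by have := mw measurableT _ (measurable_rV_set1 0); rewrite setTI.
Qed.

(** Folded onto the torus, the indicator is that of the origin. *)
Lemma lattice_points_null : mu lattice_points = 0%E.
Proof.
have mL := measurable_lattice_points.
have mI : measurable_fun setT (fun x => (\1_lattice_points x)%:E : \bar R).
  by apply/measurable_EFinP; exact: measurable_indic.
rewrite -[lattice_points]setIT -integral_indic//.
rewrite (@integral_fold R n (- pi) twopi (@twopi_gt0 R))//.
rewrite esum1// => k _.
rewrite (eq_integral (fun x => (\1_[set (0 : 'rV[R]_n)] x)%:E)); last first.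
  move=> x /set_mem xT; rewrite !indicE.
  suff -> : (x + twopi *: lat k \in lattice_points) = (x \in [set 0]) by [].
  apply/idP/idP => /set_mem xk; apply/mem_set; move: xk; rewrite /lattice_points /=.
    by rewrite wrap_shift_torus wrap_id//; exact: twopi_gt0.
  by rewrite wrap_shift_torus => x0; rewrite x0 wrap_id// -?x0//; exact: twopi_gt0.
rewrite integral_indic//; last 2 first.
- exact: measurable_torus.
- exact: measurable_rV_set1.
apply/eqP; rewrite eq_le measure_ge0 andbT -(lebesgue_rV_set1 0 n_gt0).
apply: le_measure => //; apply/mem_set.
- by apply: measurableI; [exact: measurable_rV_set1|exact: measurable_torus].
- exact: measurable_rV_set1.
Qed.

Lemma periodic_sum_shift xi k : periodic_sum (xi + twopi *: lat k) = periodic_sum xi.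
Proof.
rewrite -[RHS](esum_lattice_shift _ k); apply: eq_esum => j _.
by rewrite latD scalerDr addrA addrAC.
Qed.

Lemma periodic_sumE xi : (\esum_(j in [set: 'rV[int]_n]) (ph (xi - twopi *: lat j))%:E)%E = periodic_sum xi.
Proof.
rewrite esum_positive_part -[LHS]esum_lattice_opp; apply: eq_esum => j _.
by rewrite latN scalerN opprK.
Qed.

Lemma measurable_periodic_sum : measurable_fun setT periodic_sum.
Proof.
apply: measurable_esum => [k|k x]; last by rewrite lee_fin le_max lexx orbT.
apply/measurable_EFinP; apply: measurable_maxr; last exact: measurable_cst.
exact: (measurableT_comp measurable_ph (measurable_addv (twopi *: lat k))).
Qed.

Lemma torus_cube xi : torus xi -> cube xi.
Proof.
move=> T i; have /andP[h1 h2] := T i; rewrite h1 /=.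
by rewrite (le_trans (ltW h2))// (_ : - pi + 2 * pi = pi)//; ring.
Qed.

Lemma shift_norm_lt1 (p u v : R) : 0 < p -> - p <= u -> u <= p -> u + 2 * p * v = 0 -> `|v| < 1.
Proof. by move=> p0 u1 u2 uv; rewrite ltr_norml; apply/andP; split; nra. Qed.

(** In a coordinate where [k] is nonzero the translation is by at least 2 pi, more
    than the half side of the cube. *)
Lemma lattice_neq0 xi k : cube xi -> k != 0 -> xi + twopi *: lat k != 0.
Proof.
move=> cxi k0; apply/eqP => xk.
have [i ki] := row_neq0 k0.
have : (xi + twopi *: lat k) ord0 i = 0 by rewrite xk mxE.
rewrite !mxE => xki; have /andP[x1 x2] := cxi i.
have P := pi_gt0 R.
suff /negP[] : ~~ (1 <= `|(k ord0 i)%:~R : R|).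
  by rewrite -intr_norm (_ : 1 = 1%:~R)// ler_int; move: ki; case: (k ord0 i) => [[]|].
rewrite -ltNge; exact: (shift_norm_lt1 P x1 x2 xki).
Qed.

(** Divided by its term in the cube, the sum consists of 1 and of the ratios. *)
Lemma periodic_sum_le xi (t : R) : cube xi -> xi != 0 ->
  (forall Y, 0 \notin Y -> \sum_(k <- Y) fourier_ratio ph k xi <= t) ->
  ((ph xi)%:E <= periodic_sum xi <= (ph xi * (1 + t))%:E)%E.
Proof.
move=> cxi xi0 ratio_t; have p0 := ph_gt0 cxi xi0.
have maxE k : k != 0 -> Num.max (ph (xi + twopi *: lat k)) 0 = ph xi * fourier_ratio ph k xi.
  move=> k0; rewrite /fourier_ratio mulrCA mulfV ?gt_eqF// mulr1 max_l// ph0//.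
  exact: lattice_neq0.
have max0 : Num.max (ph (xi + twopi *: lat 0)) 0 = ph xi.
  by rewrite lat0 scaler0 addr0 max_l// ltW.
apply/andP; split.
  apply: esum_ge; exists [set (0 : 'rV[int]_n)]; first by split => //; exact: finite_set1.
  by rewrite fsbig_set1 max0.
apply: ge_ereal_sup => _ [X [finX _] <-].
rewrite fsbig_finite//= sumEFin lee_fin.
set Z := fset_set X.
apply: (@le_trans _ _ (ph xi + \sum_(k <- (Z `\ (0%R))%fset) ph xi * fourier_ratio ph k xi)).
  have [Z0|Z0] := boolP (0 \in Z).
    rewrite (big_fsetD1 _ Z0) /= max0 lerD2l.
    rewrite big_seq [leRHS]big_seq; apply: ler_sum => k; rewrite !inE => /andP[k0 _].
    by rewrite maxE.
  rewrite -[leLHS]add0r; apply: lerD; first exact: ltW.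
  rewrite big_seq (_ : (Z `\ (0%R))%fset = Z); last first.
    by apply/fsetP => k; rewrite !inE; case: eqP => // ->; rewrite (negbTE Z0).
  rewrite [leRHS]big_seq; apply: ler_sum => k kZ.
  by rewrite maxE//; apply: contraNneq Z0 => <-.
rewrite -mulr_sumr mulrDr mulr1 lerD2l ler_pM2l// ratio_t// !inE eqxx//.
Qed.

Lemma summable_bound : exists2 T : R, 0 <= T &
  forall Y, 0 \notin Y -> \sum_(k <- Y) `|M k| <= T.
Proof.
pose S := (\esum_(k in [set k : 'rV[int]_n | (k != 0)%R]) `|(M k)%:E|)%E.
have Sfin : S \is a fin_num by rewrite ge0_fin_numE//; apply: esum_ge0.
exists (fine S); first by rewrite fine_ge0//; apply: esum_ge0.
move=> Y Y0; rewrite -lee_fin fineK//; apply: esum_ge.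
exists [set` Y]; first by split=> // k /= kY; apply: contraNneq Y0 => <-.
by rewrite fsbig_finite//= set_fsetK -sumEFin.
Qed.

(** Take a finite set whose sum is within [e] of the supremum. *)
Lemma summable_tail (e : R) : 0 < e -> exists2 X : {fset 'rV[int]_n}, 0 \notin X &
  forall Y, 0 \notin Y -> \sum_(k <- (Y `\` X)%fset) `|M k| <= e.
Proof.
move=> e0; pose S := (\esum_(k in [set k : 'rV[int]_n | (k != 0)%R]) `|(M k)%:E|)%E.
have Sfin : S \is a fin_num by rewrite ge0_fin_numE//; apply: esum_ge0.
have : (S - e%:E < S)%E by rewrite lteBlDr// lteDl// lte_fin.
move=> /ereal_sup_gt[_ [X [finX X0] <-]]; rewrite fsbig_finite//= sumEFin.
set Z := fset_set X => SZ.
have Z0 : 0 \notin Z.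
  by apply/negP; rewrite in_fset_set// => /set_mem /X0; rewrite /= eqxx.
exists Z => // Y Y0.
have ZY0 : 0 \notin (Z `|` Y)%fset by rewrite in_fsetU negb_or Z0.
have : ((\sum_(k <- (Z `|` Y)%fset) `|M k|)%:E <= S)%E.
  apply: esum_ge; exists [set` (Z `|` Y)%fset].
    by split=> // k /= kY; apply: contraNneq ZY0 => <-.
  by rewrite fsbig_finite//= set_fsetK -sumEFin.
rewrite (big_fsetID _ (fun k => k \in Z)) /=.
rewrite (_ : [fset x | x in (Z `|` Y)%fset & x \in Z]%fset = Z); last first.
  by apply/fsetP => k; rewrite !inE; case: (k \in Z); rewrite ?andbF ?orbT.
rewrite (_ : [fset x | x in (Z `|` Y)%fset & x \notin Z]%fset = (Y `\` Z)%fset); last first.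
  by apply/fsetP => k; rewrite !inE; case: (k \in Z); rewrite ?andbF ?andbT.
move: SZ; rewrite -(fineK Sfin) -EFinB lte_fin lee_fin => h1 h2.
lra.
Qed.

Lemma ratio_ge0 k xi : cube xi -> xi != 0 -> k != 0 -> 0 <= fourier_ratio ph k xi.
Proof.
by move=> cxi xi0 k0; rewrite divr_ge0// ph0//; exact: lattice_neq0.
Qed.

Lemma periodic_sum_wrap xi : periodic_sum (wrap (- pi) twopi xi) = periodic_sum xi.
Proof. by rewrite /wrap -scalerN -latN periodic_sum_shift. Qed.

Lemma fine_periodic_sum_gt0 xi : wrap (- pi) twopi xi != 0 ->
  0 < fine (periodic_sum xi) /\ periodic_sum xi \is a fin_num.
Proof.
rewrite -periodic_sum_wrap; set w := wrap _ _ _ => w0.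
have cw : cube w by apply: torus_cube; exact: (@box_wrap R n (- pi) twopi (@twopi_gt0 R)).
have [T _ MT] := summable_bound.
have /andP[S1 S2] : ((ph w)%:E <= periodic_sum w <= (ph w * (1 + T))%:E)%E.
  apply: periodic_sum_le => // Y Y0; apply: le_trans (MT Y Y0).
  rewrite big_seq [leRHS]big_seq; apply: ler_sum => k kY.
  apply: le_trans (ler_norm _); apply: phM => //; by apply: contraNneq Y0 => <-.
have Sfin : periodic_sum w \is a fin_num.
  rewrite fin_numElt (lt_le_trans _ S1) ?ltNyr// (le_lt_trans S2)// ltry//.
split=> //; rewrite -lte_fin fineK//; apply: lt_le_trans S1.
by rewrite lte_fin ph_gt0.
Qed.

Lemma weight_ge0 xi : 0 <= weight xi.
Proof.
rewrite /weight; case: ifPn => w0; first by rewrite indicE.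
have [S0 _] := fine_periodic_sum_gt0 w0.
apply: divr_ge0; last exact: ltW.
apply: ph0; apply: contraNneq w0 => ->.
by rewrite wrap_id//; [exact: twopi_gt0|move=> i; rewrite mxE; have := pi_gt0 R; lra].
Qed.

Lemma measurable_periodic_sumV : measurable_fun setT (fun xi => (fine (periodic_sum xi))^-1).
Proof.
rewrite (_ : (fun xi => _) = fun xi => (fine (periodic_sum xi)) `^ (-1)).
  apply: (measurableT_comp (measurable_powR (-1))).
  by apply: measurableT_comp => //; exact: measurable_periodic_sum.
apply/funext => xi; rewrite powR_inv1// fine_ge0//; apply: esum_ge0 => k _.
by rewrite lee_fin le_max lexx orbT.
Qed.

Lemma measurable_weight : measurable_fun setT weight.
Proof.
apply: measurable_fun_ifT => //.
- apply: (measurable_fun_bool true); rewrite setTI.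
  rewrite (_ : _ @^-1` _ = lattice_points); first exact: measurable_lattice_points.
  by apply/seteqP; split=> xi /eqP.
- by apply: measurable_indic; exact: measurable_torus.
- by apply: measurable_funM; [exact: measurable_ph|exact: measurable_periodic_sumV].
Qed.

Lemma weight_partition xi : (\esum_(k in setT) (weight (xi + twopi *: lat k)%R)%:E = 1)%E.
Proof.
have [w0|w0] := eqVneq (wrap (- pi) twopi xi) 0.
  rewrite (esum_single (i := - cell (- pi) twopi xi)).
  - rewrite /weight wrap_shift_torus w0 eqxx indicE latN scalerN mem_set//.
    exact: (@box_wrap R n (- pi) twopi (@twopi_gt0 R)).
  - by rewrite lee_fin weight_ge0.
  - move=> k kc; rewrite /weight wrap_shift_torus w0 eqxx indicE memNset// => T.
    move: kc; rewrite -[k]opprK; move: T; rewrite -[k]opprK latN scalerN.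
    by move=> /(@cell_unique R n (- pi) twopi (@twopi_gt0 R)) ->; rewrite opprK eqxx.
have [S0 Sfin] := fine_periodic_sum_gt0 w0.
transitivity (\esum_(k in setT) (((fine (periodic_sum xi))^-1)%:E *
    (Num.max (ph (xi + twopi *: lat k)%R) 0)%:E))%E.
  apply: eq_esum => k _; rewrite /weight wrap_shift_torus (negbTE w0) periodic_sum_shift.
  rewrite -EFinM mulrC max_l// ph0//; apply: contraNneq w0 => xk.
  rewrite -(wrap_shift_torus xi k) xk wrap_id//; first exact: twopi_gt0.
  by move=> i; rewrite mxE; have := pi_gt0 R; lra.
rewrite esumZl ?invr_ge0 ?ltW//; last by move=> k; rewrite lee_fin le_max lexx orbT.
by rewrite -/(periodic_sum xi) -(fineK Sfin) -EFinM mulVf// gt_eqF.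
Qed.

(** The two integrands differ only on the lattice, which is a null set. *)
Lemma fundamental_weighted : fundamental ph = weighted_fundamental weight.
Proof.
apply/funext => x; rewrite /fundamental /weighted_fundamental /inverse_fourier.
congr (_ * _); rewrite -[LHS]/(cint mu _) -[RHS]/(cint mu _).
apply: ae_eq_cint.
- apply: cmeasM; last exact: cmeas_cis_dot.
  apply: cmeas_real; rewrite /fundamental_hat; under eq_fun do rewrite periodic_sumE.
  apply: measurable_funM; last exact: measurable_periodic_sumV.
  by apply: measurable_funM; [exact: measurable_cst|exact: measurable_ph].
- apply: cmeasM; last exact: cmeas_cis_dot.
  by apply: cmeas_real; apply: measurable_funM; [exact: measurable_cst|exact: measurable_weight].
exists lattice_points; split.
- exact: measurable_lattice_points.
- exact: lattice_points_null.
move=> xi /= ne; apply: contrapT => w0; apply: ne.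
rewrite /fundamental_hat periodic_sumE /weight ifF ?mulrA//.
by apply/eqP.
Qed.

(** The weight is at least [1 / (1 + t)], and thus at least [1 - t]. *)
Lemma weight_near1 xi (t : R) : torus xi -> xi != 0 ->
  (forall Y, 0 \notin Y -> \sum_(k <- Y) fourier_ratio ph k xi <= t) ->
  1 - weight xi <= t.
Proof.
move=> T xi0 ht; have cxi := torus_cube T.
have w : wrap (- pi) twopi xi = xi by rewrite wrap_id//; exact: twopi_gt0.
have [S0 Sfin] : 0 < fine (periodic_sum xi) /\ periodic_sum xi \is a fin_num.
  by apply: fine_periodic_sum_gt0; rewrite w.
have /andP[S1 S2] := periodic_sum_le cxi xi0 ht.
rewrite /weight w (negbTE xi0); move: S1 S2; rewrite -(fineK Sfin) !lee_fin => S1 S2.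
have p0 := ph_gt0 cxi xi0.
have t0 : 0 <= t by have := ht fset0; rewrite big_seq_fset0; apply; rewrite inE.
rewrite lerBlDr -lerBlDl ler_pdivlMr//.
move: (fine _) (ph xi) p0 S0 S1 S2 => S p p0 S0 S1 S2.
have [t1|t1] := lerP t 1; last first.
  by apply: le_trans (ltW p0); apply: mulr_le0_ge0; [rewrite subr_le0 ltW|exact: ltW].
have t1' : 0 <= 1 - t by rewrite subr_ge0.
apply: le_trans (ler_wpM2l t1' S2) _.
have : 0 <= t * t * p by rewrite !mulr_ge0// ltW.
move=> tp.
by lra.
Qed.

End weights.

(** * Convergence of the weights *)

Section limits.
Context {R : realType} {n : nat}.
Local Notation mu := (lebesgue_rV R n).
Local Notation c := (@fourier_const R n).
Local Notation twopi := (2 * pi : R).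
Implicit Types (x xi : 'rV[R]_n) (k : 'rV[int]_n) (Y Z : {fset 'rV[int]_n}).
Hypothesis n_gt0 : (0 < n)%N.

Lemma torus_dominated_cvg0 (h : nat -> 'rV[R]_n -> R) (g : 'rV[R]_n -> R) (C : R) :
  (forall m, measurable_fun setT (h m)) -> measurable_fun setT g ->
  (forall xi, 0 <= g xi) -> (\int[mu]_(xi in torus) (g xi)%:E < +oo)%E ->
  (forall m xi, 0 <= h m xi <= C) ->
  {ae mu, forall xi, torus xi -> h m xi @[m --> \oo] --> (0 : R)} ->
  (\int[mu]_(xi in torus) (h m xi * g xi)%:E)%E @[m --> \oo] --> 0%E.
Proof.
move=> mh mg g0 gfin hC hcvg; have mT := @measurable_torus R n.
have mgT : measurable_fun torus g by exact: measurable_funTS.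
pose f_ m xi := (h m xi * g xi)%:E; pose G xi := (C%:E * (g xi)%:E)%E.
have mf_ m : measurable_fun torus (f_ m).
  by apply/measurable_EFinP; apply: measurable_funM => //; exact: measurable_funTS.
have m0 : measurable_fun torus (cst 0%E : 'rV[R]_n -> \bar R) by exact: measurable_cst.
have f_0 : {ae mu, forall xi, torus xi -> f_ ^~ xi @ \oo --> cst 0%E xi}.
  apply: filterS hcvg => xi hx T; apply: cvg_EFin; first exact: nearW.
  by rewrite -(mul0r (g xi)); apply: cvgMr_tmp; exact: hx.
have iG : mu.-integrable torus G.
  apply: integrableZl => //; apply/integrableP; split; first exact/measurable_EFinP.
  by under eq_integral do rewrite gee0_abs ?lee_fin//.
have f_G : {ae mu, forall xi m, torus xi -> (`|f_ m xi| <= G xi)%E}.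
  apply: aeW => xi m T; have /andP[h0 h1] := hC m xi.
  by rewrite gee0_abs ?lee_fin ?mulr_ge0// ler_wpM2r.
have [_ _] := dominated_convergence mT mf_ m0 f_0 iG f_G.
by rewrite integral0.
Qed.

Variable M : 'rV[int]_n -> R.
Hypothesis sumM : summable [set k | k != 0] (fun k => (M k)%:E).
Variable ph_ : nat -> 'rV[R]_n -> R.
Hypothesis Mph : forall m, dominated_symbol M (ph_ m).
Hypothesis ratio_cvg : {ae mu, forall xi, torus xi -> forall k, k != 0 ->
  fourier_ratio (ph_ m) k xi @[m --> \oo] --> (0 : R)}.

Let s m := weight (ph_ m).

Let s_itv m xi : 0 <= 1 - s m xi <= 1.
Proof.
rewrite subr_ge0 (weight_le1 (weight_partition sumM (Mph m))).
by rewrite lerBlDr lerDl (weight_ge0 sumM (Mph m)).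
Qed.

(** A finite set of ratios tends to 0, and the others are dominated by a tail of
    the summable family. *)
Lemma deficit_cvg0 xi : torus xi -> xi != 0 ->
  (forall k, k != 0 -> fourier_ratio (ph_ m) k xi @[m --> \oo] --> (0 : R)) ->
  (1 - s m xi) @[m --> \oo] --> (0 : R).
Proof.
move=> T xi0 rc; have cxi := torus_cube T.
have r0 m k : k != 0 -> 0 <= fourier_ratio (ph_ m) k xi.
  by move=> k0; exact: (ratio_ge0 (Mph m)).
apply/cvgr0Pnorm_le => e e0.
have e2 : 0 < e / 2 by rewrite divr_gt0.
have [X X0 tail] := summable_tail sumM e2.
have head : \sum_(k <- X | k != 0) fourier_ratio (ph_ m) k xi @[m --> \oo] -->
    \sum_(k <- X | k != 0) (0 : R).
  by apply: cvg_big => //; exact: add_continuous.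
rewrite big1 // in head.
move/cvgr0Pnorm_le : head => /(_ _ e2); apply: filterS => m hm.
have /andP[d0 _] := s_itv m xi; rewrite ger0_norm//.
apply: (weight_near1 sumM (Mph m)) => // Y Y0.
rewrite (big_fsetID _ (fun k => k \in X)) /=.
rewrite [leRHS](_ : e = e / 2 + e / 2); last by field.
apply: lerD.
  apply: le_trans hm; apply: le_trans (ler_norm _).
  rewrite [leRHS](_ : _ = \sum_(k <- X) fourier_ratio (ph_ m) k xi); last first.
    by rewrite big_seq_cond [RHS]big_seq_cond; apply: eq_bigl => k; rewrite andbT;
       case kX : (k \in X) => //=; apply: contraNneq X0 => <-.
  rewrite [leRHS](big_fsetID _ (fun k => k \in Y)) /=.
  rewrite (_ : [fset x | x in Y & x \in X]%fset = [fset x | x in X & x \in Y]%fset); last first.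
    by apply/fsetP => k; rewrite !inE /= andbC.
  rewrite lerDl big_seq; apply: sumr_ge0 => k; rewrite !inE /= => /andP[kX _].
  by apply: r0; apply: contraNneq X0 => <-.
rewrite (_ : [fset x | x in Y & x \notin X]%fset = (Y `\` X)%fset); last first.
  by apply/fsetP => k; rewrite !inE /= andbC.
apply: le_trans (tail Y Y0); rewrite big_seq [leRHS]big_seq; apply: ler_sum => k.
rewrite !inE => /andP[_ kY]; apply: le_trans (ler_norm _).
by case: (Mph m) => _ _ _; apply => //; apply: contraNneq Y0 => <-.
Qed.

Let deficit_ae : {ae mu, forall xi, torus xi -> (1 - s m xi) @[m --> \oo] --> (0 : R)}.
Proof.
have ne0 : {ae mu, forall xi, xi != 0}.
  exists [set 0]; split; [exact: measurable_rV_set1|exact: lebesgue_rV_set1|].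
  by move=> xi /= /negP; rewrite negbK => /eqP.
by apply: filterS2 ratio_cvg ne0 => xi rc xi0 T; apply: deficit_cvg0 => //; exact: rc.
Qed.

Variable F : 'rV[R]_n -> R[i].
Hypothesis lF : tL2 F.

Let ms m : measurable_fun setT (s m). Proof. exact: (measurable_weight (Mph m)). Qed.
Let mF : cmeas F. Proof. by case: lF. Qed.

Lemma sup_bound_cvg0 :
  (\int[mu]_(xi in torus) (2 * (1 - s m xi) * normc (F xi))%:E)%E @[m --> \oo] --> 0%E.
Proof.
apply: (@torus_dominated_cvg0 (fun m xi => 2 * (1 - s m xi)) (fun xi => normc (F xi)) 2).
- by move=> m; apply: measurable_funM => //; exact: measurable_funB.
- exact: measurable_normc.
- by move=> xi; exact: normc_ge0.
- exact: tL2_normc_fin.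
- by move=> m xi; have := s_itv m xi; lra.
- apply: filterS deficit_ae => xi sx T; rewrite -(mulr0 (2 : R)).
  by apply: cvgMl_tmp; exact: sx.
Qed.

Lemma error_bound_cvg0 : error_bound (s m) F @[m --> \oo] --> 0%E.
Proof.
rewrite /error_bound /tnorm2.
under eq_fun do under eq_integral do rewrite nsqM nsq_real.
apply: (@torus_dominated_cvg0 (fun m xi => (2 * (1 - s m xi)) ^+ 2) (fun xi => nsq (F xi)) 4).
- by move=> m; apply: measurable_funX; apply: measurable_funM => //; exact: measurable_funB.
- exact: measurable_nsq.
- by move=> xi; exact: nsq_ge0.
- by case: lF.
- by move=> m xi; have := s_itv m xi; rewrite sqr_ge0 /=; nra.
- apply: filterS deficit_ae => xi sx T; rewrite (_ : 0 = 2 * 0 * (2 * 0) :> R); last by rewrite !mulr0.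
  by under eq_fun do rewrite expr2; apply: cvgM; apply: cvgMl_tmp; exact: sx.
Qed.

End limits.

Section filters.
Context {R : realType}.
Variable A : set R.

Lemma cvg_within_pinfty (a : nat -> R) : (forall m, A (a m)) ->
  (forall m, m%:R <= a m) -> a @ \oo --> within A +oo.
Proof.
move=> Aa ma P [C [_ CP]].
have [N NC] : exists N : nat, C < N%:R by exists (Num.bound `|C|); apply: le_lt_trans (archi_boundP _); rewrite ?ler_norm.
exists N => // m /= Nm; apply: CP => //; apply: lt_le_trans NC _.
by apply: le_trans (ma m); rewrite ler_nat.
Qed.

(** If [P] failed arbitrarily far out, the failures would form a sequence. This
    makes dominated convergence available for an uncountable parameter. *)
Lemma near_within_pinfty (P : R -> Prop) :
  (forall a : nat -> R, (forall m, A (a m)) -> (forall m, m%:R <= a m) ->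
    exists m, P (a m)) ->
  \forall a \near within A +oo, P a.
Proof.
move=> seqP; apply: contrapT => notP.
have bad (m : nat) : exists a, [/\ A a, m%:R <= a & ~ P a].
  apply: contrapT => /forallNP no; apply: notP; exists m%:R; split; first exact: num_real.
  move=> a ma Aa; apply: contrapT => nP; apply: (no a); split => //; exact: ltW.
have [a aP] := choice bad.
have [|m|m] := seqP a; try by case: (aP m).
by move=> m; case: (aP m).
Qed.

Lemma lattice_sums_to_unique n (u : 'rV[int]_n -> R[i]) (z w : R[i]) :
  lattice_sums_to u z -> lattice_sums_to u w -> z = w.
Proof.
move=> uz uw; apply/eqP; rewrite -subr_eq0; apply/eqP.
apply: (@small_normc0 R _ 2) => e e0.
have [J Jz] := uz e e0; have [K Kw] := uw e e0.
have h1 := Jz (J `|` K)%fset (fsubsetUl J K).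
have h2 := Kw (J `|` K)%fset (fsubsetUr J K).
rewrite (_ : z - w = (\sum_(j <- (J `|` K)%fset) u j - w) -
   (\sum_(j <- (J `|` K)%fset) u j - z)); last by ring.
apply: le_trans (normc_triangle _ _) _; rewrite normc_opp.
by rewrite mulrDl mul1r; apply: lerD; exact: ltW.
Qed.

Lemma lattice_sum_eq n (u : 'rV[int]_n -> R[i]) (z : R[i]) :
  lattice_sums_to u z -> lattice_sum u = z.
Proof.
move=> uz; apply: (lattice_sums_to_unique _ uz).
by apply: (@xgetPex _ 0 [set s | lattice_sums_to u s]); exists z.
Qed.

End filters.

(** * Convergence of the interpolants *)

Section assembly.
Context {R : realType} {n : nat}.
Local Notation mu := (lebesgue_rV R n).

Lemma cardinal_dominated (M : 'rV[int]_n -> R) (phi ph : 'rV[R]_n -> R) :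
  cardinal_interpolator phi ph ->
  (forall k xi, k != 0 -> cube xi -> xi != 0 -> fourier_ratio ph k xi <= M k) ->
  dominated_symbol M ph.
Proof.
case=> [[_ _ [[mph _] _] _] _ ph0 [delta d0 dph] _ _ _] ratioM; split => // xi cxi xi0.
exact: lt_le_trans d0 (dph xi cxi xi0).
Qed.

Lemma L2norm_le (g : 'rV[R]_n -> R[i]) (e : R) : 0 < e ->
  (\int[mu]_x (nsq (g x))%:E <= (e ^+ 2)%:E)%E -> (L2norm g <= e%:E)%E.
Proof.
move=> e0; rewrite L2normE; set I := integral _ _ _ => Ie.
have I0 : (0 <= I)%E by apply: integral_ge0 => x _; rewrite lee_fin nsq_ge0.
have fI : I \is a fin_num by rewrite ge0_fin_numE// (le_lt_trans Ie)// ltry.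
rewrite -(fineK fI) poweR_EFin powR12_sqrt ?fine_ge0// lee_fin.
by rewrite -(gtr0_norm e0) -sqrtr_sqr ler_wsqrtr// -lee_fin fineK.
Qed.

Lemma cvg_ge0_near (T : Type) (G : set_system T) {FG : Filter G} (u : T -> \bar R) :
  (forall a, 0 <= u a)%E -> (forall e : R, 0 < e -> \forall a \near G, (u a <= e%:E)%E) ->
  u @ G --> 0%E.
Proof.
move=> u0 ue; apply/fine_cvgP; split.
  apply: filterS (ue 1 ltr01) => a ua; rewrite ge0_fin_numE//.
  by apply: le_lt_trans ua _; exact: ltry.
apply/cvgrPdist_le => e e0; apply: filterS (ue e e0) => a ua /=.
rewrite sub0r normrN ger0_norm ?fine_ge0// -lee_fin fineK// ge0_fin_numE//.
by apply: le_lt_trans ua _; exact: ltry.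
Qed.

(** Countably many null sets have a null union. *)
Lemma ae_forall_countable (I : countType) (D : set 'rV[R]_n) (P : I -> 'rV[R]_n -> Prop) :
  (forall i, {ae mu, forall x, D x -> P i x}) ->
  {ae mu, forall x, D x -> forall i, P i x}.
Proof.
move=> aeP.
have : {ae mu, forall x, forall m, forall i, @choice.unpickle I m = Some i -> D x -> P i x}.
  apply: ae_foralln => m; case E : (choice.unpickle m) => [i|]; last exact: aeW.
  by apply: filterS (aeP i) => x Px j [<-].
by apply: filterS => x Px Dx i; apply: (Px (choice.pickle i)) => //; exact: choice.pickleK.
Qed.

End assembly.

Theorem theorem2 (R : realType) (n : nat) (n_gt0 : (0 < n)%N)
    (A : set R) (phi phihat : R -> 'rV[R]_n -> R)
    (family : regular_family A phi phihat)
    (f : 'rV[R]_n -> R[i]) (f_PW : paley_wiener f) :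
  [/\ forall a x, A a ->
        lattice_sums_to (interpolation_terms (phihat a) f x)
                        (interpolant (phihat a) f x),
      L2norm (fun x => interpolant (phihat a) f x - f x)
        @[a --> within A +oo] --> 0%E &
      forall e : R, 0 < e -> \forall a \near within A +oo, forall x,
        Normc.normc (interpolant (phihat a) f x - f x) <= e].
Proof.
have [cf fL [fhat ff fs]] := f_PW.
have [M sumM Mdom] := rf_dominated family.
have sym a : A a -> dominated_symbol M (phihat a).
  move=> Aa; apply: (cardinal_dominated (rf_cardinal family Aa)) => k xi.
  exact: Mdom.
pose F := periodized fhat; pose s a := weight (phihat a).
have lF : tL2 F := tL2_periodized ff.
have perF := @periodized_periodic R n fhat.
have fE := paley_wiener_inversion cf ff fs.
have ms a (Aa : A a) := measurable_weight (sym a Aa).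
have s0 a (Aa : A a) := weight_ge0 sumM (sym a Aa).
have s1 a (Aa : A a) := weight_partition sumM (sym a Aa).
have series a x : A a ->
    lattice_sums_to (interpolation_terms (phihat a) f x) (weighted_value (s a) F x).
  move=> Aa; have := weighted_series (ms a Aa) (s0 a Aa) (s1 a Aa) lF perF x.
  rewrite (_ : (fun j => _) = interpolation_terms (phihat a) f x)//.
  apply/funext => j; rewrite /interpolation_terms (coef_periodized cf ff fs).
  by rewrite (fundamental_weighted n_gt0 (sym a Aa)).
have valE a x : A a -> interpolant (phihat a) f x = weighted_value (s a) F x.
  by move=> Aa; exact: lattice_sum_eq (series a x Aa).
have ratio_cvg (a : nat -> R) : (forall m, A (a m)) -> (forall m, m%:R <= a m) ->
    {ae lebesgue_rV R n, forall xi, torus xi -> forall k, k != 0 ->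
      fourier_ratio (phihat (a m)) k xi @[m --> \oo] --> (0 : R)}.
  move=> Aa ma; apply: ae_forall_countable => k.
  have [->|k0] := eqVneq k 0; first by apply: aeW => xi _ /eqP.
  apply: filterS (rf_limit family k0) => xi lim T _.
  exact: cvg_comp (cvg_within_pinfty Aa ma) (lim (torus_cube T)).
have within_near := @near_within_pinfty R A.
split.
- by move=> a x Aa; rewrite valE//; exact: series.
- apply: cvg_ge0_near; first by move=> a; exact: Lnorm_ge0.
  move=> e e0; apply: within_near => a Aa ma.
  have e2 : 0 < e ^+ 2 by rewrite exprn_gt0.
  have := cvge0_near_small (error_bound_cvg0 n_gt0 sumM (fun m => sym _ (Aa m)) (ratio_cvg a Aa ma) lF) e2.
  move=> [N _ /(_ N (leqnn N)) /= small]; exists N; apply: L2norm_le => //.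
  apply: le_trans small; have AN := Aa N.
  under eq_integral do rewrite valE//.
  exact: (weighted_error_L2 (ms _ AN) (s0 _ AN) (s1 _ AN) lF perF fE).
- move=> e e0; apply: within_near => a Aa ma.
  have c0 := @fourier_const_gt0 R n.
  have ec : 0 < e / @fourier_const R n by rewrite divr_gt0.
  have := cvge0_near_small (sup_bound_cvg0 n_gt0 sumM (fun m => sym _ (Aa m)) (ratio_cvg a Aa ma) lF) ec.
  move=> [N _ /(_ N (leqnn N)) /= small]; exists N => x; have AN := Aa N.
  rewrite valE// -lee_fin.
  apply: le_trans (weighted_error_sup (ms _ AN) (s0 _ AN) (s1 _ AN) lF perF fE x) _.
  apply: (@le_trans _ _ ((@fourier_const R n)%:E * (e / @fourier_const R n)%:E)%E).
    by apply: lee_wpmul2l => //; rewrite lee_fin ltW.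
  by rewrite -EFinM lee_fin mulrC divfK// gt_eqF.
Qed.
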